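(* Let $g:[0,\infty)\to(0,\infty)$ be monotonically increasing with $1/g$ bounded, and let $g_0=g$, $g_n(t)=\int_0^t g_{n-1}(t')\,dt'$ for $n\in\mathbb{N}$. Then the operators $A_0,A_1,A_2,A_{12}$ (defined below on $\mathcal{S}$) satisfy, with all suprema over $\psi\in\mathcal{S}\setminus\{0\}$ and $t\ge 0$: \begin{align*} \sup_{\psi} \frac{\| A_0 \psi \|_g}{\| \psi \|_g} &\leq \frac{\lambda}{8\pi} \Big(\sup_{t} \frac{g_1(t)}{g(t)}\Big)^2,\\ \sup_{\psi} \frac{\| A_1 \psi \|_g}{\| \psi \|_g} &\leq \frac{\lambda m_1^2}{16\pi} \Big[ 3\Big(\sup_{t}\tfrac{t g_1(t)}{g(t)}\Big)\Big(\sup_{t}\tfrac{g_2(t)}{g(t)}\Big) + 3\Big( \sup_{t} \tfrac{g_1(t)}{g(t)} \Big)\Big( \sup_{t} \tfrac{tg_2(t)}{g(t)} \Big) + 2 \Big( \sup_{t} \tfrac{g_1(t)}{g(t)} \Big)\Big( \sup_{t} \tfrac{g_3(t)}{g(t)} \Big) \Big],\\ \sup_{\psi} \frac{\| A_2 \psi \|_g}{\| \psi \|_g} &\leq \frac{\lambda m_2^2}{16\pi} \Big[ 3\Big(\sup_{t}\tfrac{t g_1(t)}{g(t)}\Big)\Big(\sup_{t}\tfrac{g_2(t)}{g(t)}\Big) + 3\Big( \sup_{t} \tfrac{g_1(t)}{g(t)} \Big)\Big( \sup_{t} \tfrac{tg_2(t)}{g(t)} \Big) + 2 \Big( \sup_{t}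 \tfrac{g_1(t)}{g(t)} \Big)\Big( \sup_{t} \tfrac{g_3(t)}{g(t)} \Big) \Big],\\ \sup_{\psi} \frac{\| A_{12} \psi \|_g}{\| \psi \|_g} &\leq \frac{\lambda m_1^2 m_2^2}{96\pi} \Big[ \Big( \sup_{t} \tfrac{t^2 g_2(t)}{g(t)}\Big)\Big( \sup_{t} \tfrac{t g_1(t)}{g(t)}\Big) + \tfrac{1}{2} \Big( \sup_{t} \tfrac{t^2 g_3(t)}{g(t)}\Big)\Big( \sup_{t} \tfrac{g_1(t)}{g(t)}\Big) \Big]. \end{align*}
   Context: Let $\tfrac12\mathbb{M}=[0,\infty)\times\mathbb{R}^3$ with points $x=(x^0,\mathbf{x})$, and Minkowski square $x^2=(x^0)^2-|\mathbf{x}|^2$. Fix $\lambda>0$ and masses $m_1,m_2\ge 0$. Let $\mathcal{S}=\mathcal{S}((\tfrac12\mathbb{M})^2)$ be the Schwartz functions on $(\tfrac12\mathbb{M})^2$. For $g$ as in the claim, $\|\psi\|_g=\operatorname{ess\,sup}_{x,y\in\frac12\mathbb{M}}|\psi(x,y)|/(g(x^0)g(y^0))$. $H$ is the Heaviside function, $J_1$ the Bessel function of the first kind, $1_{\{\cdot\}}$ an indicator function, $dS(\omega)$ the surface measure on the unit sphere $S^2$. The operators are the rigorous versions, on test functions, of the formal operator $\psi\mapsto \frac{\lambda}{4\pi}\int d^4x'\,d^4y'\,G_1^{\rm ret}(x-x')G_2^{\rm ret}(y-y')\delta((x'-y')^2)\psi(x',y')$ over $(\frac12\mathbb M)^2$,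 where $G_k^{\rm ret}(x)=\frac{\delta(x^0-|\mathbf{x}|)}{4\pi|\mathbf{x}|}-\frac{m_k}{4\pi}H(x^0-|\mathbf{x}|)\frac{J_1(m_k\sqrt{x^2})}{\sqrt{x^2}}$; explicitly, for $\psi\in\mathcal{S}$ and $x,y\in\frac12\mathbb{M}$: $A_0$: for $\mathbf{y}'\in\mathbb{R}^3$ with $|\mathbf{y}'|<y^0$ set $b^0=x^0-y^0+|\mathbf{y}'|$, $\mathbf{b}=\mathbf{x}-\mathbf{y}-\mathbf{y}'$, $b^2=(b^0)^2-|\mathbf{b}|^2$; for $\omega\in S^2$ let $\cos\vartheta=\omega\cdot\mathbf{b}/|\mathbf{b}|$ and $r^*=\frac{b^2}{2(b^0+|\mathbf{b}|\cos\vartheta)}$. Then $(A_0\psi)(x,y)=\frac{\lambda}{(4\pi)^3}\int_{|\mathbf{y}'|<y^0}d^3\mathbf{y}'\int_{S^2}dS(\omega)\,\frac{|b^2|}{4(b^0+|\mathbf{b}|\cos\vartheta)^2|\mathbf{y}'|}\,\psi(x^0-r^*,\mathbf{x}+r^*\omega,\,y^0-|\mathbf{y}'|,\mathbf{y}+\mathbf{y}')\Big(1_{b^2>0}1_{b^0>0}1_{\cos\vartheta>\frac{b^2}{2x^0|\mathbf{b}|}-\frac{b^0}{|\mathbf{b}|}}+1_{b^2<0}1_{\cos\vartheta<\frac{b^2}{2x^0|\mathbf{b}|}-\frac{b^0}{|\mathbf{b}|}}\Big)$. $A_1$: $(A_1\psi)(x,y)=-\frac{\lambda m_1}{2(4\pi)^3}\int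 d^3\mathbf{x}'\int d^3\mathbf{y}'\,\frac{H(y^0-|\mathbf{y}-\mathbf{y}'|)}{|\mathbf{y}-\mathbf{y}'|\,|\mathbf{x}'-\mathbf{y}'|}\sum_{\sigma=\pm1}\Big[H(x'^0)H(x^0-x'^0-|\mathbf{x}-\mathbf{x}'|)\frac{J_1(m_1\sqrt{(x-x')^2})}{\sqrt{(x-x')^2}}\psi(x',y')\Big]$ where $y'^0=y^0-|\mathbf{y}-\mathbf{y}'|$ and $x'^0=y'^0+\sigma|\mathbf{x}'-\mathbf{y}'|$. $A_2$: the same with the roles of the two particles exchanged: $(A_2\psi)(x,y)=-\frac{\lambda m_2}{2(4\pi)^3}\int d^3\mathbf{x}'\int d^3\mathbf{y}'\,\frac{H(x^0-|\mathbf{x}-\mathbf{x}'|)}{|\mathbf{x}-\mathbf{x}'|\,|\mathbf{x}'-\mathbf{y}'|}\sum_{\sigma=\pm1}\Big[H(y'^0)H(y^0-y'^0-|\mathbf{y}-\mathbf{y}'|)\frac{J_1(m_2\sqrt{(y-y')^2})}{\sqrt{(y-y')^2}}\psi(x',y')\Big]$ where $x'^0=x^0-|\mathbf{x}-\mathbf{x}'|$, $y'^0=x'^0+\sigma|\mathbf{x}'-\mathbf{y}'|$. $A_{12}$: $(A_{12}\psi)(x,y)=\frac{\lambda m_1m_2}{2(4\pi)^3}\int_0^\infty dx'^0\int d^3\mathbf{x}'\int_0^\infty dy'^0\int_{S^2}dS(\omega)\,|x'^0-y'^0|\,H(x^0-x'^0-|\mathbf{x}-\mathbf{x}'|)\frac{J_1(m_1\sqrt{(x-x')^2})}{\sqrt{(x-x')^2}}H(y^0-y'^0-|\mathbf{y}-\mathbf{y}'|)\frac{J_1(m_2\sqrt{(y-y')^2})}{\sqrt{(y-y')^2}}\psi(x',y')$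 with $\mathbf{y}'=\mathbf{x}'-|x'^0-y'^0|\,\omega$. *)

(* Defs.v *)
From HB Require Import structures.
From mathcomp Require Import all_boot all_order all_algebra.
From mathcomp Require Import all_classical all_reals all_analysis.
From mathcomp Require Import ess_sup_inf.
Set Implicit Arguments.
Unset Strict Implicit.
Unset Printing Implicit Defensive.
Import Order.TTheory GRing.Theory Num.Theory.
Import numFieldNormedType.Exports.
Local Open Scope classical_set_scope.
Local Open Scope ring_scope.

Definition V3 (R : realType) := (R * R * R)%type.
Definition point (R : realType) := (R * V3 R)%type.  (* x = (x^0, bold x) *)

Definition v3 {R : realType} (a b c : R) : V3 R := (a, b, c).
Definition vadd {R : realType} (u v : V3 R) : V3 R :=
  (u.1.1 + v.1.1, u.1.2 + v.1.2, u.2 + v.2).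
Definition vsub {R : realType} (u v : V3 R) : V3 R :=
  (u.1.1 - v.1.1, u.1.2 - v.1.2, u.2 - v.2).
Definition vscale {R : realType} (a : R) (u : V3 R) : V3 R :=
  (a * u.1.1, a * u.1.2, a * u.2).
Definition vdot {R : realType} (u v : V3 R) : R :=
  u.1.1 * v.1.1 + u.1.2 * v.1.2 + u.2 * v.2.
Definition vnorm {R : realType} (u : V3 R) : R := Num.sqrt (vdot u u).

Definition msq_diff {R : realType} (x x' : point R) : R :=
  (x.1 - x'.1) ^+ 2 - (vnorm (vsub x.2 x'.2)) ^+ 2.

Definition heav {R : realType} (t : R) : R := if 0 <= t then 1 else 0.
Definition ind {R : realType} (P : Prop) : R := if `[< P >] then 1 else 0.

Definition besselJ1 {R : realType} (z : R) : R :=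
  limn (series (fun k : nat =>
    (-1) ^+ k / ((k`!)%:R * ((k.+1)`!)%:R) * (z / 2) ^+ (2 * k + 1))).

Notation leb R := (@lebesgue_measure R).
Notation mu3 R := ((leb R \x leb R) \x leb R)%E.
Notation mu8 R :=
  (((((((leb R \x leb R) \x leb R) \x leb R) \x leb R) \x leb R) \x leb R) \x leb R)%E.
Definition R8 (R : realType) := (R * R * R * R * R * R * R * R)%type.
Definition pair_of_R8 {R : realType} (z : R8 R) : point R * point R :=
  let '(x0, x1, x2, x3, y0, y1, y2, y3) := z in
  ((x0, (x1, x2, x3)), (y0, (y1, y2, y3))).

Definition int3 {R : realType} (f : V3 R -> R) : R := Rintegral (mu3 R) setT f.
Definition int_half {R : realType} (f : R -> R) : R :=
  Rintegral (leb R) `[0, +oo[ f.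

Definition sph {R : realType} (th ph : R) : V3 R :=
  (sin th * cos ph, sin th * sin ph, cos th).
Definition int_S2 {R : realType} (F : V3 R -> R) : R :=
  Rintegral (leb R) `[0, pi] (fun th =>
    Rintegral (leb R) `[0, 2 * pi] (fun ph => F (sph th ph) * sin th)).

Definition A0r {R : realType} (lam : R) (psi : point R -> point R -> R)
    (x y : point R) : R :=
  lam / (4 * pi) ^+ 3 *
  int3 (fun y' : V3 R =>
    ind (vnorm y' < y.1) *
    (let b0 := x.1 - y.1 + vnorm y' in
     let bv := vsub (vsub x.2 y.2) y' in
     let bn := vnorm bv in
     let b2 := b0 ^+ 2 - bn ^+ 2 in
     int_S2 (fun w : V3 R =>
       let c := vdot w bv / bn in
       let rs := b2 / (2 * (b0 + bn * c)) in
       `|b2| / (4 * (b0 + bn * c) ^+ 2 * vnorm y') *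
       psi (x.1 - rs, vadd x.2 (vscale rs w)) (y.1 - vnorm y', vadd y.2 y') *
       (ind (0 < b2) * ind (0 < b0) * ind (b2 / (2 * x.1 * bn) - b0 / bn < c)
        + ind (b2 < 0) * ind (c < b2 / (2 * x.1 * bn) - b0 / bn))))).

Definition A1r {R : realType} (lam m1 : R) (psi : point R -> point R -> R)
    (x y : point R) : R :=
  - (lam * m1) / (2 * (4 * pi) ^+ 3) *
  int3 (fun xv' : V3 R => int3 (fun yv' : V3 R =>
    let y'0 := y.1 - vnorm (vsub y.2 yv') in
    heav (y.1 - vnorm (vsub y.2 yv')) /
      (vnorm (vsub y.2 yv') * vnorm (vsub xv' yv')) *
    \sum_(s <- [:: 1; -1])
      (let x' : point R := (y'0 + s * vnorm (vsub xv' yv'), xv') in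
       heav x'.1 * heav (x.1 - x'.1 - vnorm (vsub x.2 xv')) *
       (besselJ1 (m1 * Num.sqrt (msq_diff x x')) / Num.sqrt (msq_diff x x')) *
       psi x' (y'0, yv')))).

Definition A2r {R : realType} (lam m2 : R) (psi : point R -> point R -> R)
    (x y : point R) : R :=
  - (lam * m2) / (2 * (4 * pi) ^+ 3) *
  int3 (fun xv' : V3 R => int3 (fun yv' : V3 R =>
    let x'0 := x.1 - vnorm (vsub x.2 xv') in
    heav (x.1 - vnorm (vsub x.2 xv')) /
      (vnorm (vsub x.2 xv') * vnorm (vsub xv' yv')) *
    \sum_(s <- [:: 1; -1])
      (let y' : point R := (x'0 + s * vnorm (vsub xv' yv'), yv') in
       heav y'.1 * heav (y.1 - y'.1 - vnorm (vsub y.2 yv')) *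
       (besselJ1 (m2 * Num.sqrt (msq_diff y y')) / Num.sqrt (msq_diff y y')) *
       psi (x'0, xv') y'))).

Definition A12r {R : realType} (lam m1 m2 : R) (psi : point R -> point R -> R)
    (x y : point R) : R :=
  lam * m1 * m2 / (2 * (4 * pi) ^+ 3) *
  int_half (fun x'0 : R => int3 (fun xv' : V3 R => int_half (fun y'0 : R =>
    int_S2 (fun w : V3 R =>
      let x' : point R := (x'0, xv') in
      let y' : point R := (y'0, vsub xv' (vscale `|x'0 - y'0| w)) in
      `|x'0 - y'0| *
      (heav (x.1 - x'.1 - vnorm (vsub x.2 x'.2)) *
       (besselJ1 (m1 * Num.sqrt (msq_diff x x')) / Num.sqrt (msq_diff x x'))) *
      (heav (y.1 - y'.1 - vnorm (vsub y.2 y'.2)) *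
       (besselJ1 (m2 * Num.sqrt (msq_diff y y')) / Num.sqrt (msq_diff y y'))) *
      psi x' y')))).

(* complex-valued functions are represented as pairs (real part, imaginary part);
   the kernels are real, so the operators act componentwise *)
Definition cfun (R : realType) := point R -> point R -> (R * R)%type.
Definition lift_op {R : realType}
    (A : (point R -> point R -> R) -> point R -> point R -> R) (psi : cfun R) : cfun R :=
  fun x y => (A (fun a b => (psi a b).1) x y, A (fun a b => (psi a b).2) x y).

Definition A0 {R : realType} (lam : R) := lift_op (A0r lam).
Definition A1 {R : realType} (lam m1 : R) := lift_op (A1r lam m1).
Definition A2 {R : realType} (lam m2 : R) := lift_op (A2r lam m2).
Definition A12 {R : realType} (lam m1 m2 : R) := lift_op (A12r lam m1 m2).

Definition cmod {R : realType} (z : R * R) : R := Num.sqrt (z.1 ^+ 2 + z.2 ^+ 2).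

Definition gwnorm {R : realType} (g : R -> R) (psi : cfun R) : \bar R :=
  ess_sup (mu8 R) (fun z : R8 R =>
    let xy := pair_of_R8 z in
    if (0 <= xy.1.1) && (0 <= xy.2.1)
    then (cmod (psi xy.1 xy.2) / (g xy.1.1 * g xy.2.1))%:E
    else -oo%E).

Definition iterD {R : realType} (f : 'rV[R]_8 -> R) (s : seq 'I_8) : 'rV[R]_8 -> R :=
  foldr (fun i h => 'D_(delta_mx 0 i) h) f s.
Definition schwartz8 {R : realType} (f : 'rV[R]_8 -> R) : Prop :=
  (forall (s : seq 'I_8) (z : 'rV[R]_8), differentiable (iterD f s) z) /\
  (forall (s : seq 'I_8) (k : nat), exists C : R,
     forall z : 'rV[R]_8, (1 + `|z|) ^+ k * `|iterD f s z| <= C).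
Definition coords8 {R : realType} (x y : point R) : 'rV[R]_8 :=
  \row_(i < 8) nth 0 [:: x.1; x.2.1.1; x.2.1.2; x.2.2; y.1; y.2.1.1; y.2.1.2; y.2.2] i.
Definition halfM {R : realType} (x : point R) : Prop := 0 <= x.1.
Definition schwartz_half {R : realType} (psi : cfun R) : Prop :=
  exists fr fi : 'rV[R]_8 -> R, schwartz8 fr /\ schwartz8 fi /\
    forall x y : point R, halfM x -> halfM y ->
      psi x y = (fr (coords8 x y), fi (coords8 x y)).

Fixpoint gn {R : realType} (g : R -> R) (n : nat) : R -> R :=
  match n with
  | 0 => g
  | n'.+1 => fun t => Rintegral (leb R) `[0, t] (gn g n')
  end.
Definition supt {R : realType} (h : R -> R) : \bar R :=
  ereal_sup [set (h t)%:E | t in `[0, +oo[%classic].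

(* Main.v *)
Require Import Defs.
From HB Require Import structures.
From mathcomp Require Import all_boot all_order all_algebra.
From mathcomp Require Import all_classical all_reals all_analysis.
From mathcomp Require Import measurable_realfun ess_sup_inf ring lra.
Set Implicit Arguments.
Unset Strict Implicit.
Unset Printing Implicit Defensive.
Import Order.TTheory GRing.Theory Num.Theory.
Import numFieldNormedType.Exports.
Local Open Scope classical_set_scope.
Local Open Scope ring_scope.

(** Schwartz functions have a finite weighted norm, and one may replace [g] by
    the monotone function [gext g], which vanishes at negative times, so that
    [|psi(x, y)| <= N g(x^0) g(y^0)] holds everywhere on the half spaces and not
    merely almost everywhere.  The Bessel kernel obeys [|J_1(m r) / r| <= m / 2],
    by an energy estimate for the Bessel equation.  Each operator is then
    dominated by an iterated integral of a nonnegative explicit kernel against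
    [g].

    For [A_0], rotation invariance reduces the integral over the sphere to one
    over [s = cos theta] in [[-1, 1]], and the substitution [s |-> r^*] turns the
    density into [dr^* / (2 |b|)], which leaves [g_1(x^0) / (2 |b|)].  The
    remaining factor [1 / (|y'| |b|)] is at most [1 / |y'|^2 + 1 / |b|^2] when
    weighted by a decreasing function, and both terms are radial integrals.
    For [A_1], [A_2] and [A_12] the spatial integrals are radial after Tonelli,
    and what is left are the convolutions
    [g_(n+1)(t) = int_0^t (t - s)^n / n! g(s) ds].

    A complex value [(X, Y)] is controlled by [a |X| + b |Y|] for all
    [a, b >= 0] with [a^2 + b^2 = 1].  This is a superadditive estimate, which
    passes through the iterated integrals without any measurability of the
    inner integrands. *)

(** The operators integrate [psi] over light cones, which are null sets of the eight-dimensional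
    space, so an essential bound on [psi] has to be upgraded to a bound at every point; continuity
    of [psi] does this, although [g] may jump. Off the half spaces [psi] is arbitrary, and nothing
    is known about the measurability of the nested real integrals in their outer variables. Hence
    every estimate is a domination, and only explicit measurable majorants are ever integrated
    exactly. The suprema may be infinite, so the final bounds are compared in the extended reals,
    factor by nonnegative factor.

    The constants are geometric. For [A_0], [8 pi^2] is [2 pi / 2] from the sphere times two radial
    integrals with factor [4 pi] each. For [A_1] and [A_2], [16 pi^2] is [(4 pi)^2], from radial
    integrations around two successive vertices. For [A_12], [16 pi^2 / 3] is the area [4 pi] of the
    sphere times the factor [4 pi / 3] of the volume of a ball. Each Bessel kernel adds a factor
    [m / 2]. *)

Local Notation mV3 R := (measurableTypeR R * measurableTypeR R * measurableTypeR R)%type.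

(** * Lower integrals of functions that may fail to be measurable *)

Section lower_integral.
Local Open Scope ereal_scope.
Context d (T : measurableType d) (R : realType).
Variable mu : {measure set T -> \bar R}.
Implicit Types (D : set T) (f : T -> \bar R).

Import HBNNSimple.

Lemma ge0_le_lower_integral D f1 f2 : (forall x, D x -> 0 <= f1 x) ->
  (forall x, D x -> f1 x <= f2 x) ->
  \int[mu]_(x in D) f1 x <= \int[mu]_(x in D) f2 x.
Proof.
move=> f10 f12.
have f20 x : D x -> 0 <= f2 x by move=> Dx; exact: le_trans (f10 _ Dx) (f12 _ Dx).
rewrite !ge0_integralE//; apply: ge_ereal_sup => _ [h /= hf <-].
apply: ereal_sup_ubound; exists h => //= x; apply: le_trans (hf x) _.
by rewrite !patchE; case: ifPn => // /[!inE] /f12.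
Qed.

(** A simple function below [f1] plus one below [f2] lies below the sum. Only this inequality
    survives without measurability, and it points the right way for majorants. *)
Lemma ge0_lower_integralD_ge D f1 f2 : (forall x, D x -> 0 <= f1 x) ->
  (forall x, D x -> 0 <= f2 x) ->
  \int[mu]_(x in D) f1 x + \int[mu]_(x in D) f2 x <=
  \int[mu]_(x in D) (f1 x + f2 x).
Proof.
move=> f10 f20.
have f120 x : D x -> 0 <= f1 x + f2 x by move=> Dx; rewrite adde_ge0 ?f10 ?f20.
have [->|i1] := eqVneq (\int[mu]_(x in D) (f1 x + f2 x)) +oo; first by rewrite leey.
have le1 : \int[mu]_(x in D) f1 x <= \int[mu]_(x in D) (f1 x + f2 x).
  by apply: ge0_le_lower_integral => // x Dx; rewrite leeDl ?f20.
have le2 : \int[mu]_(x in D) f2 x <= \int[mu]_(x in D) (f1 x + f2 x).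
  by apply: ge0_le_lower_integral => // x Dx; rewrite leeDr ?f10.
have fin f : (forall x, D x -> 0 <= f x) ->
    \int[mu]_(x in D) f x <= \int[mu]_(x in D) (f1 x + f2 x) ->
    \int[mu]_(x in D) f x \is a fin_num.
  move=> f0 ff; rewrite ge0_fin_numE ?integral_ge0//.
  by apply: le_lt_trans ff _; rewrite ltey.
(* Both integrals are finite here, so each in turn can be moved across and replaced by one of its
   simple minorants. *)
rewrite -leeBrDr; last exact: fin.
rewrite [leLHS]ge0_integralE//; apply: ge_ereal_sup => _ [h1 /= hf1 <-].
rewrite leeBrDr; last exact: fin.
have hfin : sintegral mu h1 \is a fin_num.
  rewrite ge0_fin_numE ?sintegral_ge0//; apply: (@le_lt_trans _ _ (\int[mu]_(x in D) f1 x)).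
    by rewrite ge0_integralE//; apply: ereal_sup_ubound; exists h1.
  by rewrite -ge0_fin_numE ?integral_ge0// fin.
rewrite addeC -leeBrDr//.
rewrite [leLHS]ge0_integralE//; apply: ge_ereal_sup => _ [h2 /= hf2 <-].
rewrite leeBrDr// -sintegralD.
rewrite ge0_integralE//; apply: ereal_sup_ubound; exists (add_nnsfun h2 h1) => //= x.
have := hf1 x; have := hf2 x; rewrite !patchE; case: ifPn => // xD h2x h1x.
  by rewrite EFinD addeC leeD.
by rewrite EFinD (le_trans (leeD h2x h1x))//= adde0.
Qed.

Lemma ge0_lower_integralZl_ge D f (k : R) : (0 <= k)%R -> (forall x, D x -> 0 <= f x) ->
  k%:E * \int[mu]_(x in D) f x <= \int[mu]_(x in D) (k%:E * f x).
Proof.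
move=> k0 f0; have [->|kN0] := eqVneq k 0%R.
  by rewrite mul0e integral_ge0// => x Dx; rewrite mul0e.
have kp : (0 < k)%R by rewrite lt_def kN0.
rewrite -lee_pdivlMl// ge0_integralE//; apply: ge_ereal_sup => _ [h /= hf <-].
rewrite lee_pdivlMl// -sintegralrM ge0_integralE; last first.
  by move=> x Dx; rewrite mule_ge0 ?lee_fin ?f0.
apply: ereal_sup_ubound; exists (scale_nnsfun h k0) => //= x.
have := hf x; rewrite !patchE EFinM; case: ifPn => // xD hx.
  by rewrite lee_pmul2l.
by rewrite (@le_trans _ _ (k%:E * 0))// ?lee_pmul2l// mule0.
Qed.

(* No measurability is needed: for nonnegative functions the integral is a
   supremum over simple functions, hence monotone and superadditive. *)
Lemma Rintegral_pair_le D (f1 f2 : T -> R) (H : T -> \bar R) (a b : R) :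
  (0 <= a)%R -> (0 <= b)%R ->
  (forall x, D x -> (a * `|f1 x| + b * `|f2 x|)%:E <= H x) ->
  (a * `|Rintegral mu D f1| + b * `|Rintegral mu D f2|)%:E <= \int[mu]_(x in D) H x.
Proof.
move=> a0 b0 fH.
(* The integral is the difference of the lower integrals of the positive and negative parts, each
   between 0 and that of [|f|]. If either is infinite, so is the right-hand side. *)
have absR (f : T -> R) : `|Rintegral mu D f|%:E <= \int[mu]_(x in D) `|f x|%:E.
  rewrite /Rintegral.
  have abs0 : 0 <= \int[mu]_(x in D) `|f x|%:E.
    by apply: integral_ge0 => x _; rewrite lee_fin.
  have := integralE mu D (EFin \o f) => /= ->.
  have le1 : \int[mu]_(x in D) ((EFin \o f)^\+ x) <= \int[mu]_(x in D) `|f x|%:E.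
    apply: ge0_le_lower_integral => // x _; rewrite funeposE /=.
    by rewrite -EFin_max lee_fin ge_max ler_norm normr_ge0.
  have le2 : \int[mu]_(x in D) ((EFin \o f)^\- x) <= \int[mu]_(x in D) `|f x|%:E.
    apply: ge0_le_lower_integral => // x _; rewrite funenegE /=.
    by rewrite -EFin_max lee_fin ge_max normr_ge0 -normrN ler_norm.
  have p1 : 0 <= \int[mu]_(x in D) ((EFin \o f)^\+ x) by exact: integral_ge0.
  have p2 : 0 <= \int[mu]_(x in D) ((EFin \o f)^\- x) by exact: integral_ge0.
  move: (\int[mu]_(x in D) _) (\int[mu]_(x in D) _) (\int[mu]_(x in D) _) le1 le2 p1 p2 abs0.
  move=> [m| |] [p| |] [n| |] //=; rewrite ?lee_fin ?normr0 ?leey//.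
  by move=> pm nm p0 n0 m0; rewrite ler_norml; apply/andP; split; lra.
apply: (@le_trans _ _ (a%:E * \int[mu]_(x in D) `|f1 x|%:E +
                       b%:E * \int[mu]_(x in D) `|f2 x|%:E)).
  by rewrite EFinD !EFinM leeD// lee_wpmul2l// lee_fin.
apply: (@le_trans _ _ (\int[mu]_(x in D) (a%:E * `|f1 x|%:E) +
                       \int[mu]_(x in D) (b%:E * `|f2 x|%:E))).
  by apply: leeD; apply: ge0_lower_integralZl_ge => // x _; rewrite lee_fin.
apply: (le_trans (ge0_lower_integralD_ge _ _)) => [x _|x _|].
- by rewrite -EFinM lee_fin mulr_ge0.
- by rewrite -EFinM lee_fin mulr_ge0.
apply: ge0_le_lower_integral => [x _|x Dx].
  by rewrite -!EFinM -EFinD lee_fin addr_ge0// mulr_ge0.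
by rewrite -!EFinM -EFinD fH.
Qed.

End lower_integral.

(** * Image measures with densities *)

Section weighted_pushforward.
Local Open Scope ereal_scope.
Context d (X : measurableType d) (R : realType).
Variables (mu : {measure set X -> \bar R}) (w : X -> R) (phi : X -> R).
Hypotheses (mw : measurable_fun setT w) (w0 : forall x, (0 <= w x)%R).
Hypothesis mphi : measurable_fun setT phi.

(** The image under [phi] of the measure with density [w]. The proofs are arguments so that the
    measure structure can be inferred from the term itself. *)
Definition wpush of measurable_fun setT w & (forall x, (0 <= w x)%R) &
  measurable_fun setT phi : set R -> \bar R :=
  fun A => \int[mu]_(x in phi @^-1` A) (w x)%:E.

Local Notation nu := (wpush mw w0 mphi).

Let wpush0 : nu set0 = 0.
Proof. by rewrite /wpush preimage_set0 integral_set0. Qed.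

Let wpush_ge0 A : 0 <= nu A.
Proof. by apply: integral_ge0 => x _; rewrite lee_fin. Qed.

Let wpush_sigma_additive : semi_sigma_additive nu.
Proof.
move=> F mF tF mUF; rewrite /wpush; apply: cvg_toP.
  apply: ereal_nondecreasing_is_cvgn => m n mn.
  by apply: lee_sum_nneg_natr => // k _ _; apply: integral_ge0 => x _; rewrite lee_fin.
rewrite preimage_bigcup ge0_integral_bigcup//=.
- by move=> k; rewrite -[_ @^-1` _]setTI; exact: mphi.
- exact/measurable_EFinP/measurable_funTS.
- by move=> x _; rewrite lee_fin.
- apply/trivIsetP => i j _ _ ij; rewrite -preimage_setI.
  by move/trivIsetP : tF => ->//; rewrite preimage_set0.
Qed.

HB.instance Definition _ := isMeasure.Build _ _ _ nu
  wpush0 wpush_ge0 wpush_sigma_additive.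

Import HBNNSimple.

Let integral_wpush_nnsfun (f : {nnsfun R >-> R}) :
  \int[nu]_y (f y)%:E = \int[mu]_x ((w x)%:E * (f (phi x))%:E).
Proof.
have mr r : measurable (phi @^-1` (f @^-1` [set r])).
  by rewrite -[_ @^-1` _]setTI; apply: mphi.
under [LHS]eq_integral do rewrite fimfunE -fsumEFin//.
rewrite [LHS]ge0_integral_fsum//; last 2 first.
  - by move=> r; exact/measurable_EFinP/measurableT_comp.
  - by move=> n x _; rewrite EFinM nnfun_muleindic_ge0.
under [RHS]eq_integral.
  move=> x xD; rewrite fimfunE -fsumEFin// ge0_mule_fsumr; last first.
    by move=> r; rewrite EFinM nnfun_muleindic_ge0.
  over.
rewrite [RHS]ge0_integral_fsum//; last 2 first.
  - move=> r; apply: emeasurable_funM; first exact/measurable_EFinP.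
    apply/measurable_EFinP; apply: measurable_funM => //.
    by apply: measurableT_comp mphi; exact: measurable_indic.
  - move=> n x _; apply: mule_ge0; first by rewrite lee_fin.
    by rewrite EFinM nnfun_muleindic_ge0.
apply: eq_fsbigr => r /[!inE] -[y _ fyr].
rewrite integralZl_indic_nnsfun//= integral_indic//= setIT /wpush.
under [RHS]eq_integral do rewrite EFinM muleCA.
have r0 : (0 <= r)%R by rewrite -fyr.
rewrite ge0_integralZl//=; last 2 first.
  - apply: emeasurable_funM; [exact/measurable_EFinP|]; apply/measurable_EFinP.
    by apply: measurableT_comp mphi; exact: measurable_indic.
  - by move=> x _; rewrite mule_ge0// ?lee_fin.
congr (_ * _); rewrite [LHS]integral_mkcond; apply: eq_integral => x _.
rewrite patchE indicE (_ : (phi x \in _) = (x \in phi @^-1` (f @^-1` [set r]))); last first.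
  by apply/idP/idP; rewrite !inE.
by case: ifPn => _; rewrite ?mule1 ?mule0.
Qed.

Lemma integral_wpush (f : R -> \bar R) :
  measurable_fun setT f -> (forall x, 0 <= f x) ->
  \int[nu]_y f y = \int[mu]_x ((w x)%:E * f (phi x)).
Proof.
move=> mf f0; pose f_ := nnsfun_approx measurableT mf.
transitivity (lim (\int[nu]_x (f_ n x)%:E @[n --> \oo])).
  rewrite -monotone_convergence//=.
  - apply: eq_integral => ? /[!inE] xD; apply/esym/cvg_lim => //=.
    exact: cvg_nnsfun_approx.
  - by move=> n; exact/measurable_EFinP/measurable_funTS.
  - by move=> n ? _; rewrite lee_fin.
  - by move=> ? _ ? ? mn; rewrite lee_fin; exact/lefP/nd_nnsfun_approx.
under eq_fun do rewrite integral_wpush_nnsfun.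
rewrite -monotone_convergence//=.
- apply: eq_integral => x _; apply/cvg_lim => //=.
  apply: cvgeZl => //.
  exact: cvg_nnsfun_approx.
- move=> n; apply: emeasurable_funM; [exact/measurable_EFinP|]; apply/measurable_EFinP.
  exact: measurableT_comp mphi.
- by move=> n ? _; rewrite mule_ge0// ?lee_fin.
- move=> x _ m n mn; rewrite lee_wpmul2l ?lee_fin//.
  exact/lefP/nd_nnsfun_approx.
Qed.

End weighted_pushforward.

(* Equality in law: it suffices to test on the rays ]-oo, c[. *)
Lemma integral_eq_law (R : realType) (d1 d2 : measure_display)
    (X : measurableType d1) (Y : measurableType d2)
    (mu : {measure set X -> \bar R}) (nu : {measure set Y -> \bar R})
    (u : X -> R) (v : Y -> R) (phi : X -> R) (psi : Y -> R) :
  measurable_fun setT u -> (forall x, 0 <= u x) -> measurable_fun setT phi ->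
  measurable_fun setT v -> (forall x, 0 <= v x) -> measurable_fun setT psi ->
  (forall c : R, \int[mu]_(x in [set x | (phi x < c)%R]) (u x)%:E < +oo)%E ->
  (forall c : R, \int[mu]_(x in [set x | (phi x < c)%R]) (u x)%:E =
                 \int[nu]_(y in [set y | (psi y < c)%R]) (v y)%:E)%E ->
  forall f : R -> \bar R, measurable_fun setT f -> (forall x, 0 <= f x)%E ->
  (\int[mu]_x ((u x)%:E * f (phi x)) = \int[nu]_y ((v y)%:E * f (psi y)))%E.
Proof.
move=> mu' u0 mphi mv v0 mpsi fin uv f mf f0.
rewrite -(integral_wpush mu mu' u0 mphi)// -(integral_wpush nu mv v0 mpsi)//.
apply: eq_measure_integral => A mA _.
have Eray (c : R) Z (p : Z -> R) : p @^-1` `]-oo, c[%classic = [set x | (p x < c)%R].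
  by apply/seteqP; split => x /=; rewrite in_itv.
apply: (measure_unique (@RGenInftyO.G R) (fun n : nat => `]-oo, n%:R[%classic)) => //.
- exact: RGenInftyO.measurableE.
- move=> _ _ [a ->] [b ->]; exists (Num.min a b); apply/seteqP; split => x /=;
    by rewrite !in_itv/= lt_min => /andP.
- by move=> n; exists n%:R.
- apply/seteqP; split => x //= _; exists (Num.truncn x).+1 => //=.
  by rewrite in_itv/= truncnS_gt.
- move=> _ [c ->] /=; rewrite /wpush !Eray; exact: uv.
- by move=> n; rewrite /= /wpush Eray.
Qed.

Section measurable_real_functions.
Context {R : realType}.

Lemma measurable_invr : measurable_fun [set: R] (@GRing.inv R).
Proof.
rewrite (_ : GRing.inv = fun x : R => if x == 0 then 0 else x^-1); last first.
  by apply/funext => x; case: eqP => // ->; rewrite invr0.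
apply: measurable_fun_if => //.
  by apply: measurable_fun_eqr.
rewrite setTI (_ : _ @^-1` _ = ~` [set 0]); last first.
  by apply/seteqP; split => x /=; [move=> /eqP|move=> /eqP/negbTE].
apply: open_continuous_measurable_fun.
  by apply: closed_openC; exact: closed_eq.
by move=> x /[!inE]/= /eqP x0; exact: inv_continuous.
Qed.

Lemma measurable_sqrtr : measurable_fun [set: R] (@Num.sqrt R).
Proof. by apply: nondecreasing_measurable => // x y; exact: ler_wsqrtr. Qed.

End measurable_real_functions.

(** * One-dimensional change of variables *)

Section substitution.
Context {R : realType}.
Local Notation mu := (@lebesgue_measure R).

(** The density [f] on [[a, b]] transported by [F] and Lebesgue measure on [[F a, F b]] agree on
    rays by the fundamental theorem of calculus, hence as measures. This reaches integrands [H] that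
    are merely measurable, such as those built from the monotone function [gext g]. *)
Lemma ge0_integral_subst_incr (F f : R -> R) (a b : R) (H : R -> \bar R) :
  a < b -> (forall x, x \in `[a, b] -> is_derive x 1 F (f x)) ->
  {within `[a, b], continuous f} -> (forall x, x \in `]a, b[ -> 0 < f x) ->
  (forall x, x \in `[a, b] -> 0 <= f x) ->
  measurable_fun setT H -> (forall x, 0 <= H x)%E ->
  (\int[mu]_(x in `[a, b]) ((f x)%:E * H (F x)) = \int[mu]_(y in `[F a, F b]) H y)%E.
Proof.
move=> ab dF cf fp f0 mH H0.
have cF : {within `[a, b], continuous F}.
  by apply: derivable_within_continuous => x /dF [].
have inF : {in `[a, b] &, {homo F : x y / x < y}}.
  move=> x y; rewrite !in_itv/= => /andP[ax _] /andP[_ yb] xy.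
  apply: (@gtr0_derive1_incr _ F a b) => //.
  - by move=> z /subset_itv_oo_cc /dF [].
  - by move=> z zab; rewrite derive1E; have [_ ->] := dF _ (subset_itv_oo_cc zab); exact: fp.
have aab : a \in `[a, b] by rewrite in_itv/= lexx ltW.
have bab : b \in `[a, b] by rewrite in_itv/= lexx ltW.
have Fab : F a < F b by exact: inF.
have Fcont x : x \in `[a, b] -> {for x, continuous F}.
  by move=> /dF [+ _] => /derivable1_diffP/differentiable_continuous.
have FTC m : a < m -> m <= b ->
    (\int[mu]_(x in `[a, m]) (f x)%:E = (F m)%:E - (F a)%:E)%E.
  move=> am mb; have sub : {subset `[a, m] <= `[a, b]}.
    by move=> x; rewrite !in_itv/= => /andP[-> /le_trans->].
  apply: continuous_FTC2 => //.
  - by apply: continuous_subspaceW cf.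
  - split.
    + by move=> x /subset_itv_oo_cc /sub /dF [].
    + by apply: cvg_at_right_filter; apply: Fcont.
    + by apply: cvg_at_left_filter; apply: Fcont; rewrite in_itv/= (ltW am).
  - by move=> x /subset_itv_oo_cc /sub xab; rewrite derive1E; have [_ ->] := dF _ xab.
(* Off [[a, b]] the weight [u] is 0, so the default value taken there by [phi] has no effect. *)
pose u := f \_ `[a, b]; pose v : R -> R := \1_(`[F a, F b]).
pose phi := F \_ `[a, b].
have mu' : measurable_fun setT u.
  apply/(measurable_restrictT _ (measurable_itv _)).
  by apply: subspace_continuous_measurable_fun.
have mphi : measurable_fun setT phi.
  apply/(measurable_restrictT _ (measurable_itv _)).
  by apply: subspace_continuous_measurable_fun.
have u0 x : 0 <= u x by rewrite /u patchE; case: ifPn => // /[!inE]; exact: f0.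
have law := @integral_eq_law R _ _ _ _ mu mu u v phi id mu' u0 mphi.
have mv : measurable_fun setT v by exact: measurable_indic.
have v0 x : 0 <= v x by rewrite /v indicE.
have -> : (\int[mu]_(x in `[a, b]) ((f x)%:E * H (F x)) =
           \int[mu]_x ((u x)%:E * H (phi x)))%E.
  rewrite integral_mkcond; apply: eq_integral => x _.
  by rewrite /u /phi !patchE; case: ifPn => //; rewrite mul0e.
have -> : (\int[mu]_(x in `[F a, F b]) H x =
           \int[mu]_x ((v x)%:E * H x))%E.
  rewrite integral_mkcond; apply: eq_integral => x _.
  by rewrite /v indicE !patchE; case: ifPn => //= _; rewrite ?mul0e ?mul1e.
have key c : (\int[mu]_(x in [set x | (phi x < c)%R]) (u x)%:E =
              \int[mu]_(y in [set y | (y < c)%R]) (v y)%:E)%E.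
  have -> : (\int[mu]_(x in [set x | (phi x < c)%R]) (u x)%:E =
      \int[mu]_(x in `[a, b] `&` [set x | (F x < c)%R]) (f x)%:E)%E.
    rewrite [LHS]integral_mkcond [RHS]integral_mkcond; apply: eq_integral => x _.
    rewrite !patchE /u /phi in_setI patchE.
    have [xab|xab] := boolP (x \in `[a, b]%classic) => /=.
      by rewrite (_ : (x \in _) = (x \in [set x | F x < c]))//;
        apply/idP/idP; rewrite !inE/= /phi patchE xab.
    by case: ifPn.
  rewrite integral_indic//; last first.
    by rewrite (_ : [set y | _] = `]-oo, c[%classic)//;
      apply/seteqP; split => x /=; rewrite in_itv.
  have [cFa|Fac] := leP c (F a).
    rewrite (_ : _ `&` _ = set0); last first.
      apply/seteqP; split => x //= -[xab]; rewrite ltNge (le_trans cFa)//.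
      have := xab; rewrite in_itv/= => /andP[]; rewrite le_eqVlt => /predU1P[<-//|ax _].
      by rewrite ltW// inF.
    rewrite integral_set0 (_ : _ `&` _ = set0) ?measure0//.
    apply/seteqP; split => x //= -[]; rewrite in_itv/= => /andP[Fax _].
    by rewrite ltNge (le_trans cFa).
  have [Fbc|cFb] := ltP (F b) c.
    rewrite (_ : _ `&` _ = `[a, b]%classic); last first.
      apply/seteqP; split => x /=; first by case.
      move=> xab; split => //; apply: le_lt_trans Fbc.
      have := xab; rewrite in_itv/= => /andP[_]; rewrite le_eqVlt => /predU1P[->//|bx].
      by rewrite ltW// inF.
    rewrite FTC//; transitivity (mu `[F a, F b]%classic).
      by rewrite lebesgue_measure_itv/= lte_fin Fab EFinN.
    congr (mu _); apply/seteqP; split => x /=; last by case.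
    by move=> xF; split => //; move: xF; rewrite in_itv/= => /andP[_ /le_lt_trans]; apply.
  (* For [c] between the end values, the intermediate value theorem turns the ray condition
     [F x < c] into [x < m]. *)
  have [m mab Fm] : exists2 m, m \in `[a, b] & F m = c.
    apply: IVT => //; first exact: ltW.
    by rewrite (min_idPl (ltW Fab)) (max_idPr (ltW Fab)) (ltW Fac).
  have am : a < m.
    rewrite ltNge; apply/negP => ma; move: Fac; rewrite -Fm.
    have -> : m = a by apply/eqP; rewrite eq_le ma; move: mab; rewrite in_itv/= => /andP[->].
    by rewrite ltxx.
  have mb : m <= b by move: mab; rewrite in_itv/= => /andP[].
  rewrite (_ : `[a, b] `&` _ = `[a, m[%classic); last first.
    apply/seteqP; split => x /=.
      move=> [xab]; rewrite -Fm => FxFm; move: (xab); rewrite !in_itv/= => /andP[-> _]/=.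
      rewrite ltNge; apply/negP; rewrite le_eqVlt => /predU1P[mx|mx].
        by rewrite mx ltxx in FxFm.
      by have := lt_trans FxFm (inF _ _ mab xab mx); rewrite ltxx.
    rewrite in_itv/= => /andP[ax xm].
    have xab : x \in `[a, b] by rewrite in_itv/= ax (le_trans (ltW xm)).
    by split => //; rewrite -Fm inF.
  rewrite integral_itv_bndo_bndc; last first.
    apply/measurable_EFinP; apply: (@measurable_funS _ _ _ _ `[a, b]%classic) => //.
      by move=> x /=; rewrite !in_itv/= => /andP[-> /ltW/le_trans->].
    apply: subspace_continuous_measurable_fun => //.
  rewrite FTC//; transitivity (mu `[F a, c[%classic).
    by rewrite lebesgue_measure_itv/= lte_fin Fac Fm EFinN.
  congr (mu _); apply/seteqP; split => x /=; rewrite !in_itv/=; last by move=> [/andP[->]].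
  by move=> /andP[-> xc]; split => //; rewrite (le_trans (ltW xc)).
apply: law => //.
move=> c; rewrite key integral_indic//; last first.
  by rewrite (_ : [set y | _] = `]-oo, c[%classic)//;
    apply/seteqP; split => x /=; rewrite in_itv.
apply: (@le_lt_trans _ _ (mu `[F a, F b]%classic)).
  apply: le_measure; rewrite ?inE//; apply: measurableI => //.
  by rewrite (_ : [set y | _] = `]-oo, c[%classic)//;
    apply/seteqP; split => x /=; rewrite in_itv.
by rewrite lebesgue_measure_itv/= lte_fin Fab -EFinD ltry.
Qed.

End substitution.

Section substitution_corollaries.
Context {R : realType}.
Local Notation mu := (@lebesgue_measure R).

Lemma ge0_integral_oppr (H : R -> \bar R) (a b : R) :
  measurable_fun setT H -> (forall x, 0 <= H x)%E ->
  (\int[mu]_(x in `[(- b)%R, (- a)%R]) H (- x)%R = \int[mu]_(x in `[a, b]) H x)%E.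
Proof.
move=> mH H0; rewrite (_ : `[- b, - a]%classic =
    (-%R : _ -> measurableTypeR R) @^-1` `[a, b]); last first.
  by rewrite opp_preimage_itvbndbnd.
rewrite -ge0_integral_pushforward//=; last exact: measurable_funS mH.
by apply: eq_measure_integral => //= A mA AS; exact/lebesgue_measureN.
Qed.

Lemma ge0_integral_subst_decr (F f : R -> R) (a b : R) (H : R -> \bar R) :
  a < b -> (forall x, x \in `[a, b] -> is_derive x 1 F (- f x)) ->
  {within `[a, b], continuous f} -> (forall x, x \in `]a, b[ -> 0 < f x) ->
  (forall x, x \in `[a, b] -> 0 <= f x) ->
  measurable_fun setT H -> (forall x, 0 <= H x)%E ->
  (\int[mu]_(x in `[a, b]) ((f x)%:E * H (F x)) = \int[mu]_(y in `[F b, F a]) H y)%E.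
Proof.
move=> ab dF cf fp f0 mH H0.
have mHN : measurable_fun setT (H \o -%R) by apply: measurableT_comp mH _.
have dNF x : x \in `[a, b] -> is_derive x 1 (fun x => - F x) (f x).
  by move=> xab; have dFx := dF x xab; apply: is_derive_eq; rewrite opprK.
rewrite -[RHS]ge0_integral_oppr//.
rewrite -(ge0_integral_subst_incr ab dNF cf fp f0 mHN (fun x => H0 _)).
by apply: eq_integral => x _; rewrite /= opprK.
Qed.

Lemma ge0_integral_shift (H : R -> \bar R) (a b c : R) : a <= b ->
  measurable_fun setT H -> (forall x, 0 <= H x)%E ->
  (\int[mu]_(x in `[a, b]) H (x + c)%R = \int[mu]_(x in `[(a + c)%R, (b + c)%R]) H x)%E.
Proof.
rewrite le_eqVlt => /predU1P[->|ab] mH H0; first by rewrite !set_itv1 !integral_set1.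
have dF x : x \in `[a, b] -> is_derive x 1 (fun x => x + c) 1.
  by move=> _; apply: is_derive_eq; rewrite addr0.
have c1 : {within `[a, b], continuous (fun _ : R => 1 : R)}.
  exact/continuous_subspaceT/cst_continuous.
rewrite -(ge0_integral_subst_incr ab dF c1)//.
by apply: eq_integral => x _; rewrite mul1e.
Qed.

Lemma ge0_integral_reflect (H : R -> \bar R) (a b c : R) : a <= b ->
  measurable_fun setT H -> (forall x, 0 <= H x)%E ->
  (\int[mu]_(x in `[a, b]) H (c - x)%R = \int[mu]_(x in `[(c - b)%R, (c - a)%R]) H x)%E.
Proof.
rewrite le_eqVlt => /predU1P[->|ab] mH H0; first by rewrite !set_itv1 !integral_set1.
have dF x : x \in `[a, b] -> is_derive x 1 (fun x => c - x) (- 1).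
  by move=> _; apply: is_derive_eq; rewrite add0r mul1r.
have c1 : {within `[a, b], continuous (fun _ : R => 1 : R)}.
  exact/continuous_subspaceT/cst_continuous.
rewrite -(ge0_integral_subst_decr ab dF c1)//.
by apply: eq_integral => x _; rewrite mul1e.
Qed.

Lemma measurable_sin : measurable_fun [set: R] (@sin R).
Proof. by apply: continuous_measurable_fun; exact: continuous_sin. Qed.

Lemma measurable_cos : measurable_fun [set: R] (@cos R).
Proof. by apply: continuous_measurable_fun; exact: continuous_cos. Qed.

Lemma ge0_integral_cos_subst (p q : R) (H : R -> \bar R) : 0 < p ->
  measurable_fun setT H -> (forall x, 0 <= H x)%E ->
  (\int[mu]_(t in `[0%R, pi]) ((p * sin t)%:E * H (p * cos t + q)%R) =
   \int[mu]_(x in `[(q - p)%R, (q + p)%R]) H x)%E.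
Proof.
move=> p0 mH H0.
have dF x : x \in `[0, pi] -> is_derive x 1 (fun t => p * cos t + q) (- (p * sin x)).
  by move=> _; apply: is_derive_eq; rewrite ?addr0 ?scaler0 ?mulr0 ?addr0 ?scalerN.
have cs : {within `[0, pi], continuous (fun t : R => p * sin t)}.
  apply: continuous_subspaceT => x; apply: continuousM; first exact: cvg_cst.
  exact: continuous_sin.
rewrite (ge0_integral_subst_decr (pi_gt0 R) dF cs)//.
- by rewrite cospi cos0 mulrN1 mulr1 addrC (addrC p).
- by move=> x /sin_gt0_pi xp; rewrite mulr_gt0.
- by move=> x /sin_ge0_pi xp; rewrite mulr_ge0// ltW.
Qed.

(** With [x = p * cos t + q] the Jacobian [p * sin t] is the square root of [p ^+ 2 - (x - q) ^+ 2].
    Square roots of negative numbers and the inverse of 0 are 0, so the kernel vanishes outside the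
    range of the substitution and the right-hand integral may run over the whole line. *)
Lemma ge0_integral_arcsine (p q : R) (H : R -> \bar R) : 0 < p ->
  measurable_fun setT H -> (forall x, 0 <= H x)%E ->
  (\int[mu]_(t in `[0%R, pi]) H (p * cos t + q)%R =
   \int[mu]_x (H x * ((Num.sqrt (p ^+ 2 - (x - q) ^+ 2))^-1)%:E))%E.
Proof.
move=> p0 mH H0.
pose K x := (H x * ((Num.sqrt (p ^+ 2 - (x - q) ^+ 2))^-1)%:E)%E.
have mK : measurable_fun setT K.
  apply: emeasurable_funM => //; apply/measurable_EFinP.
  apply: (measurableT_comp measurable_invr); apply: (measurableT_comp measurable_sqrtr).
  by apply: measurable_funB => //; apply: measurable_funX; exact: measurable_funB.
have K0 x : (0 <= K x)%E by rewrite mule_ge0// lee_fin invr_ge0 sqrtr_ge0.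
have mHc : measurable_fun setT (fun t => H (p * cos t + q)).
  apply: (measurableT_comp mH); apply: measurable_funD => //.
  by apply: measurable_funM => //; exact: measurable_cos.
transitivity (\int[mu]_(x in `[(q - p)%R, (q + p)%R]) K x)%E; last first.
  rewrite integral_mkcond; apply: eq_integral => x _; rewrite patchE.
  case: ifPn => //; rewrite notin_setE /= in_itv/= => /negP xpq.
  rewrite /K ler0_sqrtr ?invr0 ?mule0//; move: xpq.
  rewrite negb_and -!ltNge subr_le0 => /orP[xq|xq].
    by rewrite -(sqrrN (x - q)) lerXn2r ?nnegrE; lra.
  by rewrite lerXn2r ?nnegrE; lra.
rewrite -ge0_integral_cos_subst//.
(* The end points are removed because [p * sin t] can be cancelled only where it is positive. *)
rewrite [LHS]integral_itv_bndoo; last exact: measurable_funS mHc.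
rewrite [RHS]integral_itv_bndoo; last first.
  apply: emeasurable_funM.
    apply/measurable_EFinP; apply: measurable_funM => //.
    by apply: measurable_funS measurable_sin.
  apply: (@measurable_funS _ _ _ _ setT) => //.
  apply: (measurableT_comp mK); apply: measurable_funD => //.
  by apply: measurable_funM => //; exact: measurable_cos.
apply: eq_integral => t /[!inE] /= t0pi.
have st := sin_gt0_pi t0pi.
rewrite /K addrK (_ : p ^+ 2 - _ = (p * sin t) ^+ 2); last first.
  by rewrite !exprMn sin2cos2; ring.
have pst : 0 < p * sin t by rewrite mulr_gt0.
rewrite sqrtr_sqr gtr0_norm// muleCA -EFinM mulfV ?mule1//.
by rewrite gt_eqF.
Qed.

End substitution_corollaries.

(** * Integration over the circle and the sphere *)

Section sphere.
Context {R : realType}.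
Local Notation mu := (@lebesgue_measure R).

Lemma ge0_integral_itv_cat (H : R -> \bar R) (a b c : R) : a <= b -> b <= c ->
  measurable_fun setT H -> (forall x, 0 <= H x)%E ->
  (\int[mu]_(x in `[a, c]) H x =
   \int[mu]_(x in `[a, b]) H x + \int[mu]_(x in `[b, c]) H x)%E.
Proof.
move=> ab bc mH H0.
rewrite -[X in (X + _)%E]integral_itv_bndo_bndc; last exact: measurable_funS mH.
rewrite -ge0_integral_setU//=.
- by congr (integral _ _ _); rewrite -itv_bndbnd_setU.
- exact: measurable_funS mH.
- apply/disj_setPS => x /=; rewrite !in_itv/= => -[/andP[_ xb] /andP[bx _]].
  by have := lt_le_trans xb bx; rewrite ltxx.
Qed.

(** The shifted interval is cut at 0, and its negative part is moved by one period. *)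
Lemma ge0_integral_periodic (P : R -> \bar R) (c : R) : 0 <= c -> c <= 2 * pi ->
  measurable_fun setT P -> (forall x, 0 <= P x)%E -> (forall x, P (x + 2 * pi)%R = P x) ->
  (\int[mu]_(x in `[0%R, (2 * pi)%R]) P (x - c)%R =
   \int[mu]_(x in `[0%R, (2 * pi)%R]) P x)%E.
Proof.
move=> c0 cpi mP P0 perP; have p0 := pi_gt0 R.
rewrite ge0_integral_shift//; last lra.
rewrite (@ge0_integral_itv_cat _ _ 0)//; [|lra|lra].
rewrite (@ge0_integral_itv_cat _ 0 (2 * pi - c) (2 * pi))//; [|lra|lra].
rewrite addeC; congr (_ + _)%E.
under eq_integral do rewrite -perP.
rewrite ge0_integral_shift//; last lra.
by rewrite !add0r addrC.
Qed.

Lemma polar_angle (u v : R) : exists2 c : R, 0 <= c <= 2 * pi &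
  u = Num.sqrt (u ^+ 2 + v ^+ 2) * cos c /\ v = Num.sqrt (u ^+ 2 + v ^+ 2) * sin c.
Proof.
have p0 := pi_gt0 R.
set p := Num.sqrt _; have p2 : p ^+ 2 = u ^+ 2 + v ^+ 2 by rewrite sqr_sqrtr// addr_ge0// sqr_ge0.
have [p00|pN0] := eqVneq p 0.
  have [u0 v0] : u = 0 /\ v = 0.
    by move: p2; rewrite p00 expr0n/= => /esym/eqP; rewrite paddr_eq0 ?sqr_ge0// !sqrf_eq0 => /andP[/eqP-> /eqP->].
  by exists 0; [lra|rewrite p00 !mul0r].
have pp : 0 < p by rewrite lt_def pN0 sqrtr_ge0.
have up : -1 <= u / p <= 1.
  rewrite ler_pdivlMr// ler_pdivrMr//; apply/andP; split; nra.
have cosc : cos (acos (u / p)) = u / p by rewrite acosK// in_itv.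
have sinc : sin (acos (u / p)) = `|v| / p.
  rewrite sin_acos// (_ : 1 - _ = (`|v| / p) ^+ 2); last first.
    rewrite !exprMn real_normK ?num_real// exprVn.
    have : p ^+ 2 != 0 by rewrite expf_neq0.
    by rewrite p2 => ?; field.
  by rewrite sqrtr_sqr ger0_norm// divr_ge0// ltW.
have /andP[a0 api] : 0 <= acos (u / p) <= pi by rewrite acos_ge0// acos_lepi.
have [v0|v0] := leP 0 v.
  exists (acos (u / p)); first lra.
  by rewrite cosc sinc ger0_norm//; split; field.
exists (2 * pi - acos (u / p)); first lra.
have -> : 2 * pi - acos (u / p) = - acos (u / p) + pi + pi by lra.
by rewrite cosDpi cosDpi sinDpi sinDpi cosN sinN !opprK cosc sinc ltr0_norm//; split; field.
Qed.

(** In polar form [u * cos x + v * sin x] is an amplitude times [cos (x - c)]. Periodicity removes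
    the phase [c], and the reflection [x |-> 2 * pi - x] identifies the two half turns. *)
Lemma ge0_integral_circle (K : R -> \bar R) (u v : R) :
  measurable_fun setT K -> (forall x, 0 <= K x)%E ->
  (\int[mu]_(x in `[0%R, (2 * pi)%R]) K (u * cos x + v * sin x)%R =
   2%:E * \int[mu]_(x in `[0%R, pi]) K (Num.sqrt (u ^+ 2 + v ^+ 2) * cos x)%R)%E.
Proof.
move=> mK K0; have p0 := pi_gt0 R.
have [c /andP[c0 cpi] [uE vE]] := polar_angle u v.
set p := Num.sqrt _ in uE vE *; pose P x := K (p * cos x).
have mP : measurable_fun setT P.
  apply: (measurableT_comp mK); apply: measurable_funM => //; exact: measurable_cos.
have P0 x : (0 <= P x)%E by exact: K0.
have cos2 x : cos (x + 2 * pi) = cos x :> R.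
  by rewrite mulr2n mulrDl mul1r addrA !cosDpi opprK.
transitivity (\int[mu]_(x in `[0%R, (2 * pi)%R]) P (x - c)%R)%E.
  apply: eq_integral => x _; rewrite /P cosB; congr K; rewrite {1}uE {1}vE; ring.
rewrite ge0_integral_periodic//; last by move=> x; rewrite /P cos2.
rewrite (@ge0_integral_itv_cat _ _ pi)//; [|lra|lra].
have -> : (\int[mu]_(x in `[pi, (2 * pi)%R]) P x = \int[mu]_(x in `[0%R, pi]) P x)%E.
  rewrite (_ : `[pi, (2 * pi)%R]%classic = `[(2 * pi - pi)%R, (2 * pi - 0)%R]%classic); last first.
    by rewrite subr0 (_ : 2 * pi - pi = pi)//; lra.
  rewrite -ge0_integral_reflect//; last lra.
  by apply: eq_integral => x _; rewrite /P -cosN opprB -cos2 subrK.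
by rewrite -[2]/(1 + 1) EFinD ge0_muleDl ?lee_fin// !mul1e.
Qed.

(* The spherical integral of a zonal function: the change of variables
   x = sph th ph . e at fixed z = cos th produces the kernel
   (sqrt (b^2 (1 - z^2) - (x - e3 z)^2))^-1, symmetric in x and z. *)
Lemma funk_hecke (F : R -> \bar R) (e : V3 R) : vdot e e = 1 ->
  measurable_fun setT F -> (forall x, 0 <= F x)%E ->
  (\int[mu]_(th in `[0%R, pi]) \int[mu]_(ph in `[0%R, (2 * pi)%R])
      (F (vdot (sph th ph) e) * (sin th)%:E) =
   (2 * pi)%:E * \int[mu]_(x in `[(-1)%R, 1%R]) F x)%E.
Proof.
case: e => [[e1 e2] e3]; rewrite /vdot/= => e1E mF F0; have p0 := pi_gt0 R.
pose b := Num.sqrt (e1 ^+ 2 + e2 ^+ 2).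
have b2 : b ^+ 2 = e1 ^+ 2 + e2 ^+ 2 by rewrite sqr_sqrtr// addr_ge0// sqr_ge0.
have b2a2 : b ^+ 2 + e3 ^+ 2 = 1 by rewrite b2 -e1E; ring.
have b0 : 0 <= b := sqrtr_ge0 _.
have inner th : th \in `[0, pi] -> (\int[mu]_(ph in `[0%R, (2 * pi)%R])
      (F (sin th * cos ph * e1 + sin th * sin ph * e2 + cos th * e3)%R * (sin th)%:E) =
    (sin th)%:E * (2%:E * \int[mu]_(x in `[0%R, pi]) F (b * sin th * cos x + e3 * cos th)%R))%E.
  move=> th0; have st := sin_ge0_pi th0.
  pose K x := F (sin th * x + e3 * cos th).
  have mK : measurable_fun setT K.
    by apply: (measurableT_comp mF); apply: measurable_funD => //; exact: measurable_funM.
  under eq_integral => ph _.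
    rewrite (_ : _ + _ = sin th * (e1 * cos ph + e2 * sin ph) + e3 * cos th); last by ring.
    over.
  rewrite ge0_integralZr//; last first.
    apply: (@measurable_funS _ _ _ _ setT) => //; apply: (measurableT_comp mK).
    apply: measurable_funD; apply: measurable_funM => //;
      [exact: measurable_cos|exact: measurable_sin].
  rewrite (ge0_integral_circle e1 e2 mK (fun x => F0 _)) muleC; congr (_ * (_ * _))%E.
  by apply: eq_integral => x _; rewrite /K -/b; congr F; ring.
under eq_integral => th /[!inE]/= th0 do rewrite inner//.
(* For [b = 0] the axis [e] is a pole: the arcsine density degenerates, but the integrand no longer
   depends on [ph], and substituting [cos th] is enough. *)
have [bz|bN0] := eqVneq b 0.
  have mFe : measurable_fun setT (fun x => F (e3 * x)).
    by apply: (measurableT_comp mF); exact: measurable_funM.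
  have -> : (\int[mu]_(x in `[0%R, pi]) ((sin x)%:E *
      (2%:E * \int[mu]_(x0 in `[0%R, pi]) F (b * sin x * cos x0 + e3 * cos x)%R)) =
      \int[mu]_(x in `[0%R, pi]) ((2 * pi)%:E * ((1 * sin x)%:E * F (e3 * (1 * cos x + 0))%R)))%E.
    apply: eq_integral => th /[!inE]/= th0; rewrite bz.
    under eq_integral do rewrite !mul0r add0r.
    rewrite integral_cst//= lebesgue_measure_itv/= lte_fin p0 -EFinD subr0 addr0 !mul1r.
    rewrite [in RHS]EFinM -!muleA [LHS]muleCA; congr (_ * _)%E.
    by rewrite [RHS]muleCA; congr (_ * _)%E; rewrite muleC.
  rewrite ge0_integralZl//; last 3 first.
  - apply: (@measurable_funS _ _ _ _ setT) => //; apply: emeasurable_funM.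
      by apply/measurable_EFinP; apply: measurable_funM => //; exact: measurable_sin.
    apply: (measurableT_comp mFe); apply: measurable_funD => //.
    by apply: measurable_funM => //; exact: measurable_cos.
  - by move=> x /= /sin_ge0_pi sx; rewrite mule_ge0// lee_fin mul1r.
  - by rewrite lee_fin mulr_ge0// ltW.
  congr (_ * _)%E; rewrite (@ge0_integral_cos_subst _ 1 0 (fun x => F (e3 * x)))//.
  rewrite sub0r add0r.
  have : e3 ^+ 2 = 1 by rewrite -b2a2 bz; ring.
  move=> /eqP; rewrite sqrf_eq1 => /orP[] /eqP ->; first by under eq_integral do rewrite mul1r.
  under eq_integral do rewrite mulN1r.
  by have := ge0_integral_oppr (-1) 1 mF F0; rewrite opprK.
have bp : 0 < b by rewrite lt_def bN0.
(* Since [b ^+ 2 + e3 ^+ 2 = 1], [D z x] equals [b ^+ 2 - z ^+ 2 - x ^+ 2 + 2 * e3 * x * z]. By this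
   symmetry the integral over [z] left after Tonelli is again of arcsine type. *)
pose D (z x : R) := b ^+ 2 * (1 - z ^+ 2) - (x - e3 * z) ^+ 2.
have Dsym z x : D z x = D x z.
  have b2E : b ^+ 2 = 1 - e3 ^+ 2 by rewrite -b2a2; ring.
  by rewrite /D b2E; ring.
pose f (zx : R * R) := (F zx.2 * ((Num.sqrt (D zx.1 zx.2))^-1)%:E)%E.
have mf : measurable_fun setT f.
  apply: emeasurable_funM; first exact: measurableT_comp.
  apply/measurable_EFinP; apply: (measurableT_comp measurable_invr).
  apply: (measurableT_comp measurable_sqrtr); apply: measurable_funB.
    by apply: measurable_funM => //; apply: measurable_funB => //; exact: measurable_funX.
  by apply: measurable_funX; apply: measurable_funB => //; exact: measurable_funM.
have f0 zx : (0 <= f zx)%E by rewrite mule_ge0// lee_fin invr_ge0 sqrtr_ge0.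
pose Q z := (2%:E * \int[mu]_x f (z, x))%E.
have mQ : measurable_fun setT Q.
  by apply: emeasurable_funM => //; exact: (measurable_fun_fubini_tonelli_F (m2 := mu) f).
have Q0 z : (0 <= Q z)%E by rewrite mule_ge0 ?lee_fin// integral_ge0.
(* For [|z| >= 1] the square root is 0 and the kernel vanishes, so the integrals over [z] extend
   from [[-1, 1]] to the line. *)
have D_le0 z x : (1 <= `|z|) -> D z x <= 0.
  move=> z1; rewrite /D; have : 1 <= z ^+ 2 by rewrite -real_normK ?num_real//; nra.
  have := sqr_ge0 (x - e3 * z); have := sqr_ge0 b; nra.
have -> : (\int[mu]_(x in `[0%R, pi]) ((sin x)%:E *
      (2%:E * \int[mu]_(x0 in `[0%R, pi]) F (b * sin x * cos x0 + e3 * cos x)%R)) =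
      \int[mu]_(x in `[0%R, pi]) ((1 * sin x)%:E * Q (1 * cos x + 0)%R))%E.
  apply: eq_integral => th /[!inE]/= th0; rewrite !mul1r addr0.
  have := sin_ge0_pi th0; rewrite le_eqVlt => /predU1P[<-|st]; first by rewrite !mul0e.
  rewrite ge0_integral_arcsine// ?mulr_gt0//; congr (_ * (_ * _))%E.
  apply: eq_integral => x _; rewrite /f/= /D; congr (_ * ((Num.sqrt _)^-1)%:E)%E.
  by rewrite exprMn sin2cos2.
rewrite ge0_integral_cos_subst// sub0r add0r.
have -> : (\int[mu]_(x in `[(-1)%R, 1%R]) Q x = \int[mu]_x Q x)%E.
  rewrite integral_mkcond; apply: eq_integral => x _; rewrite patchE.
  case: ifPn => //; rewrite notin_setE /= in_itv/= => /negP xpq.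
  rewrite /Q integral0_eq ?mule0// => y _; rewrite /f/= ler0_sqrtr ?invr0 ?mule0//.
  by apply: D_le0; move: xpq; rewrite -ler_norml -ltNge => /ltW.
rewrite /Q ge0_integralZl//; last 2 first.
- exact: (measurable_fun_fubini_tonelli_F (m2 := mu) f).
- by move=> x _; exact: integral_ge0.
rewrite (fubini_tonelli (m1 := mu) (m2 := mu) f)//.
rewrite [in RHS]EFinM -muleA; congr (_ * _)%E.
rewrite -ge0_integralZl//; last 2 first.
- exact: measurable_funS mF.
- by rewrite lee_fin ltW.
rewrite [RHS]integral_itv_bndoo; last first.
  by apply: emeasurable_funM => //; exact: measurable_funS mF.
rewrite [RHS]integral_mkcond; apply: eq_integral => x _; rewrite patchE /f/=.
case: ifPn => [/[!inE]/=|]; last first.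
  rewrite notin_setE/= in_itv/= => /negP x1.
  rewrite integral0_eq// => z _; rewrite Dsym ler0_sqrtr ?invr0 ?mule0//.
  by apply: D_le0; rewrite leNgt ltr_norml.
rewrite in_itv/= => /andP[x1 x2].
have x21 : 0 < 1 - x ^+ 2 by nra.
pose A := b * Num.sqrt (1 - x ^+ 2).
have A0 : 0 < A by rewrite mulr_gt0// sqrtr_gt0.
have A2 : A ^+ 2 = b ^+ 2 * (1 - x ^+ 2).
  by rewrite exprMn; congr (_ * _); rewrite sqr_sqrtr// ltW.
rewrite ge0_integralZl//; last first.
  apply/measurable_EFinP; apply: (measurableT_comp measurable_invr).
  apply: (measurableT_comp measurable_sqrtr); apply: measurable_funB.
    by apply: measurable_funM => //; apply: measurable_funB => //; exact: measurable_funX.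
  by apply: measurable_funX; apply: measurable_funB => //; exact: measurable_funM.
rewrite muleC; congr (_ * _)%E.
under eq_integral do rewrite Dsym /D -A2.
(* With the constant 1 as integrand, the arcsine density has total mass [pi], whatever its centre
   and width. *)
have := @ge0_integral_arcsine R A (e3 * x) (cst 1%E) A0.
move=> /(_ (measurable_cst _) (fun=> lee01)) /=.
under [X in _ = X -> _]eq_integral do rewrite mul1e.
move=> <-; rewrite integral_cst//= lebesgue_measure_itv/= lte_fin p0 mul1e.
by rewrite -EFinD subr0.
Qed.

End sphere.

(** * Iterated integrals in three dimensions *)

Section tonelli3.
Local Open Scope ereal_scope.
Context d1 d2 d3 (T1 : measurableType d1) (T2 : measurableType d2) (T3 : measurableType d3)
  (R : realType).
Variables (m1 : {sigma_finite_measure set T1 -> \bar R})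
  (m2 : {sigma_finite_measure set T2 -> \bar R})
  (m3 : {sigma_finite_measure set T3 -> \bar R}).

(* The canonical sigma-finite structure on m1 \x m2 only covers the
   product of probabilities, hence the explicit packing. *)
Definition product_sigma_finite : {sigma_finite_measure set (T1 * T2)%type -> \bar R} :=
  HB.pack (m1 \x m2)
    (lebesgue_integral_fubini.measure_function_Measure_isSigmaFinite__to__measure_function_isSFinite m1 m2)
    (lebesgue_integral_fubini.measure_function_Measure_isSigmaFinite__to__measure_function_isSigmaFinite m1 m2).

Lemma tonelli3 (f : T1 * T2 * T3 -> \bar R) :
  measurable_fun setT f -> (forall z, 0 <= f z) ->
  \int[(m1 \x m2) \x m3]_z f z = \int[m1]_x \int[m2]_y \int[m3]_t f (x, y, t).
Proof.
move=> mf f0; have mF := measurable_fun_fubini_tonelli_F (m2 := m3) f mf f0.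
have F0 z : 0 <= fubini_F m3 f z by exact: integral_ge0.
apply: etrans.
  exact: (@fubini_tonelli1 _ _ _ _ R product_sigma_finite m3 f mf f0).
exact: (@fubini_tonelli1 _ _ _ _ _ m1 m2 (fubini_F m3 f) mF F0).
Qed.
End tonelli3.

(** * Volume of balls and radial integrals *)

Section radial.
Context {R : realType}.
Local Notation mu := (@lebesgue_measure R).
Local Notation MR := (measurableTypeR R).

Lemma integral_sin2 : (\int[mu]_(t in `[0%R, pi]) ((sin t ^+ 2)%:E) = (pi / 2)%:E)%E.
Proof.
have dF (x : R) : is_derive x 1 (fun t => (t - sin t * cos t) / 2) (sin x ^+ 2).
  apply: is_derive_eq; rewrite /GRing.scale/= ?mulr0 ?add0r ?addr0 ?mulr1.
  have := cos2Dsin2 x; lra.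
have cF x : {for x, continuous (fun t : R => (t - sin t * cos t) / 2)}.
  by apply/differentiable_continuous/derivable1_diffP; have [] := dF x.
rewrite (@continuous_FTC2 _ _ (fun t => (t - sin t * cos t) / 2))//.
- by rewrite sinpi sin0 !mul0r !subr0 -EFinB; congr EFin; ring.
- exact: pi_gt0.
- apply: continuous_subspaceT => x.
  by apply: (@continuous_comp _ _ _ sin (fun y => y ^+ _)); [exact: continuous_sin|exact: exprn_continuous].
- split.
  + by move=> x _; have [] := dF x.
  + by apply: cvg_at_right_filter; exact: cF.
  + by apply: cvg_at_left_filter; exact: cF.
- by move=> x _; rewrite derive1E; have [_ ->] := dF x.
Qed.

Lemma integral_sin3 : (\int[mu]_(t in `[0%R, pi]) ((sin t ^+ 3)%:E) = (4 / 3)%:E)%E.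
Proof.
have dF (x : R) : is_derive x 1 (fun t => cos t ^+ 3 / 3 - cos t) (sin x ^+ 3).
  apply: is_derive_eq; rewrite /GRing.scale/= ?mulr0 ?add0r ?addr0 ?mulr1.
  have -> : sin x ^+ 3 = sin x * (1 - cos x ^+ 2) by rewrite exprS -sin2cos2.
  by field.
have cF x : {for x, continuous (fun t : R => cos t ^+ 3 / 3 - cos t)}.
  by apply/differentiable_continuous/derivable1_diffP; have [] := dF x.
rewrite (@continuous_FTC2 _ _ (fun t => cos t ^+ 3 / 3 - cos t))//.
- by rewrite cospi cos0 -EFinB; congr EFin; field.
- exact: pi_gt0.
- apply: continuous_subspaceT => x.
  by apply: (@continuous_comp _ _ _ sin (fun y => y ^+ _)); [exact: continuous_sin|exact: exprn_continuous].
- split.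
  + by move=> x _; have [] := dF x.
  + by apply: cvg_at_right_filter; exact: cF.
  + by apply: cvg_at_left_filter; exact: cF.
- by move=> x _; rewrite derive1E; have [_ ->] := dF x.
Qed.

Lemma lebesgue_measure_sqr_lt (a s : R) :
  mu [set t | (a - t) ^+ 2 < s] = (2 * Num.sqrt s)%:E.
Proof.
have [s0|s0] := leP s 0.
  rewrite (_ : [set t | _] = set0) ?measure0 ?ler0_sqrtr ?mulr0//.
  apply/seteqP; split => t //=; rewrite ltNge => /negP; apply.
  by rewrite (le_trans s0)// sqr_ge0.
rewrite (_ : [set t | _] = `]a - Num.sqrt s, a + Num.sqrt s[%classic); last first.
  have E t : ((a - t) ^+ 2 < s) = (a - Num.sqrt s < t < a + Num.sqrt s).
    rewrite -{1}(sqr_sqrtr (ltW s0)) -[(a - t) ^+ 2]real_normK ?num_real//.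
    by rewrite ltr_pXn2r ?nnegrE ?sqrtr_ge0// ltr_distlC.
  by apply/seteqP; split => t /=; rewrite in_itv/= E.
have ss : 0 < Num.sqrt s by rewrite sqrtr_gt0.
rewrite lebesgue_measure_itv/= lte_fin ifT; last lra.
by rewrite -EFinD; congr EFin; ring.
Qed.

(** The area of a disc of squared radius [s], summed from its chords. The maximum with 0 covers the
    planes that miss the ball. *)
Lemma integral_sqrt_slice (a s : R) :
  (\int[mu]_y (2 * Num.sqrt (s - (a - y) ^+ 2))%:E = (pi * Num.max s 0)%:E)%E.
Proof.
have [s0|s0] := leP s 0.
  rewrite integral0_eq ?mulr0// => y _.
  by rewrite ler0_sqrtr ?mulr0// subr_le0 (le_trans s0)// sqr_ge0.
pose p := Num.sqrt s; have p0 : 0 < p by rewrite sqrtr_gt0.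
have p2 : p ^+ 2 = s by rewrite sqr_sqrtr// ltW.
pose H y := (2 * Num.sqrt (s - (a - y) ^+ 2))%:E.
have mH : measurable_fun setT H.
  apply/measurable_EFinP; apply: measurable_funM => //.
  apply: (measurableT_comp measurable_sqrtr); apply: measurable_funB => //.
  by apply: measurable_funX; exact: measurable_funB.
have H0 y : (0 <= H y)%E by rewrite lee_fin mulr_ge0// sqrtr_ge0.
transitivity (\int[mu]_(y in `[(a - p)%R, (a + p)%R]) H y)%E.
  rewrite [RHS]integral_mkcond; apply: eq_integral => x _; rewrite patchE.
  case: ifPn => //; rewrite notin_setE /= in_itv/= => /negP xpq.
  rewrite /H ler0_sqrtr ?mulr0//; move: xpq.
  rewrite negb_and -!ltNge subr_le0 -p2 => /orP[xq|xq].
    by rewrite lerXn2r ?nnegrE; lra.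
  by rewrite -(sqrrN (a - x)) lerXn2r ?nnegrE; lra.
rewrite -ge0_integral_cos_subst//.
rewrite (_ : (pi * _)%:E = ((2 * s)%:E * (pi / 2)%:E)%E); last first.
  by rewrite -EFinM; congr EFin; field.
rewrite -integral_sin2 -ge0_integralZl//; last 3 first.
- apply/measurable_EFinP; apply: measurable_funX.
  by apply: measurable_funS measurable_sin.
- by move=> x _; rewrite lee_fin sqr_ge0.
- by rewrite lee_fin mulr_ge0// ltW.
apply: eq_integral => t /[!inE]/= /sin_ge0_pi st.
rewrite /H -!EFinM; congr EFin.
rewrite (_ : s - _ = (p * sin t) ^+ 2); last first.
  by rewrite -p2 [in RHS]exprMn sin2cos2; ring.
by rewrite sqrtr_sqr ger0_norm ?(mulr_ge0 (ltW p0) st)// -p2; ring.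
Qed.

(** The volume of a ball of radius [c], summed from its discs; [x = a + c * cos t] reduces it to the
    integral of [sin t ^+ 3]. *)
Lemma integral_disc_slice (a c : R) : 0 < c ->
  (\int[mu]_x (pi * Num.max (c ^+ 2 - (a - x) ^+ 2) 0)%:E = (4 / 3 * pi * c ^+ 3)%:E)%E.
Proof.
move=> c0; have pi0 := pi_ge0 R.
pose H y := (pi * Num.max (c ^+ 2 - (a - y) ^+ 2) 0)%:E.
have mH : measurable_fun setT H.
  apply/measurable_EFinP; apply: measurable_funM => //.
  apply: measurable_maxr => //; apply: measurable_funB => //.
  by apply: measurable_funX; exact: measurable_funB.
have H0 y : (0 <= H y)%E by rewrite lee_fin mulr_ge0// le_max lexx orbT.
transitivity (\int[mu]_(y in `[(a - c)%R, (a + c)%R]) H y)%E.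
  rewrite [RHS]integral_mkcond; apply: eq_integral => x _; rewrite patchE.
  case: ifPn => //; rewrite notin_setE /= in_itv/= => /negP xpq.
  rewrite /H max_r ?mulr0//; move: xpq.
  rewrite negb_and -!ltNge subr_le0 => /orP[xq|xq].
    by rewrite lerXn2r ?nnegrE; lra.
  by rewrite -(sqrrN (a - x)) lerXn2r ?nnegrE; lra.
rewrite -ge0_integral_cos_subst//.
rewrite (_ : (4 / 3 * pi * c ^+ 3)%:E = ((pi * c ^+ 3)%:E * (4 / 3)%:E)%E); last first.
  by rewrite -EFinM; congr EFin; ring.
rewrite -integral_sin3 -ge0_integralZl//; last 3 first.
- apply/measurable_EFinP; apply: measurable_funX.
  by apply: measurable_funS measurable_sin.
- by move=> x /= /sin_ge0_pi st; rewrite lee_fin exprn_ge0.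
- by rewrite lee_fin mulr_ge0// exprn_ge0// ltW.
apply: eq_integral => t /[!inE]/= /sin_ge0_pi st.
rewrite /H -!EFinM; congr EFin.
rewrite (_ : c ^+ 2 - _ = (c * sin t) ^+ 2); last first.
  by rewrite [in RHS]exprMn sin2cos2; ring.
by rewrite max_l ?sqr_ge0//; ring.
Qed.

Lemma ge0_integral_mu3 (f : MR * MR * MR -> \bar R) :
  measurable_fun setT f -> (forall z, 0 <= f z)%E ->
  (\int[mu3 R]_z f z = \int[mu]_x \int[mu]_y \int[mu]_t f (x, y, t))%E.
Proof. by move=> mf f0; exact: (tonelli3 mu mu mu mf f0). Qed.

Lemma measurable_dist (a : V3 R) :
  measurable_fun [set: MR * MR * MR] (fun z : MR * MR * MR => vnorm (vsub a z)).
Proof.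
apply: (measurableT_comp measurable_sqrtr); rewrite /vdot/=.
have m1 : measurable_fun [set: MR * MR * MR] (fun z : MR * MR * MR => a.1.1 - z.1.1).
  by apply: measurable_funB => //; exact: measurableT_comp.
have m2 : measurable_fun [set: MR * MR * MR] (fun z : MR * MR * MR => a.1.2 - z.1.2).
  by apply: measurable_funB => //; exact: measurableT_comp.
have m3 : measurable_fun [set: MR * MR * MR] (fun z : MR * MR * MR => a.2 - z.2).
  by apply: measurable_funB.
by do 2?[apply: measurable_funD]; apply: measurable_funM.
Qed.

Lemma vnorm_ge0 (u : V3 R) : 0 <= vnorm u. Proof. exact: sqrtr_ge0. Qed.

Lemma vnorm_sqr (u : V3 R) : vnorm u ^+ 2 = u.1.1 ^+ 2 + u.1.2 ^+ 2 + u.2 ^+ 2.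
Proof.
rewrite sqr_sqrtr /vdot -?expr2 -?expr2; last by rewrite !addr_ge0// sqr_ge0.
by [].
Qed.

Lemma measurable_ball3 (a : V3 R) (c : R) :
  measurable [set z : MR * MR * MR | vnorm (vsub a z) < c].
Proof.
rewrite (_ : [set z | _] = setT `&` (fun z : MR * MR * MR => vnorm (vsub a z)) @^-1` `]-oo, c[%classic).
  by apply: measurable_dist.
by rewrite setTI; apply/seteqP; split => z /=; rewrite in_itv.
Qed.

Lemma volume_ball (a : V3 R) (c : R) : 0 < c ->
  mu3 R [set z | vnorm (vsub a z) < c] = (4 / 3 * pi * c ^+ 3)%:E.
Proof.
move=> c0; have mB := measurable_ball3 a c.
pose B := [set z : MR * MR * MR | vnorm (vsub a z) < c].
have -> : mu3 R [set z | vnorm (vsub a z) < c] = (\int[mu3 R]_z (\1_B z)%:E)%E.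
  by rewrite integral_indic// setIT.
rewrite ge0_integral_mu3//; last first.
  by apply/measurable_EFinP; exact: measurable_indic.
rewrite -(integral_disc_slice a.1.1 c0); apply: eq_integral => x _.
rewrite -(integral_sqrt_slice a.1.2); apply: eq_integral => y _.
rewrite -(lebesgue_measure_sqr_lt a.2).
pose S := [set t | (a.2 - t) ^+ 2 < c ^+ 2 - (a.1.1 - x) ^+ 2 - (a.1.2 - y) ^+ 2].
have SB t : ((x, y, t) \in B) = (t \in S).
  apply/idP/idP; rewrite !inE /B /S/= => h.
    by move: h; rewrite -(@ltr_pXn2r _ 2)// ?nnegrE ?vnorm_ge0 ?ltW// vnorm_sqr/=; lra.
  by rewrite -(@ltr_pXn2r _ 2)// ?nnegrE ?vnorm_ge0 ?ltW// vnorm_sqr/=; lra.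
have mS : measurable S.
  have := measurable_xsection (x, y) mB.
  by congr measurable; apply/seteqP; split => t; rewrite /xsection/= SB inE.
transitivity (\int[mu]_t (\1_S t)%:E)%E; last by rewrite integral_indic// setIT.
by apply: eq_integral => t _; rewrite !indicE SB.
Qed.

(** The law of the distance to [a] is determined by the volumes of balls, whose derivative in the
    radius is [4 * pi * r ^+ 2]. *)
Lemma ge0_integral_radial (a : V3 R) (H : R -> \bar R) :
  measurable_fun setT H -> (forall x, 0 <= H x)%E ->
  (\int[mu3 R]_z H (vnorm (vsub a z)) =
   \int[mu]_(r in `[0%R, +oo[) ((4 * pi * r ^+ 2)%:E * H r))%E.
Proof.
move=> mH H0; have pi0 := pi_gt0 R.
pose v : R -> R := (fun r => 4 * pi * r ^+ 2) \_ `[0, +oo[.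
have mv : measurable_fun setT v.
  apply/(measurable_restrictT _ (measurable_itv _)).
  by apply: measurable_funM => //; exact: measurable_funX.
have v0 x : 0 <= v x.
  by rewrite /v patchE; case: ifPn => // _; rewrite mulr_ge0 ?sqr_ge0// mulr_ge0// ltW.
have key c : (\int[mu3 R]_(x in [set x | (vnorm (vsub a x) < c)%R]) (cst 1 x)%:E =
              \int[mu]_(y in [set y | (y < c)%R]) (v y)%:E)%E.
  have -> : (\int[mu]_(y in [set y | (y < c)%R]) (v y)%:E =
      \int[mu]_(y in `[0%R, c[) (4 * pi * y ^+ 2)%:E)%E.
    rewrite [LHS]integral_mkcond [RHS]integral_mkcond; apply: eq_integral => y _.
    rewrite !patchE /v patchE.
    have -> : (y \in [set y | y < c]) = (y < c) by apply/idP/idP; rewrite inE.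
    rewrite !mem_setE !in_itv/= andbT.
    by case: (0 <= y); case: (y < c).
  have [c0|c0] := leP c 0.
    rewrite (_ : [set x | _] = set0); last first.
      apply/seteqP; split => z //=; rewrite ltNge => /negP; apply.
      by rewrite (le_trans c0)// vnorm_ge0.
    rewrite integral_set0 set_itv_ge ?integral_set0// bnd_simp -leNgt //.
  rewrite (eq_integral (cst 1%E))// integral_cst/=; last exact: measurable_ball3.
  rewrite mul1e volume_ball// integral_itv_bndo_bndc; last first.
    by apply/measurable_EFinP; apply: measurable_funM => //; exact: measurable_funX.
  have dF (x : R) : is_derive x 1 (fun t => 4 / 3 * pi * t ^+ 3) (4 * pi * x ^+ 2).
    by apply: is_derive_eq; rewrite /GRing.scale/= ?mulr0 ?add0r ?addr0 ?mulr1; field.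
  have cF x : {for x, continuous (fun t : R => 4 / 3 * pi * t ^+ 3)}.
    by apply/differentiable_continuous/derivable1_diffP; have [] := dF x.
  have c2 : {within `[0, c], continuous (fun x : R => 4 * pi * x ^+ 2)}.
    apply: continuous_subspaceT => x.
    apply: (@continuous_comp _ _ _ (fun t : R => t ^+ 2) ( *%R (4 * pi))).
      exact: exprn_continuous.
    exact: mulrl_continuous.
  rewrite (@continuous_FTC2 _ _ (fun t => 4 / 3 * pi * t ^+ 3))//.
  - by rewrite -EFinB; congr EFin; ring.
  - split.
    + by move=> x _; have [] := dF x.
    + by apply: cvg_at_right_filter; exact: cF.
    + by apply: cvg_at_left_filter; exact: cF.
  - by move=> x _; rewrite derive1E; have [_ ->] := dF x.
have fin c : (\int[mu3 R]_(x in [set x | (vnorm (vsub a x) < c)%R]) (cst 1 x)%:E < +oo)%E.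
  rewrite (eq_integral (cst 1%E))// integral_cst/=; last exact: measurable_ball3.
  have [c0|c0] := leP c 0; last by rewrite mul1e volume_ball// ltry.
  rewrite (_ : [set x | _] = set0) ?measure0 ?mule0//.
  apply/seteqP; split => z //=; rewrite ltNge => /negP; apply.
  by rewrite (le_trans c0)// vnorm_ge0.
have law := @integral_eq_law R _ _ _ _ (mu3 R) mu (cst 1) v (fun z => vnorm (vsub a z)) id
  (measurable_cst _) (fun=> ler01) (measurable_dist a) mv v0 (@measurable_id _ _ _) fin key
  H mH H0.
transitivity (\int[mu3 R]_x ((cst 1 x)%:E * H (vnorm (vsub a x))))%E.
  by apply: eq_integral => x _; rewrite mul1e.
rewrite law [RHS]integral_mkcond; apply: eq_integral => y _.
by rewrite /v !patchE; case: ifPn => // _; rewrite mul0e.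
Qed.

End radial.

(** * The Bessel kernel *)

Section bessel_bound.
Context {R : realType}.

(* The j-th derivative of sum_k (-w)^k / (k! (k+1)!) has these coefficients. *)
Let d (j k : nat) : R := (-1) ^+ (k + j) / (k`!%:R * (k + j).+1`!%:R).
Let h (j : nat) (w : R) : R := limn (pseries (d j) w).

Let factN0 n : n`!%:R != 0 :> R.
Proof. by rewrite pnatr_eq0 -lt0n fact_gt0. Qed.

Let d_diffs j : pseries_diffs (d j) = d j.+1.
Proof.
apply/funext => k; rewrite /pseries_diffs /d addSnnS factS natrM.
have := factN0 k; have := factN0 (k + j.+1).+1.
have : k.+1%:R != 0 :> R by rewrite pnatr_eq0.
by move=> ? ? ?; field; apply/and3P; split.
Qed.

Let cvg_d j w : cvgn (pseries (d j) w).
Proof.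
apply: normed_cvg; rewrite /normed_series_of /=.
apply: (@series_le_cvg _ _ (exp_coeff `|w|)).
- by move=> n.
- by move=> n; rewrite /exp_coeff/= mulr_ge0// ?exprn_ge0// invr_ge0.
- move=> n; rewrite /d /exp_coeff/= !normrM normrX normrN1 expr1n mul1r normfV normrM !normr_nat.
  rewrite normrX mulrC ler_wpM2l ?exprn_ge0// lef_pV2 ?posrE ?mulr_gt0 ?ltr0n ?fact_gt0//.
  by rewrite ler_peMr// ler1n fact_gt0.
- exact: is_cvg_series_exp_coeff.
Qed.

Let dh j (w : R) : is_derive w 1 (h j) (h j.+1 w).
Proof.
rewrite /h -d_diffs; apply: (@pseries_snd_diffs _ _ (`|w| + 1)).
- exact: cvg_d.
- by rewrite d_diffs; exact: cvg_d.
- by rewrite !d_diffs; exact: cvg_d.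
- by rewrite [ltRHS]ger0_norm ?ltrDl// addr_ge0.
Qed.

(** The differential equation [w h'' + 2 h' + h = 0] holds coefficient by coefficient. The factor
    [w] raises the degree by one, so the other two partial sums take one term more and the identity
    is exact at every stage. *)
Let ode_partial w n :
  w * pseries (d 2) w n + 2 * pseries (d 1) w n.+1 + pseries (d 0) w n.+1 = 0.
Proof.
have coef k : d 2 k + 2 * d 1 k.+1 + d 0 k.+1 = 0.
  rewrite /d addn2 addn1 addn0 (factS k) (factS k.+2) !natrM !exprS.
  have := factN0 k; have := factN0 k.+2.
  have : k.+1%:R != 0 :> R by rewrite pnatr_eq0.
  have : k.+3%:R != 0 :> R by rewrite pnatr_eq0.
  have -> : k.+3%:R = k%:R + 3 :> R by rewrite -natrD addn3.
  have -> : k.+1%:R = k%:R + 1 :> R by rewrite -natr1.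
  by move=> ? ? ? ?; field; apply/and4P; split.
rewrite /pseries/= /series/=; elim: n => [|n IH].
  have d10 : d 1 0 = - 2^-1 by rewrite /d add0n expr1 !factS fact0 !muln1 mul1r mulN1r.
  have d00 : d 0 0 = 1 by rewrite /d add0n expr0 !factS fact0 !muln1; field.
  by rewrite !big_nat1 big_nil !expr0 d10 d00; field.
rewrite big_nat_recr//= [X in _ + 2 * X + _]big_nat_recr//= [X in _ + _ + X]big_nat_recr//=.
move: IH (coef n); set A := \sum_(_ <= _ < _) _; set B := \sum_(_ <= _ < _) _.
set C := \sum_(_ <= _ < _) _ => IH cn.
transitivity ((w * A + 2 * B + C) + (d 2 n + 2 * d 1 n.+1 + d 0 n.+1) * w ^+ n.+1).
  by rewrite exprS; ring.
by rewrite IH cn mul0r addr0.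
Qed.

Let ode w : w * h 2 w + 2 * h 1 w + h 0 w = 0.
Proof.
have c2 : (fun n => w * pseries (d 2) w n + 2 * pseries (d 1) w n.+1 + pseries (d 0) w n.+1)
    @ \oo --> w * h 2 w + 2 * h 1 w + h 0 w.
  apply: cvgD; last by rewrite (cvg_shiftS (pseries (d 0) w)); exact: cvg_d.
  apply: cvgD; first by apply: cvgM; [exact: cvg_cst|exact: cvg_d].
  apply: cvgM; first exact: cvg_cst.
  by rewrite (cvg_shiftS (pseries (d 1) w)); exact: cvg_d.
have E : (fun n => w * pseries (d 2) w n + 2 * pseries (d 1) w n.+1 + pseries (d 0) w n.+1) =
    cst 0 by apply/funext => n; exact: ode_partial.
by rewrite E in c2; apply: (cvg_unique _ c2 (cvg_cst _)).
Qed.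

(* [w h'^2 + h^2] is nonincreasing because of [w h'' + 2 h' + h = 0]. *)
Let h_le1 w : 0 <= w -> `|h 0 w| <= 1.
Proof.
move=> w0; pose E (w : R) := w * h 1 w ^+ 2 + h 0 w ^+ 2.
(* The derivative [h'^2 + 2 h' (w h'' + h)] collapses to [-3 h'^2], because [w h'' + h = -2 h']. *)
have dE (x : R) : is_derive x 1 E (- 3 * h 1 x ^+ 2).
  have d0 := dh 0 x; have d1 := dh 1 x.
  rewrite /E; apply: is_derive_eq; rewrite /GRing.scale/=.
  have := ode x; move: (h 0 x) (h 1 x) (h 2 x) => a b c abc.
  have -> : a = - (x * c + 2 * b) by lra.
  ring.
have h0 : h 0 0 = 1.
  rewrite /h; apply: cvg_lim => //; rewrite -(cvg_shiftS (pseries (d 0) 0)).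
  apply: cvg_near_cst; apply: nearW => n.
  rewrite /pseries/= /series/= big_nat_recl// big1 ?addr0.
    by rewrite /d addn0 !expr0 !factS fact0 !muln1; field.
  by move=> i _; rewrite expr0n/= mulr0.
have Ele : E w <= E 0.
  apply: (@ler0_derive1_nincr _ E 0 w) => //.
  - move=> x _; rewrite derive1E; have [_ ->] := dE x.
    by rewrite mulNr oppr_le0 mulr_ge0// sqr_ge0.
  - apply: continuous_subspaceT => x.
    by apply/differentiable_continuous/derivable1_diffP; have [] := dE x.
move: Ele; rewrite /E h0 mul0r add0r expr1n => Ele.
rewrite -(@ler_pXn2r _ 2)// ?nnegrE// real_normK ?num_real// expr1n.
by apply: le_trans Ele; rewrite lerDr mulr_ge0// sqr_ge0.
Qed.

Lemma besselJ1_le (z : R) : `|besselJ1 z| <= `|z| / 2.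
Proof.
(* The substitution [w = (z / 2) ^+ 2] makes the oscillating series of [besselJ1] a power series
   with value 1 at 0. *)
have -> : besselJ1 z = z / 2 * h 0 ((z / 2) ^+ 2).
  rewrite /besselJ1; apply: cvg_lim => //.
  rewrite (_ : series _ = fun n => z / 2 * pseries (d 0) ((z / 2) ^+ 2) n).
    by apply: cvgM; [exact: cvg_cst|exact: cvg_d].
  apply/funext => n; rewrite /pseries/= /series/= mulr_sumr; apply: eq_bigr => k _.
  by rewrite /d !addn0 addn1 exprS exprM mulrCA.
rewrite normrM ler_pdivlMr// normrM normfV (ger0_norm (ler0n _ 2)) mulrAC divfK//.
by rewrite ler_piMr// h_le1// sqr_ge0.
Qed.

End bessel_bound.

(** * Boxes and null sets in the eight-fold product *)

Section product_sets.
Local Open Scope ereal_scope.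
Context d1 d2 (T1 : measurableType d1) (T2 : measurableType d2) (R : realType).
Variables (m1 : {measure set T1 -> \bar R}) (m2 : {sigma_finite_measure set T2 -> \bar R}).

Lemma product_measure1_gt0 (A : set T1) (B : set T2) : measurable A -> measurable B ->
  0 < m1 A -> 0 < m2 B -> 0 < (m1 \x m2) (A `*` B).
Proof. by move=> mA mB A0 B0; rewrite product_measure1E// mule_gt0. Qed.

Lemma product_measure1_eq0l (A : set T1) (B : set T2) : measurable A -> measurable B ->
  m1 A = 0 -> (m1 \x m2) (A `*` B) = 0.
Proof. by move=> mA mB A0; rewrite product_measure1E// A0 mul0e. Qed.

Lemma product_measure1_eq0r (A : set T1) (B : set T2) : measurable A -> measurable B ->
  m2 B = 0 -> (m1 \x m2) (A `*` B) = 0.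
Proof. by move=> mA mB B0; rewrite product_measure1E// B0 mule0. Qed.

End product_sets.

Section product8.
Local Open Scope ereal_scope.
Context e0 e1 e2 e3 e4 e5 e6 e7
  (T0 : measurableType e0)
  (T1 : measurableType e1)
  (T2 : measurableType e2)
  (T3 : measurableType e3)
  (T4 : measurableType e4)
  (T5 : measurableType e5)
  (T6 : measurableType e6)
  (T7 : measurableType e7) (R : realType).
Variable m0 : {measure set T0 -> \bar R}.
Variable m1 : {sigma_finite_measure set T1 -> \bar R}.
Variable m2 : {sigma_finite_measure set T2 -> \bar R}.
Variable m3 : {sigma_finite_measure set T3 -> \bar R}.
Variable m4 : {sigma_finite_measure set T4 -> \bar R}.
Variable m5 : {sigma_finite_measure set T5 -> \bar R}.
Variable m6 : {sigma_finite_measure set T6 -> \bar R}.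
Variable m7 : {sigma_finite_measure set T7 -> \bar R}.

(** Boxes of positive measure are what turns a pointwise violation of a bound, by continuity, into
    an essential one. *)
Lemma product8_gt0 (A0 : set T0) (A1 : set T1) (A2 : set T2) (A3 : set T3) (A4 : set T4)
    (A5 : set T5) (A6 : set T6) (A7 : set T7) :
  measurable A0 -> measurable A1 -> measurable A2 -> measurable A3 -> measurable A4 ->
  measurable A5 -> measurable A6 -> measurable A7 ->
  0 < m0 A0 -> 0 < m1 A1 -> 0 < m2 A2 -> 0 < m3 A3 -> 0 < m4 A4 -> 0 < m5 A5 -> 0 < m6 A6 -> 0 < m7 A7 ->
  0 < (((((((m0 \x m1) \x m2) \x m3) \x m4) \x m5) \x m6) \x m7)
    (A0 `*` A1 `*` A2 `*` A3 `*` A4 `*` A5 `*` A6 `*` A7).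
Proof.
move=> mA0 mA1 mA2 mA3 mA4 mA5 mA6 mA7 p0 p1 p2 p3 p4 p5 p6 p7.
by do 7![apply: product_measure1_gt0 => //; do ?[apply: measurableX => //]].
Qed.

Lemma product8_eq0_1 (A : set T0) : measurable A -> m0 A = 0 ->
  (((((((m0 \x m1) \x m2) \x m3) \x m4) \x m5) \x m6) \x m7)
    (A `*` setT `*` setT `*` setT `*` setT `*` setT `*` setT `*` setT) = 0.
Proof.
move=> mA A0.
by do 7![apply: product_measure1_eq0l => //; do ?[apply: measurableX => //]].
Qed.

Lemma product8_eq0_5 (A : set T4) : measurable A -> m4 A = 0 ->
  (((((((m0 \x m1) \x m2) \x m3) \x m4) \x m5) \x m6) \x m7)
    (setT `*` setT `*` setT `*` setT `*` A `*` setT `*` setT `*` setT) = 0.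
Proof.
move=> mA A0.
do 3![apply: product_measure1_eq0l => //; do ?[apply: measurableX => //]].
by apply: product_measure1_eq0r => //; do ?[apply: measurableX => //].
Qed.

(** The factors [T0] and [T4] are the two time axes; [A] and [B] will be the instant 0. *)
Lemma product8_negligible (A : set T0) (B : set T4) :
  measurable A -> measurable B -> m0 A = 0 -> m4 B = 0 ->
  (((((((m0 \x m1) \x m2) \x m3) \x m4) \x m5) \x m6) \x m7).-negligible
    ((A `*` setT `*` setT `*` setT `*` setT `*` setT `*` setT `*` setT) `|`
     (setT `*` setT `*` setT `*` setT `*` B `*` setT `*` setT `*` setT)).
Proof.
move=> mA mB A0 B0; apply: negligibleU.
- apply/negligibleP; [by do 7?[apply: measurableX => //]|exact: product8_eq0_1].
- apply/negligibleP; [by do 7?[apply: measurableX => //]|exact: product8_eq0_5].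
Qed.

End product8.

(** * From the essential supremum to a bound at every point *)

Section weighted_norm.
Context {R : realType}.
Local Notation mu := (@lebesgue_measure R).
Variable g : R -> R.
Hypothesis g_gt0 : forall t, 0 <= t -> 0 < g t.
Hypothesis g_nd : forall s t, 0 <= s -> s <= t -> g s <= g t.

(* At [0] the essential supremum only controls the right limit of [g]. *)
Definition gext (t : R) : R :=
  if t < 0 then 0 else if t == 0 then inf [set g s | s in `]0, +oo[%classic] else g t.

Let has_inf_g : has_inf [set g s | s in `]0, +oo[%classic].
Proof.
split; first by exists (g 1); exists 1 => //=; rewrite in_itv/= ltr01.
exists 0 => y [s /=]; rewrite in_itv/= andbT => /ltW s0 <-; exact/ltW/g_gt0.
Qed.

Lemma gext_pos t : 0 < t -> gext t = g t.
Proof. by move=> t0; rewrite /gext ltNge (ltW t0)/= gt_eqF. Qed.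

Lemma gext_neg t : t < 0 -> gext t = 0.
Proof. by rewrite /gext => ->. Qed.

Lemma gext_ge0 t : 0 <= gext t.
Proof.
rewrite /gext; case: ltP => // t0; case: eqP => // [_|_]; last exact/ltW/g_gt0.
apply: lb_le_inf; first exact: has_inf_g.1.
by move=> y [s /=]; rewrite in_itv/= andbT => /ltW s0 <-; exact/ltW/g_gt0.
Qed.

Lemma gext0_le s : 0 < s -> gext 0 <= g s.
Proof.
move=> s0; rewrite /gext ltxx eqxx; apply: ge_inf; first exact: has_inf_g.2.
by exists s => //=; rewrite in_itv/= s0.
Qed.

Lemma gext_nd : {homo gext : s t / s <= t}.
Proof.
move=> s t st; have [s0|s0|s0] := ltgtP s 0; first by rewrite gext_neg// gext_ge0.
  by rewrite !gext_pos ?(lt_le_trans s0 st)// g_nd// ltW.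
rewrite s0 in st *; move: st; rewrite le_eqVlt => /predU1P[<-//|t0].
by rewrite [leRHS]gext_pos// gext0_le.
Qed.

Lemma measurable_gext : measurable_fun [set: R] gext.
Proof. by apply: nondecreasing_measurable => // s t; exact: gext_nd. Qed.

(** At [t = 0] the value of [gext] is an infimum over positive times, so a bound at all positive
    times passes to it; at [t > 0] the choice [s = t] is available. *)
Lemma le_gext (A k t : R) : 0 <= k -> 0 <= t ->
  (forall s, 0 < s -> t <= s -> A <= k * g s) -> A <= k * gext t.
Proof.
move=> k0; rewrite le_eqVlt => /predU1P[<-|t0] Ak; last by rewrite gext_pos// Ak.
move: k0; rewrite le_eqVlt => /predU1P[k0|k0].
  by have := Ak 1 ltr01 ler01; rewrite -k0 !mul0r.
rewrite -ler_pdivrMl// /gext ltxx eqxx; apply: lb_le_inf; first exact: has_inf_g.1.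
move=> y [s /=]; rewrite in_itv/= andbT => s0 <-.
by rewrite ler_pdivrMl// Ak// ltW.
Qed.

Lemma ae_mu8_pos : {ae mu8 R, forall z : R8 R,
  (pair_of_R8 z).1.1 != 0 /\ (pair_of_R8 z).2.1 != 0}.
Proof.
have mO : measurable ([set 0] : set (measurableTypeR R)) by exact: measurable_set1.
have O0 : mu [set 0] = 0%E by exact: lebesgue_measure_set1.
have [N [mN N0 sN]] :=
  @product8_negligible _ _ _ _ _ _ _ _ _ _ _ _ _ _ _ _ R
    mu mu mu mu mu mu mu mu _ _ mO mO O0 O0.
exists N; split => //; apply: subset_trans sN.
move=> [[[[[[[x0 x1] x2] x3] y0] y1] y2] y3] /= /not_andP[] /negP; rewrite negbK => /eqP ->.
  by left.
by right.
Qed.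

(** The hyperplanes where a time vanishes are null, so it is enough to test strictly positive
    times. *)
Lemma gwnorm_le (phi : cfun R) (C : \bar R) :
  (forall x y : Defs.point R, 0 < x.1 -> 0 < y.1 ->
     ((cmod (phi x y) / (g x.1 * g y.1))%:E <= C)%E) ->
  (gwnorm g phi <= C)%E.
Proof.
move=> phiC; apply/ess_supP; case: ae_mu8_pos => N [mN N0 sN].
exists N; split => //; apply: subset_trans sN; apply: subsetC => z /=.
case: ifPn => [/andP[x0 y0] [x00 y00]|_ _]; last exact: leNye.
by apply: phiC; rewrite lt_def ?x00 ?y00.
Qed.

Lemma cmod_ge0 (z : R * R) : 0 <= cmod z. Proof. exact: sqrtr_ge0. Qed.

Lemma cmod_continuous (fr fi : 'rV[R]_8 -> R) w :
  {for w, continuous fr} -> {for w, continuous fi} ->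
  {for w, continuous (fun w => cmod (fr w, fi w))}.
Proof.
move=> cr ci; rewrite /cmod/=.
apply: (@continuous_comp _ _ _ (fun w => fr w ^+ 2 + fi w ^+ 2) Num.sqrt).
  have sq (f : 'rV[R]_8 -> R) : {for w, continuous f} -> {for w, continuous (fun w : 'rV[R]_8 => f w ^+ 2)}.
    by move=> cf; apply: (@continuous_comp _ _ _ f (fun y : R => y ^+ 2)) => //; exact: exprn_continuous.
  by apply: (@continuousD _ R^o); exact: sq.
exact: sqrt_continuous.
Qed.

(** A violation at one point persists, by continuity of the Schwartz extensions, on a neighbourhood.
    Cut to times in []0, s[] and []0, t[] it is still a box of positive measure, and there
    monotonicity replaces the weight by [g s * g t], even where [g] jumps. *)
Lemma gwnorm_pointwise_le (psi : cfun R) (c : R) (x y : Defs.point R) (s t : R) :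
  schwartz_half psi -> (gwnorm g psi <= c%:E)%E -> 0 <= x.1 -> 0 <= y.1 ->
  0 < s -> 0 < t -> x.1 <= s -> y.1 <= t ->
  cmod (psi x y) <= c * (g s * g t).
Proof.
move=> [fr [fi [[dr _] [[di _] psiE]]]] /ess_supP psic x0 y0 s0 t0 xs yt.
rewrite leNgt; apply/negP => psigt.
pose K w := cmod (fr w, fi w).
have cK : {for coords8 x y, continuous K}.
  apply: cmod_continuous; apply: differentiable_continuous;
    [exact: (dr [::])|exact: (di [::])].
have : \forall w \near coords8 x y, c * (g s * g t) < K w.
  by apply: (cvgr_gt (K (coords8 x y)) cK); rewrite /K -psiE.
move=> /nbhs_ballP[e /= e0 Ke].
pose I (u : R) : set (measurableTypeR R) := `]u - e, u + e[%classic.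
pose J (u v : R) : set (measurableTypeR R) := `]Num.max 0 (u - e), Num.min v (u + e)[%classic.
have Ip u : (0 < mu (I u))%E.
  have lt : u - e < u + e by rewrite ltrD2l gtrN.
  by rewrite lebesgue_measure_itv/= lte_fin lt -EFinD lte_fin subr_gt0.
have Jp u v : 0 <= u -> 0 < v -> u <= v -> (0 < mu (J u v))%E.
  move=> u0 v0 uv; have lt : Num.max 0 (u - e) < Num.min v (u + e).
    rewrite gt_max !lt_min v0 ltr_wpDl//= (lt_le_trans _ uv) ?gtrBl//=.
    by rewrite ltrD2l gtrN.
  by rewrite lebesgue_measure_itv/= lte_fin lt -EFinD lte_fin subr_gt0.
have mI u : measurable (I u) by exact: measurable_itv.
have mJ u v : measurable (J u v) by exact: measurable_itv.
pose B := J x.1 s `*` I x.2.1.1 `*` I x.2.1.2 `*` I x.2.2 `*`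
          J y.1 t `*` I y.2.1.1 `*` I y.2.1.2 `*` I y.2.2.
have mB : measurable B by do 7?[apply: measurableX => //].
have Bp : (0 < mu8 R B)%E by exact: (@product8_gt0 _ _ _ _ _ _ _ _ _ _ _ _ _ _ _ _ R
    mu mu mu mu mu mu mu mu _ _ _ _ _ _ _ _ (mJ _ _) (mI _) (mI _) (mI _)
    (mJ _ _) (mI _) (mI _) (mI _) (Jp _ _ x0 s0 xs) (Ip _) (Ip _) (Ip _)
    (Jp _ _ y0 t0 yt) (Ip _) (Ip _) (Ip _)).
(* A box of positive measure is not contained in the exceptional null set, so the essential bound
   holds at some point of the box. *)
have [z [Bz zc]] : exists z : R8 R, B z /\ (let xy := pair_of_R8 z in
    (if (0 <= xy.1.1)%R && (0 <= xy.2.1)%R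
     then (cmod (psi xy.1 xy.2) / (g xy.1.1 * g xy.2.1))%:E else -oo) <= c%:E)%E.
  apply/not_existsP => nz; case: psic => N [mN N0 subN].
  have BN : B `<=` N by move=> z Bz; apply: subN => zc; apply: (nz z).
  have := le_measure (mu8 R) (mem_set mB) (mem_set mN) BN.
  by rewrite leNgt /= N0 Bp.
case: z Bz zc => [[[[[[[z0 z1] z2] z3] w0] w1] w2] w3] /=.
rewrite /B /I /J /= !in_itv/= => -[[[[[[[]]]]]]].
rewrite !gt_max !lt_min => /andP[/andP[z00 z0x] /andP[z0s z0x']] z1x z2x z3x.
move=> /andP[/andP[w00 w0y] /andP[w0t w0y']] w1y w2y w3y.
rewrite (ltW z00) (ltW w00)/= lee_fin ler_pdivrMr; last by rewrite mulr_gt0// g_gt0// ltW.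
move=> le.
have gg : 0 < g z0 * g w0 by rewrite mulr_gt0// g_gt0// ltW.
have c0 : 0 <= c.
  by rewrite -(pmulr_lge0 _ gg); apply: le_trans le; exact: cmod_ge0.
have : c * (g s * g t) < c * (g z0 * g w0).
  apply: lt_le_trans le.
  rewrite psiE /halfM/= ?ltW//; apply: Ke.
  split => // i j; rewrite !mxE /ball/=.
  case: j => [[|[|[|[|[|[|[|[|//]]]]]]]] /= ?]; rewrite ltr_distlC//; exact/andP.
by rewrite ltNge ler_wpM2l// ler_pM ?g_nd ?ltW// g_gt0// ltW.
Qed.

Lemma gwnorm_ge0 (psi : cfun R) (c : R) :
  schwartz_half psi -> (gwnorm g psi <= c%:E)%E -> 0 <= c.
Proof.
move=> spsi psic.
pose p : Defs.point R := (0, (0, 0, 0)).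
have := @gwnorm_pointwise_le psi c p p 1 1 spsi psic (lexx _) (lexx _) ltr01 ltr01 ler01 ler01.
move=> /(le_trans (cmod_ge0 _)).
by rewrite pmulr_lge0// mulr_gt0// g_gt0.
Qed.

Lemma gwnorm_pointwise (psi : cfun R) (c : R) (x y : Defs.point R) :
  schwartz_half psi -> (gwnorm g psi <= c%:E)%E -> 0 <= x.1 -> 0 <= y.1 ->
  cmod (psi x y) <= c * (gext x.1 * gext y.1).
Proof.
move=> spsi psic x0 y0; have c0 := gwnorm_ge0 spsi psic.
rewrite mulrA; apply: le_gext => //; first by rewrite mulr_ge0// gext_ge0.
move=> t t0 yt; rewrite mulrAC; apply: le_gext => //.
  by rewrite mulr_ge0// ltW// g_gt0// ltW.
by move=> s s0 xs; rewrite -mulrA (mulrC (g t)); exact: (gwnorm_pointwise_le spsi psic).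
Qed.

(** The Schwartz bounds with no derivative and no polynomial weight make [psi] bounded, and [M]
    bounds the inverse weights. The origin excludes a negative value and, with it, [-oo]. *)
Lemma gwnorm_fin (psi : cfun R) (M : R) : (forall t, 0 <= t -> (g t)^-1 <= M) ->
  schwartz_half psi -> exists2 N : R, 0 <= N & gwnorm g psi = N%:E.
Proof.
move=> gM spsi; have [fr [fi [[_ /(_ [::] 0%N) [Cr hr]] [[_ /(_ [::] 0%N) [Ci hi]] psiE]]]] := spsi.
have M0 : 0 <= M by apply: le_trans (gM 0 (lexx _)); rewrite invr_ge0 ltW// g_gt0.
have up : (gwnorm g psi <= ((Cr + Ci) * (M * M))%:E)%E.
  apply: gwnorm_le => x y x0 y0; rewrite lee_fin psiE; [|exact: ltW|exact: ltW].
  set w := coords8 x y.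
  have hrw : `|fr w| <= Cr by have := hr w; rewrite expr0 mul1r.
  have hiw : `|fi w| <= Ci by have := hi w; rewrite expr0 mul1r.
  have gx := g_gt0 (ltW x0); have gy := g_gt0 (ltW y0).
  apply: ler_pM; [exact: cmod_ge0|by rewrite invr_ge0 mulr_ge0// ltW| |].
    apply: (@le_trans _ _ (`|fr w| + `|fi w|)); last exact: lerD.
    rewrite -(@ler_pXn2r _ 2) ?nnegrE ?cmod_ge0 ?addr_ge0// /cmod sqr_sqrtr ?addr_ge0 ?sqr_ge0//=.
    rewrite sqrrD !real_normK ?num_real// lerD2r lerDl mulrn_wge0// mulr_ge0//.
  by rewrite invfM; apply: ler_pM; rewrite ?invr_ge0 ?gM// ltW.
case E : (gwnorm g psi) up => [N| |] up.
- by exists N => //; apply: gwnorm_ge0 spsi _; rewrite E.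
- by rewrite leye_eq in up.
- have := @gwnorm_ge0 psi (-1) spsi; rewrite E => /(_ (leNye _)).
  by rewrite ler0N1.
Qed.

End weighted_norm.

(** * Iterated primitives as convolutions *)

Section iterated_primitives.
Context {R : realType}.
Local Notation mu := (@lebesgue_measure R).
Variable g : R -> R.
Hypothesis g_gt0 : forall t, 0 <= t -> 0 < g t.
Hypothesis g_nd : forall s t, 0 <= s -> s <= t -> g s <= g t.
Local Notation G := (gext g).

Let G0 t : 0 <= G t. Proof. exact: gext_ge0. Qed.
Let mG : measurable_fun [set: R] G. Proof. exact: measurable_gext. Qed.
Let Gnd : {homo G : s t / s <= t}. Proof. exact: gext_nd. Qed.

Lemma integral_shifted_power (n : nat) (r t : R) : r <= t ->
  (\int[mu]_(s in `[r, t]) ((s - r) ^+ n / n`!%:R)%:E =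
   ((t - r) ^+ n.+1 / n.+1`!%:R)%:E)%E.
Proof.
have nf : n`!%:R != 0 :> R by rewrite pnatr_eq0 -lt0n fact_gt0.
have n1 : n.+1%:R != 0 :> R by rewrite pnatr_eq0.
rewrite le_eqVlt => /predU1P[->|rt].
  by rewrite set_itv1 integral_set1 subrr expr0n/= mul0r.
have dF (x : R) : is_derive x 1 (fun s => (s - r) ^+ n.+1 / n.+1`!%:R) ((x - r) ^+ n / n`!%:R).
  have d1 : is_derive x 1 (fun s : R => s - r) 1 by apply: is_derive_eq; rewrite subr0.
  have d2 := is_deriveX n.+1 d1.
  have -> : (fun s => (s - r) ^+ n.+1 / n.+1`!%:R) =
      (n.+1`!%:R)^-1 *: ((fun s : R => s - r) ^+ n.+1).
    by apply/funext => s; rewrite scalrfctE exprfctE /GRing.scale/= mulrC.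
  apply: is_derive_eq; rewrite /GRing.scale/= mulr1 factS natrM.
  by field; rewrite ?natr1 ?nat1r n1 nf.
have cF x : {for x, continuous (fun s : R => (s - r) ^+ n.+1 / n.+1`!%:R)}.
  by apply/differentiable_continuous/derivable1_diffP; have [] := dF x.
have cf : {within `[r, t], continuous (fun s : R => (s - r) ^+ n / n`!%:R)}.
  apply: continuous_subspaceT => x.
  apply: (@continuous_comp _ _ _ (fun s : R => s - r) (fun s => s ^+ n / n`!%:R)).
    by apply: (@continuousB _ R^o); [exact: cvg_id|exact: cvg_cst].
  apply: (@continuous_comp _ _ _ (fun s : R => s ^+ n) (fun s => s / n`!%:R)).
    exact: exprn_continuous.
  exact: mulrr_continuous.
rewrite (@continuous_FTC2 _ _ (fun s => (s - r) ^+ n.+1 / n.+1`!%:R) _ _ rt cf).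
- by rewrite subrr expr0n/= mul0r sube0.
- split.
  + by move=> x _; have [] := dF x.
  + by apply: cvg_at_right_filter; exact: cF.
  + by apply: cvg_at_left_filter; exact: cF.
- by move=> x _; rewrite derive1E; have [_ ->] := dF x.
Qed.

(** Cauchy's formula for repeated integration: by Tonelli on the triangle [0 <= r <= s <= t], the
    inner integral of [(s - r)^n / n!] over [s] raises the power by one. Replacing [g] by its
    modification at 0 changes no integral. *)
Lemma gnE (n : nat) (t : R) : 0 <= t ->
  (gn g n.+1 t)%:E = (\int[mu]_(r in `[0%R, t]) ((t - r) ^+ n / n`!%:R * G r)%:E)%E.
Proof.
elim: n t => [|n IH] t t0.
  have E : (\int[mu]_(r in `[0%R, t]) (g r)%:E =
            \int[mu]_(r in `[0%R, t]) (G r)%:E)%E.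
    have E r : r \in `]0, t] -> g r = G r.
      by rewrite in_itv/= => /andP[r0 _]; rewrite gext_pos.
    rewrite -integral_itv_obnd_cbnd; last first.
      apply/measurable_EFinP; apply: (eq_measurable_fun G).
        by move=> r /[!inE]/= /E.
      exact: measurable_funS mG.
    rewrite -[RHS]integral_itv_obnd_cbnd; last first.
      by apply/measurable_EFinP; exact: measurable_funS mG.
    by apply: eq_integral => r /[!inE]/= /E ->.
  rewrite /= /Rintegral fineK E.
    by apply: eq_integral => r _; rewrite expr0 fact0 divr1 mul1r.
  rewrite ge0_fin_numE; last by apply: integral_ge0 => r _; rewrite lee_fin.
  apply: (@le_lt_trans _ _ (\int[mu]_(r in `[0%R, t]) (G t)%:E)%E).
    apply: ge0_le_lower_integral => r /=; rewrite ?lee_fin// in_itv/= => /andP[_ rt].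
    exact: Gnd.
  rewrite integral_cst//= lebesgue_measure_itv/=; case: ifPn => _.
    by rewrite -EFinD -EFinM ltry.
  by rewrite mule0.
rewrite [gn]lock /= -lock /= /Rintegral.
pose f (sr : measurableTypeR R * measurableTypeR R) : \bar R :=
  (if [&& 0 <= sr.2, sr.2 <= sr.1 & sr.1 <= t] then
     (sr.1 - sr.2) ^+ n / n`!%:R * G sr.2 else 0)%:E.
have mf : measurable_fun setT f.
  apply/measurable_EFinP; apply: measurable_fun_ifT => //.
    apply: measurable_and; first exact: measurable_fun_ler.
    by apply: measurable_and; exact: measurable_fun_ler.
  apply: measurable_funM; last exact: measurableT_comp mG _.
  apply: measurable_funM => //; apply: measurable_funX; exact: measurable_funB.
have f0 sr : (0 <= f sr)%E.
  rewrite lee_fin; case: ifPn => // /and3P[_ sr0 _].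
  by rewrite !mulr_ge0// ?invr_ge0// exprn_ge0// subr_ge0.
have E1 : (\int[mu]_(s in `[0%R, t]) (gn g n.+1 s)%:E = \int[mu]_s \int[mu]_r f (s, r))%E.
  rewrite integral_mkcond; apply: eq_integral => s _; rewrite patchE.
  case: ifPn => [/[!inE]/=|].
    rewrite in_itv/= => /andP[s0 st]; rewrite IH// integral_mkcond.
    apply: eq_integral => r _; rewrite patchE /f/= mem_setE in_itv/= st andbT.
    by case: ifPn.
  rewrite notin_setE/= in_itv/= => /negP st; rewrite integral0_eq// => r _.
  rewrite /f/=; case: ifPn => // /and3P[r0 rs st'].
  by move: st; rewrite st' (le_trans r0 rs).
have E2 : (\int[mu]_s \int[mu]_r f (s, r) =
    \int[mu]_(r in `[0%R, t]) ((t - r) ^+ n.+1 / n.+1`!%:R * G r)%:E)%E.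
  apply: etrans; first exact: (@fubini_tonelli _ _ _ _ R mu mu f mf f0).
  rewrite [RHS]integral_mkcond; apply: eq_integral => r _; rewrite patchE.
  case: ifPn => [/[!inE]/=|].
    rewrite in_itv/= => /andP[r0 rt].
    transitivity (\int[mu]_(s in `[r, t]) (((s - r) ^+ n / n`!%:R)%:E * (G r)%:E))%E.
      rewrite [RHS]integral_mkcond; apply: eq_integral => s _; rewrite patchE /f/=.
      by rewrite mem_setE in_itv/= r0/=; case: ifPn.
    rewrite ge0_integralZr//.
    - by rewrite integral_shifted_power.
    - apply/measurable_EFinP; apply: measurable_funM => //.
      by apply: measurable_funX; exact: measurable_funB.
    - move=> s /=; rewrite in_itv/= => /andP[rs _].
      by rewrite lee_fin mulr_ge0 ?invr_ge0// exprn_ge0// subr_ge0.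
    - by rewrite lee_fin.
  rewrite notin_setE/= in_itv/= => /negP st; rewrite integral0_eq// => s _.
  rewrite /f/=; case: ifPn => // /and3P[r0 rs st'].
  by move: st; rewrite r0 (le_trans rs st').
change ((fine (\int[mu]_(x in `[0%R, t]) (gn g n.+1 x)%:E))%:E =
  \int[mu]_(r in `[0%R, t]) ((t - r) ^+ n.+1 / n.+1`!%:R * G r)%:E)%E.
(* The function [gn] takes the real part of an extended integral, so the identity also needs this
   integral to be finite; a constant on [[0, t]] bounds the integrand. *)
rewrite E1 E2 fineK// ge0_fin_numE; last first.
  apply: integral_ge0 => r /=; rewrite in_itv/= => /andP[r0 rt].
  by rewrite lee_fin !mulr_ge0// ?invr_ge0// exprn_ge0// subr_ge0.
apply: (@le_lt_trans _ _ (\int[mu]_(r in `[0%R, t]) (t ^+ n.+1 / n.+1`!%:R * G t)%:E)%E).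
  apply: ge0_le_lower_integral => r /=; rewrite in_itv/= => /andP[r0 rt].
    by rewrite lee_fin !mulr_ge0// ?invr_ge0// exprn_ge0// subr_ge0.
  rewrite lee_fin ler_pM ?Gnd//.
    by rewrite mulr_ge0 ?invr_ge0// exprn_ge0// subr_ge0.
  by rewrite ler_wpM2r ?invr_ge0// lerXn2r ?nnegrE ?subr_ge0// lerBlDr lerDl.
rewrite integral_cst//= lebesgue_measure_itv/=; case: ifPn => _.
  by rewrite -EFinD -EFinM ltry.
by rewrite mule0.
Qed.

(** Reflection [r |-> t - r] in Cauchy's formula. The half line replaces [[0, t]] because [gext g]
    vanishes at negative times, which is the form produced by radial integration. *)
Lemma gn_convolution (n : nat) (t : R) : 0 <= t ->
  (\int[mu]_(r in `[0%R, +oo[) (r ^+ n / n`!%:R * G (t - r))%:E = (gn g n.+1 t)%:E)%E.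
Proof.
move=> t0; pose K s : \bar R := (`|t - s| ^+ n / n`!%:R * G s)%:E.
have mK : measurable_fun setT K.
  apply/measurable_EFinP; apply: measurable_funM => //; apply: measurable_funM => //.
  by apply: measurable_funX; apply: measurableT_comp => //; exact: measurable_funB.
have K0 s : (0 <= K s)%E by rewrite lee_fin !mulr_ge0 ?invr_ge0// exprn_ge0.
transitivity (\int[mu]_(r in `[0%R, t]) K (t - r)%R)%E.
  rewrite [LHS]integral_mkcond [RHS]integral_mkcond; apply: eq_integral => r _.
  rewrite !patchE !mem_setE !in_itv/= andbT /K.
  have [r0|//] := leP 0 r; have [rt|tr]/= := leP r t.
    by rewrite subKr ger0_norm.
  by rewrite gext_neg ?mulr0// subr_lt0.
rewrite ge0_integral_reflect// subrr subr0 gnE//.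
apply: eq_integral => r /[!inE]/=; rewrite in_itv/= => /andP[r0 rt].
by rewrite /K ger0_norm// subr_ge0.
Qed.

Lemma gn1E (t : R) : 0 <= t -> (\int[mu]_(r in `[0%R, t]) (G r)%:E = (gn g 1 t)%:E)%E.
Proof.
by move=> t0; rewrite gnE//; apply: eq_integral => r _; rewrite expr0 fact0 divr1 mul1r.
Qed.

Lemma gn_ge0 (n : nat) (t : R) : 0 <= t -> 0 <= gn g n t.
Proof.
case: n => [|n] t0; first exact/ltW/g_gt0.
rewrite -lee_fin gnE//; apply: integral_ge0 => r /=; rewrite in_itv/= => /andP[r0 rt].
by rewrite lee_fin !mulr_ge0// ?invr_ge0// exprn_ge0// subr_ge0.
Qed.

(** The radial integral over a future light cone, where the surface factor [s ^+ 2] against [1 / s]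
    leaves the weight [s]. The Heaviside factor forces [s <= t - tau <= t], and the shift by [tau]
    lands inside [[0, t]]. *)
Lemma gn1_advanced_le (tau t : R) : 0 <= tau -> 0 <= t ->
  (\int[mu]_(s in `[0%R, +oo[) (s * (heav (t - (tau + s)) * G (tau + s)))%:E <=
   (t * gn g 1 t)%:E)%E.
Proof.
move=> tau0 t0; have [taut|ttau] := leP tau t; last first.
  rewrite integral0_eq ?lee_fin ?mulr_ge0 ?gn_ge0// => s /=; rewrite in_itv/= andbT => s0.
  by rewrite /heav ifF ?mul0r ?mulr0//; apply/negbTE; rewrite -ltNge; lra.
have mG' : measurable_fun setT (EFin \o G) by exact/measurable_EFinP.
have mGs : measurable_fun setT (fun s : R => (G (s + tau))%:E).
  by apply/measurable_EFinP; apply: (measurableT_comp mG); exact: measurable_funD.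
apply: (@le_trans _ _ (\int[mu]_(s in `[0%R, (t - tau)%R]) (t%:E * (G (s + tau))%:E))%E).
  rewrite [leLHS]integral_mkcond [leRHS]integral_mkcond.
  apply: ge0_le_lower_integral => s _; rewrite !patchE !mem_setE !in_itv/= andbT.
    case: ifPn => // s0; rewrite lee_fin !mulr_ge0//.
    by rewrite /heav; case: ifP.
  have [s0|//] := leP 0 s; rewrite /heav /=.
  have [st|st] := leP s (t - tau).
    rewrite ifT ?mul1r; last lra.
    by rewrite -EFinM lee_fin (addrC tau) ler_wpM2r//; lra.
  by rewrite ifF ?mul0r ?mulr0//; apply/negbTE; rewrite -ltNge; lra.
rewrite ge0_integralZl//; [|exact: measurable_funS mGs|by move=> s _; rewrite lee_fin].
rewrite (ge0_integral_shift tau _ mG')//; last by rewrite subr_ge0.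
rewrite add0r subrK EFinM lee_wpmul2l ?lee_fin// -gn1E//.
apply: ge0_subset_integral => //.
- exact: measurable_funS mG'.
- by move=> s _; rewrite /= lee_fin.
- by move=> s /=; rewrite !in_itv/= => /andP[ts ->]; rewrite (le_trans tau0).
Qed.

(** The past light cone: [gext g] vanishes for [s > tau], so the weight [s] is at most [tau], and
    the Heaviside factor cuts the reflected integral to [[0, t]]. *)
Lemma gn1_retarded_le (tau t : R) : 0 <= tau -> 0 <= t ->
  (\int[mu]_(s in `[0%R, +oo[) (s * (heav (t - (tau - s)) * G (tau - s)))%:E <=
   (tau * gn g 1 t)%:E)%E.
Proof.
move=> tau0 t0; pose K u := (heav (t - u) * G u)%:E.
have mh : measurable_fun setT (@heav R).
  by apply: measurable_fun_ifT => //; exact: measurable_fun_ler.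
have h0 (u : R) : 0 <= heav u :> R by rewrite /heav; case: ifP.
have mK : measurable_fun setT K.
  apply/measurable_EFinP; apply: measurable_funM => //.
  by apply: (measurableT_comp mh); exact: measurable_funB.
have K0 u : (0 <= K u)%E by rewrite lee_fin mulr_ge0.
have mKs : measurable_fun setT (fun s : R => K (tau - s)).
  by apply: (measurableT_comp mK); exact: measurable_funB.
apply: (@le_trans _ _ (\int[mu]_(s in `[0%R, tau]) (tau%:E * K (tau - s)%R))%E).
  rewrite [leLHS]integral_mkcond [leRHS]integral_mkcond.
  apply: ge0_le_lower_integral => s _; rewrite !patchE !mem_setE !in_itv/= andbT.
    by case: ifPn => // s0; rewrite lee_fin !mulr_ge0.
  have [s0|//] := leP 0 s => /=; have [st|st] := leP s tau.
    by rewrite /K -EFinM lee_fin ler_wpM2r// mulr_ge0.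
  by rewrite gext_neg ?mulr0// subr_lt0.
rewrite ge0_integralZl//; last exact: measurable_funS mKs.
rewrite ge0_integral_reflect// subrr subr0 EFinM lee_wpmul2l ?lee_fin// -gn1E//.
rewrite [leLHS]integral_mkcond [leRHS]integral_mkcond.
apply: ge0_le_lower_integral => s _; rewrite !patchE !mem_setE !in_itv/=.
  by case: ifPn.
have [s0|//] := leP 0 s => /=; rewrite /K /heav subr_ge0.
have [st|st] := leP s t; rewrite ?mul1r ?mul0r; case: ifPn => _ //; rewrite lee_fin//.
Qed.

End iterated_primitives.

(** * Estimates for pairs and spherical integrals *)

Lemma besselJ1_quot_le {R : realType} (m r : R) : 0 <= m -> 0 <= r -> `|besselJ1 (m * r) / r| <= m / 2.
Proof.
move=> m0 r0; have [->|rN0] := eqVneq r 0; first by rewrite invr0 mulr0 normr0 divr_ge0.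
have rp : 0 < r by rewrite lt_def rN0.
rewrite normrM normfV (ger0_norm r0) ler_pdivrMr//.
by apply: le_trans (besselJ1_le _) _; rewrite ger0_norm ?mulr_ge0// mulrAC.
Qed.

Lemma vnorm_vsubC {R : realType} (u v : V3 R) : vnorm (vsub u v) = vnorm (vsub v u).
Proof.
by rewrite /vnorm /vdot /vsub/=; congr Num.sqrt; ring.
Qed.

Lemma pair_scale {R : realType} (a b k X Y : R) : a * `|k * X| + b * `|k * Y| = `|k| * (a * `|X| + b * `|Y|).
Proof.
by rewrite !normrM; ring.
Qed.

Lemma pair_scale_le {R : realType} (a b k X Y B0 B : R) : ((a * `|X| + b * `|Y|)%:E <= B0%:E)%E ->
  `|k| * B0 <= B -> a * `|k * X| + b * `|k * Y| <= B.
Proof.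
by rewrite lee_fin => XY kB; rewrite pair_scale; apply: le_trans kB; exact: ler_wpM2l.
Qed.

Lemma heav_ge0 {R : realType} (t : R) : 0 <= heav t :> R.
Proof.
by rewrite /heav; case: ifP.
Qed.

Lemma measurable_heav {R : realType} : measurable_fun [set: R] (@heav R).
Proof.
by apply: measurable_fun_ifT => //; exact: measurable_fun_ler.
Qed.

(** The integrands only have to be dominated by a function of [vdot w e]; this majorant is
    measurable, and [funk_hecke] integrates it exactly. *)
Lemma int_S2_pair_le {R : realType} (F1 F2 : V3 R -> R) (e : V3 R) (F : R -> R) (a b : R) :
  0 <= a -> 0 <= b -> vdot e e = 1 -> measurable_fun setT F -> (forall s, 0 <= F s) ->
  (forall w, a * `|F1 w| + b * `|F2 w| <= F (vdot w e)) ->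
  ((a * `|int_S2 F1| + b * `|int_S2 F2|)%:E <=
   (2 * pi)%:E * \int[@lebesgue_measure R]_(s in `[(-1)%R, 1%R]) (F s)%:E)%E.
Proof.
move=> a0 b0 e1 mF F0 FF.
have mF' : measurable_fun setT (EFin \o F) by exact/measurable_EFinP.
have F0' s : (0 <= (EFin \o F) s)%E by rewrite lee_fin.
rewrite -(funk_hecke e1 mF' F0') /int_S2.
apply: Rintegral_pair_le => // th th0; apply: Rintegral_pair_le => // ph _.
have st := sin_ge0_pi th0.
rewrite /= -EFinM lee_fin !normrM (ger0_norm st) !mulrA -mulrDl.
by apply: ler_wpM2r => //; exact: FF.
Qed.

(** The choice of [a] and [b] as [|X|] and [|Y|] divided by the modulus attains the modulus. *)
Lemma cmod_le_pair {R : realType} (X Y B : R) : (forall a b, 0 <= a -> 0 <= b -> a ^+ 2 + b ^+ 2 = 1 ->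
  a * `|X| + b * `|Y| <= B) -> cmod (X, Y) <= B.
Proof.
move=> XYB; have c2 : cmod (X, Y) ^+ 2 = `|X| ^+ 2 + `|Y| ^+ 2.
  by rewrite /cmod/= sqr_sqrtr ?addr_ge0 ?sqr_ge0// !real_normK ?num_real.
have [c0|cN0] := eqVneq (cmod (X, Y)) 0.
  have e10 : 1 ^+ 2 + 0 ^+ 2 = 1 :> R by rewrite expr1n expr0n addr0.
  by rewrite c0; apply: le_trans (XYB 1 0 ler01 (lexx _) e10); rewrite mul1r mul0r addr0.
have cp : 0 < cmod (X, Y) by rewrite lt_def cN0 cmod_ge0.
have := XYB (`|X| / cmod (X, Y)) (`|Y| / cmod (X, Y)).
rewrite !divr_ge0 ?cmod_ge0// => /(_ isT isT) H.
have E : (`|X| / cmod (X, Y)) ^+ 2 + (`|Y| / cmod (X, Y)) ^+ 2 = 1.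
  by rewrite !exprMn -mulrDl -c2 exprVn divff// expf_neq0.
apply: le_trans (H E); rewrite !(mulrAC _ (cmod (X, Y))^-1) -mulrDl -!expr2 -c2 expr2.
by rewrite mulfK.
Qed.

(** Cauchy-Schwarz, through Lagrange's identity. *)
Lemma pair_le_cmod {R : realType} (a b X Y : R) : 0 <= a -> 0 <= b -> a ^+ 2 + b ^+ 2 = 1 ->
  a * `|X| + b * `|Y| <= cmod (X, Y).
Proof.
move=> a0 b0 ab; have c2 : cmod (X, Y) ^+ 2 = `|X| ^+ 2 + `|Y| ^+ 2.
  by rewrite /cmod/= sqr_sqrtr ?addr_ge0 ?sqr_ge0// !real_normK ?num_real.
rewrite -(@ler_pXn2r _ 2)// ?nnegrE ?cmod_ge0 ?addr_ge0 ?mulr_ge0// c2 -subr_ge0.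
rewrite (_ : _ - _ = (a * `|Y| - b * `|X|) ^+ 2) ?sqr_ge0//.
transitivity ((a ^+ 2 + b ^+ 2) * (`|X| ^+ 2 + `|Y| ^+ 2) - (a * `|X| + b * `|Y|) ^+ 2).
  by rewrite ab mul1r.
by ring.
Qed.

(** * The massless operator [A_0] *)

(** With [D = b0 + bn * s], clearing denominators in the threshold gives [b2 < 2 * x0 * D] for
    positive [b2] and the reverse for negative [b2]. So [D] has the sign of [b2], and the retarded
    radius lies between 0 and [x0]: [psi] is evaluated at a positive first time. *)
Lemma retarded_time {R : realType} (b0 bn x0 s : R) : 0 < x0 -> 0 < bn -> let b2 := b0 ^+ 2 - bn ^+ 2 in
  ((0 < b2) && (b2 / (2 * x0 * bn) - b0 / bn < s)) ||
  ((b2 < 0) && (s < b2 / (2 * x0 * bn) - b0 / bn)) ->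
  0 < b2 / (2 * (b0 + bn * s)) < x0.
Proof.
move=> x00 bn0 b2.
have E : b2 / (2 * x0 * bn) - b0 / bn = (b2 / (2 * x0) - b0) / bn.
  by field; rewrite !gt_eqF.
rewrite E ltr_pdivrMr// ltr_pdivlMr//; move: b2 {E} => b2.
set D := b0 + bn * s; have DE : s * bn = D - b0 by rewrite /D; ring.
rewrite DE; move: D {DE} => D /orP[/andP[b20]|/andP[b20]].
- rewrite ltrD2r => bD; rewrite ltr_pdivrMr ?mulr_gt0// in bD.
  have D0 : 0 < D.
    rewrite ltNge; apply/negP => D0; move: (lt_trans b20 bD).
    by rewrite pmulr_lgt0 ?mulr_gt0// ltNge D0.
  rewrite divr_gt0 ?mulr_gt0//= ltr_pdivrMr ?mulr_gt0//.
  by apply: lt_le_trans bD _; rewrite le_eqVlt; apply/orP; left; apply/eqP; ring.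
- rewrite ltrD2r => bD; rewrite ltr_pdivlMr ?mulr_gt0// in bD.
  have D0 : D < 0.
    rewrite ltNge; apply/negP => D0; move: (lt_trans bD b20).
    by rewrite ltNge mulr_ge0// mulr_ge0// ltW.
  have -> : b2 / (2 * D) = (- b2) / (2 * (- D)) by field; rewrite lt_eqF.
  rewrite divr_gt0 ?mulr_gt0 ?oppr_gt0//= ltr_pdivrMr ?mulr_gt0 ?oppr_gt0//.
  have -> : x0 * (2 * - D) = - (D * (2 * x0)) by ring.
  by rewrite ltrN2.
Qed.

Lemma is_derive_retarded_time {R : realType} (b0 bn b2 s : R) : b0 + bn * s != 0 ->
  is_derive s 1 (fun s => b2 / (2 * (b0 + bn * s))) (- (b2 * bn / (2 * (b0 + bn * s) ^+ 2))).
Proof.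
move=> D0.
have d1 : is_derive s 1 (fun s : R => 2 * (b0 + bn * s)) (2 * bn).
  by apply: is_derive_eq; rewrite /GRing.scale/=; ring.
have D20 : 2 * (b0 + bn * s) != 0 by rewrite mulf_neq0// pnatr_eq0.
have d2 := @is_deriveV _ (fun s : R => 2 * (b0 + bn * s)) s _ _ D20 d1.
have -> : (fun s => b2 / (2 * (b0 + bn * s))) = b2 *: (fun s : R => (2 * (b0 + bn * s))^-1).
  by apply/funext => u.
by apply: is_derive_eq; rewrite /GRing.scale/=; field.
Qed.

Lemma continuous_retarded_density {R : realType} (b0 bn c lo hi : R) :
  (forall s, s \in `[lo, hi] -> b0 + bn * s != 0) ->
  {within `[lo, hi], continuous (fun s : R => c / (2 * (b0 + bn * s) ^+ 2))}.
Proof.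
move=> D0; apply: derivable_within_continuous => s /D0 Ds.
have d1 : is_derive s 1 (fun s : R => 2 * (b0 + bn * s) ^+ 2) (4 * bn * (b0 + bn * s)).
  by apply: is_derive_eq; rewrite /GRing.scale/=; ring.
have D20 : 2 * (b0 + bn * s) ^+ 2 != 0 by rewrite mulf_neq0 ?pnatr_eq0// expf_neq0.
have d2 := @is_deriveV _ (fun s : R => 2 * (b0 + bn * s) ^+ 2) s _ _ D20 d1.
have -> : (fun s => c / (2 * (b0 + bn * s) ^+ 2)) = c *: (fun s : R => (2 * (b0 + bn * s) ^+ 2)^-1).
  by apply/funext => u.
by apply: ex_derive.
Qed.

(** The density is [f s / (2 * bn)], where [f] is the absolute derivative of the retarded radius
    [rs]. On the admissible range [b0 + bn * s] does not vanish, so [rs] is monotone there,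
    increasing for [b2 < 0] and decreasing for [b2 > 0]. What remains is [gext g (x0 - r)]
    integrated over part of [r >= 0]. *)
Lemma retarded_density_le {R : realType} (g : R -> R) (g_gt0 : forall t, 0 <= t -> 0 < g t)
    (g_nd : forall s t, 0 <= s -> s <= t -> g s <= g t) (b0 bn x0 : R) (P : R -> bool) :
  0 < x0 -> 0 < bn -> let b2 := b0 ^+ 2 - bn ^+ 2 in
  (forall s, P s -> ((0 < b2) && (0 < b0) && (b2 / (2 * x0 * bn) - b0 / bn < s)) ||
                    ((b2 < 0) && (s < b2 / (2 * x0 * bn) - b0 / bn))) ->
  (\int[@lebesgue_measure R]_(s in `[(-1)%R, 1%R])
     (if P s then `|b2| / (4 * (b0 + bn * s) ^+ 2) * gext g (x0 - b2 / (2 * (b0 + bn * s)))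
      else 0)%:E <= (gn g 1 x0 / (2 * bn))%:E)%E.
Proof.
move=> x00 bn0 b2 Pc; set G := gext g.
have G0 t : 0 <= G t by exact: gext_ge0.
have mG : measurable_fun setT G by exact: measurable_gext.
pose H r : \bar R := (heav r * G (x0 - r))%:E.
have H0 r : (0 <= H r)%E by rewrite lee_fin mulr_ge0// heav_ge0.
have mH : measurable_fun setT H.
  apply/measurable_EFinP; apply: measurable_funM; first exact: measurable_heav.
  by apply: (measurableT_comp mG); exact: measurable_funB.
have HT lo hi : (\int[@lebesgue_measure R]_(r in `[lo, hi]) H r <= (gn g 1 x0)%:E)%E.
  rewrite -(@gn_convolution R g g_gt0 g_nd 0)//; last exact: ltW.
  rewrite [leLHS]integral_mkcond [leRHS]integral_mkcond.
  apply: ge0_le_lower_integral => r _; rewrite !patchE; first by case: ifPn.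
  rewrite !mem_setE !in_itv/= andbT /H /heav expr0 fact0 divr1 mul1r.
  by case: ifPn => _; case: ifPn => _; rewrite ?mul1r ?mul0r ?lee_fin.
pose rs s := b2 / (2 * (b0 + bn * s)).
pose f s := `|b2| * bn / (2 * (b0 + bn * s) ^+ 2).
have f0 s : 0 <= f s.
  by apply: divr_ge0; apply: mulr_ge0 => //; [exact: ltW|exact: sqr_ge0].
have g10 : 0 <= gn g 1 x0 by apply: gn_ge0 => //; exact: ltW.
have k0 : 0 <= (2 * bn)^-1 by rewrite invr_ge0 mulr_ge0// ltW.
(* It remains to exhibit an interval that contains every admissible [s] and on which the
   substitution is licit; the empty interval [[1, 0]] serves when no [s] is admissible. *)
have scaled lo hi : (\int[@lebesgue_measure R]_(s in `[lo, hi]) ((f s)%:E * H (rs s)) <= (gn g 1 x0)%:E)%E ->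
    (forall s, s \in `[-1, 1] -> P s -> s \in `[lo, hi]) ->
    (\int[@lebesgue_measure R]_(s in `[(-1)%R, 1%R])
     (if P s then `|b2| / (4 * (b0 + bn * s) ^+ 2) * G (x0 - b2 / (2 * (b0 + bn * s)))
      else 0)%:E <= (gn g 1 x0 / (2 * bn))%:E)%E.
  move=> Hle PI; rewrite mulrC EFinM.
  have mD : measurable_fun setT (fun s : R => b0 + bn * s).
    by apply: measurable_funD => //; exact: measurable_funM.
  have mfH : measurable_fun `[lo, hi] (fun s => ((f s)%:E * H (rs s))%E).
    apply: (@measurable_funS _ _ _ _ setT) => //; apply: emeasurable_funM.
      apply/measurable_EFinP; apply: measurable_funM => //.
      apply: (measurableT_comp measurable_invr); apply: measurable_funM => //.
      exact: measurable_funX.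
    apply: (measurableT_comp mH); apply: measurable_funM => //.
    by apply: (measurableT_comp measurable_invr); exact: measurable_funM.
  apply: (@le_trans _ _ ((2 * bn)^-1%:E *
      \int[@lebesgue_measure R]_(s in `[lo, hi]) ((f s)%:E * H (rs s)))%E); last first.
    by rewrite lee_wpmul2l// lee_fin.
  rewrite -ge0_integralZl//; last by move=> s _; rewrite mule_ge0// lee_fin.
  rewrite [leLHS]integral_mkcond [leRHS]integral_mkcond.
  apply: ge0_le_lower_integral => s _; rewrite !patchE.
    case: ifPn => // _; case: ifPn => // _; rewrite lee_fin mulr_ge0//.
    by apply: divr_ge0 => //; apply: mulr_ge0 => //; exact: sqr_ge0.
  have pos : (0 <= (2 * bn)^-1%:E * ((f s)%:E * H (rs s)))%E.
    by rewrite !mule_ge0// lee_fin.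
  case: ifPn => s1; last by case: ifPn.
  case: ifPn => Ps; last by case: ifPn.
  have sI : s \in `[lo, hi]%classic.
    by rewrite mem_setE; apply: PI => //; move: s1; rewrite mem_setE.
  have /andP[rs0 _] : 0 < rs s < x0.
    apply: retarded_time => //; have /orP[/andP[/andP[-> _] ->//]|->] := Pc _ Ps.
    by rewrite orbT.
  rewrite sI /H /heav (ltW rs0) mul1r -!EFinM lee_fin /f -/(rs s).
  rewrite le_eqVlt; apply/orP; left; apply/eqP; rewrite mulrA; congr (_ * _).
  have bnN : bn != 0 by rewrite gt_eqF.
  have [D0|D0] := eqVneq (b0 + bn * s) 0; first by rewrite D0 expr0n/= !mulr0 invr0 !mulr0.
  by field; rewrite ?D0 ?bnN.
have [b2n|b2p|b2z] := ltgtP b2 0.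
- pose thr := b2 / (2 * x0 * bn) - b0 / bn.
  have Dthr s : s <= thr -> b0 + bn * s < 0.
    rewrite /thr (_ : _ - _ = (b2 / (2 * x0) - b0) / bn); last by field; rewrite !gt_eqF.
    rewrite ler_pdivlMr// => h.
    have : b2 / (2 * x0) < 0 by rewrite pmulr_llt0// invr_gt0 mulr_gt0.
    by move=> h2; rewrite mulrC; apply: le_lt_trans h2; rewrite -lerBrDl.
  have [t1|t1] := leP thr (-1).
    apply: (@scaled 1 0); first by rewrite set_itv_ge ?integral_set0 ?lee_fin// bnd_simp -ltNge.
    move=> s; rewrite in_itv/= => /andP[s1 _] /Pc; rewrite ltNge (ltW b2n)/= => /andP[_].
    by rewrite -/thr ltNge (le_trans t1 s1).
  pose hi := Num.min thr 1.
  have lohi : -1 < hi by rewrite lt_min t1/=; lra.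
  have Dne s : s \in `[-1, hi] -> b0 + bn * s < 0.
    by rewrite in_itv/= => /andP[_ sh]; apply: Dthr; apply: le_trans sh _; rewrite ge_min lexx.
  have df s : s \in `[-1, hi] -> is_derive s 1 rs (f s).
    move=> /Dne Ds; have Ds0 : b0 + bn * s != 0 by rewrite lt_eqF.
    have := is_derive_retarded_time b2 Ds0.
    by rewrite /f ltr0_norm// !mulNr.
  have cf : {within `[-1, hi], continuous f}.
    by apply: continuous_retarded_density => s /Dne Ds; rewrite lt_eqF.
  apply: (@scaled (-1) hi).
    rewrite (ge0_integral_subst_incr lohi df cf)//.
    move=> s /subset_itv_oo_cc /Dne Ds; apply: divr_gt0; apply: mulr_gt0 => //.
      by rewrite normr_gt0 lt_eqF.
    by rewrite exprn_even_gt0//= lt_eqF.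
  move=> s; rewrite !in_itv/= => /andP[-> s1] /Pc; rewrite ltNge (ltW b2n)/= => /andP[_].
  by rewrite -/thr le_min s1 andbT => /ltW.
- have [b00|b00] := ltP 0 b0; last first.
    apply: (@scaled 1 0); first by rewrite set_itv_ge ?integral_set0 ?lee_fin// bnd_simp -ltNge.
    by move=> s _ /Pc; rewrite (ltNge 0 b0) b00 andbF/= ltNge (ltW b2p).
  (* For [b2 > 0] and [b0 > 0] the vector is timelike and future directed, so [b0 + bn * s > 0] on
     all of [[-1, 1]]. *)
  have bb : bn < b0.
    by rewrite -(@ltr_pXn2r _ 2)// ?nnegrE ?(ltW bn0) ?(ltW b00)// -subr_gt0.
  have N11 : -1 < 1 :> R by lra.
  have Dne s : s \in `[-1, 1] -> 0 < b0 + bn * s.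
    rewrite in_itv/= => /andP[s1 _]; have : bn * (-1) <= bn * s by rewrite ler_pM2l.
    rewrite mulrN1 => h; apply: lt_le_trans (lerD (lexx b0) h).
    by rewrite subr_gt0.
  have df (s : R) : s \in `[-1, 1] -> is_derive s 1 rs (- f s).
    move=> /Dne Ds; have Ds0 : b0 + bn * s != 0 by rewrite gt_eqF.
    have := is_derive_retarded_time b2 Ds0.
    by rewrite /f gtr0_norm.
  have cf : {within `[-1, 1], continuous f}.
    by apply: continuous_retarded_density => s /Dne Ds; rewrite gt_eqF.
  apply: (@scaled (-1) 1) => //.
  rewrite (ge0_integral_subst_decr N11 df cf)//.
  move=> s /subset_itv_oo_cc /Dne Ds; apply: divr_gt0; apply: mulr_gt0 => //.
    by rewrite normr_gt0 gt_eqF.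
  by rewrite exprn_gt0.
- apply: (@scaled 1 0); first by rewrite set_itv_ge ?integral_set0 ?lee_fin// bnd_simp -ltNge.
  by move=> s _ /Pc; rewrite b2z ltxx.
Qed.

Lemma ind_bool {R : realType} (b : bool) : ind b = b%:R :> R.
Proof.
by rewrite /ind asboolb; case: b.
Qed.

Lemma ind_cases {R : realType} (b2 c0 thr s : R) :
  ind (0 < b2) * ind (0 < c0) * ind (thr < s) + ind (b2 < 0) * ind (s < thr) =
  (((0 < b2) && (0 < c0) && (thr < s)) || ((b2 < 0) && (s < thr)))%:R :> R.
Proof.
rewrite !ind_bool; case: (ltgtP b2 0) => _ /=; rewrite ?mul0r ?add0r ?addr0 ?mul1r//.
by rewrite -natrM mulnb orbF.
Qed.

(** This separates two singularities with different centres. If [u <= v], then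
    [1 / (u * v) <= 1 / u ^+ 2]; otherwise it is at most [1 / v ^+ 2], and [h u <= h v] because [h]
    decreases. *)
Lemma inv_prod_le {R : realType} (h : R -> R) (u v : R) : (forall s t, s <= t -> h t <= h s) ->
  (forall s, 0 <= h s) -> 0 <= u -> 0 <= v ->
  h u / (u * v) <= h u / u ^+ 2 + h v / v ^+ 2.
Proof.
move=> hd h0 u0 v0.
have p w : 0 <= h w / w ^+ 2 by rewrite divr_ge0// sqr_ge0.
have [->|uN] := eqVneq u 0; first by rewrite mul0r invr0 mulr0 addr_ge0.
have [->|vN] := eqVneq v 0; first by rewrite mulr0 invr0 mulr0 addr_ge0.
have up : 0 < u by rewrite lt_def uN.
have vp : 0 < v by rewrite lt_def vN.
have [uv|vu] := leP u v.
  apply: le_trans (ler_wpDr (p v) (lexx _)).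
  by rewrite ler_wpM2l// lef_pV2 ?posrE ?mulr_gt0// expr2 ler_pM2l.
apply: le_trans (ler_wpDl (p u) (lexx _)).
apply: ler_pM => //; first by rewrite invr_ge0 mulr_ge0.
  exact/hd/ltW.
by rewrite lef_pV2 ?posrE ?mulr_gt0// expr2 ler_pM2r// ltW.
Qed.

Lemma vnorm_sub0 {R : realType} (z : V3 R) : vnorm z = vnorm (vsub (0, 0, 0) z).
Proof.
by rewrite /vnorm /vdot /vsub/=; congr Num.sqrt; ring.
Qed.

(** The surface factor cancels the singularity, leaving the convolution of [gext g] with 1. *)
Lemma radial_inv2_le {R : realType} (g : R -> R) (g_gt0 : forall t, 0 <= t -> 0 < g t)
    (g_nd : forall s t, 0 <= s -> s <= t -> g s <= g t) (y0 : R) (c : V3 R) : 0 <= y0 ->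
  (\int[mu3 R]_z (gext g (y0 - vnorm (vsub c z)) / vnorm (vsub c z) ^+ 2)%:E <=
   (4 * pi * gn g 1 y0)%:E)%E.
Proof.
move=> y00; have pi0 := pi_gt0 R; have piN := lt0r_neq0 pi0.
have G0 t : 0 <= gext g t by exact: gext_ge0.
have mG : measurable_fun setT (gext g) by exact: measurable_gext.
pose K (r : R) : \bar R := (gext g (y0 - r) / r ^+ 2)%:E.
have mGy : measurable_fun setT (fun r : R => gext g (y0 - r)).
  by apply: (measurableT_comp mG); exact: measurable_funB.
have mK : measurable_fun setT K.
  apply/measurable_EFinP; apply: measurable_funM => //.
  by apply: (measurableT_comp measurable_invr); exact: measurable_funX.
have K0 r : (0 <= K r)%E by rewrite lee_fin divr_ge0// sqr_ge0.
rewrite (ge0_integral_radial c mK K0) EFinM -(gn_convolution g_gt0 g_nd 0 y00).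
rewrite -ge0_integralZl//; last 3 first.
- apply/measurable_EFinP; apply: (@measurable_funS _ _ _ _ setT) => //.
  by apply: measurable_funM => //; apply: measurable_funM => //; exact: measurable_funX.
- by move=> r _; rewrite lee_fin mulr_ge0// divr_ge0 ?expr0.
- by rewrite lee_fin mulr_ge0// ltW.
apply: ge0_le_lower_integral => r _.
  apply: mule_ge0 => //; rewrite lee_fin; apply: mulr_ge0; last exact: sqr_ge0.
  by apply: mulr_ge0 => //; exact: ltW.
rewrite /K -!EFinM lee_fin expr0 fact0 divr1 mul1r -[leLHS]mulrA.
apply: ler_wpM2l; first by rewrite mulr_ge0// ltW.
have [->|rN] := eqVneq r 0; first by rewrite expr0n mul0r.
by rewrite mulrC divfK// expf_neq0.
Qed.

(** Here one power of [r] survives the cancellation, which raises the index of the primitive to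
    2. *)
Lemma radial_inv1_le {R : realType} (g : R -> R) (g_gt0 : forall t, 0 <= t -> 0 < g t)
    (g_nd : forall s t, 0 <= s -> s <= t -> g s <= g t) (y0 : R) (c : V3 R) : 0 <= y0 ->
  (\int[mu3 R]_z (gext g (y0 - vnorm (vsub c z)) / vnorm (vsub c z))%:E <=
   (4 * pi * gn g 2 y0)%:E)%E.
Proof.
move=> y00; have pi0 := pi_gt0 R; have piN := lt0r_neq0 pi0.
have G0 t : 0 <= gext g t by exact: gext_ge0.
have mG : measurable_fun setT (gext g) by exact: measurable_gext.
(* The factor [heav r] makes the profile nonnegative at negative [r] too; distances do not see
   it. *)
pose K (r : R) : \bar R := (heav r * (gext g (y0 - r) / r))%:E.
have mGy : measurable_fun setT (fun r : R => gext g (y0 - r)).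
  by apply: (measurableT_comp mG); exact: measurable_funB.
have mK : measurable_fun setT K.
  apply/measurable_EFinP; apply: measurable_funM; first exact: measurable_heav.
  by apply: measurable_funM => //; exact: measurable_invr.
have K0 r : (0 <= K r)%E.
  rewrite lee_fin /heav; case: ifPn => r0; last by rewrite mul0r.
  by rewrite mul1r divr_ge0.
have -> : (\int[mu3 R]_z (gext g (y0 - vnorm (vsub c z)) / vnorm (vsub c z))%:E =
    \int[mu3 R]_z K (vnorm (vsub c z)))%E.
  by apply: eq_integral => z _; rewrite /K /heav vnorm_ge0 mul1r.
rewrite (ge0_integral_radial c mK K0) EFinM -(gn_convolution g_gt0 g_nd 1 y00).
rewrite -ge0_integralZl//; last 3 first.
- apply/measurable_EFinP; apply: (@measurable_funS _ _ _ _ setT) => //.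
  by apply: measurable_funM => //; apply: measurable_funM => //; exact: measurable_funX.
- move=> r /=; rewrite in_itv/= andbT => r0.
  by rewrite lee_fin mulr_ge0// mulr_ge0// expr1.
- by rewrite lee_fin mulr_ge0// ltW.
apply: ge0_le_lower_integral => r /=; rewrite in_itv/= andbT => r0.
  by rewrite mule_ge0// lee_fin !mulr_ge0// ?sqr_ge0// ltW.
rewrite /K /heav r0 mul1r -!EFinM lee_fin expr1 factS fact0 muln1 divr1 -[leLHS]mulrA.
apply: ler_wpM2l; first by rewrite mulr_ge0// ltW.
have [->|rN] := eqVneq r 0; first by rewrite expr0n mul0r mulr_ge0.
by rewrite le_eqVlt; apply/orP; left; apply/eqP; field.
Qed.

Lemma A0r_pair_le {R : realType} (g : R -> R) (g_gt0 : forall t, 0 <= t -> 0 < g t)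
    (g_nd : forall s t, 0 <= s -> s <= t -> g s <= g t) (lam a b N : R)
    (u v : Defs.point R -> Defs.point R -> R) : 0 <= lam -> 0 <= a -> 0 <= b -> 0 <= N ->
  (forall x y, 0 <= x.1 -> 0 <= y.1 ->
     a * `|u x y| + b * `|v x y| <= N * (gext g x.1 * gext g y.1)) ->
  forall x y, 0 < x.1 -> 0 < y.1 ->
  a * `|A0r lam u x y| + b * `|A0r lam v x y| <=
  N * (lam / (8 * pi) * (gn g 1 x.1 * gn g 1 y.1)).
Proof.
move=> lam0 a0 b0 N0 uv x y x0 y0; have pi0 := pi_gt0 R; have piN := lt0r_neq0 pi0; set G := gext g.
have G0 t : 0 <= G t by exact: gext_ge0.
have mG : measurable_fun setT G by exact: measurable_gext.
have gx : 0 <= gn g 1 x.1 by apply: gn_ge0 => //; exact: ltW.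
have gy : 0 <= gn g 1 y.1 by apply: gn_ge0 => //; exact: ltW.
rewrite /A0r; apply: (@pair_scale_le R a b _ _ _ (N * (8 * pi ^+ 2) * (gn g 1 x.1 * gn g 1 y.1))); last first.
  have lp : 0 <= lam / (4 * pi) ^+ 3.
    by rewrite divr_ge0// exprn_ge0// mulr_ge0// ltW.
  rewrite ger0_norm// le_eqVlt; apply/orP; left; apply/eqP.
  by move: piN; generalize (pi : R) => p pN; field.
pose k := pi * N * gn g 1 x.1; have k0 : 0 <= k by rewrite !mulr_ge0// ltW.
pose cx := vsub x.2 y.2; pose o : V3 R := (0, 0, 0).
pose h r := G (y.1 - r).
have h0 r : 0 <= h r by exact: G0.
have hd s t : s <= t -> h t <= h s by move=> st; apply: gext_nd => //; rewrite lerD2l lerN2.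
have mh : measurable_fun setT h by apply: (measurableT_comp mG); exact: measurable_funB.
pose Q (c z : V3 R) := h (vnorm (vsub c z)) / vnorm (vsub c z) ^+ 2.
have Q0 c z : 0 <= Q c z by rewrite divr_ge0// sqr_ge0.
have mQ c : measurable_fun [set: (mV3 R)] (fun z : (mV3 R) => (Q c z)%:E).
  have mhr : measurable_fun setT (fun r : R => h r / r ^+ 2).
    apply: measurable_funM => //.
    by apply: (measurableT_comp measurable_invr); exact: measurable_funX.
  by apply/measurable_EFinP; exact: (measurableT_comp mhr (measurable_dist c)).
apply: (@le_trans _ _ (\int[mu3 R]_z (k%:E * ((Q o z)%:E + (Q cx z)%:E)))%E); last first.
  rewrite ge0_integralZl//; last 2 first.
  - exact: emeasurable_funD.
  - by move=> z _; rewrite adde_ge0// lee_fin.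
  rewrite ge0_integralD//; do ?[by move=> z _; rewrite lee_fin].
  apply: (@le_trans _ _ (k%:E * ((4 * pi * gn g 1 y.1)%:E + (4 * pi * gn g 1 y.1)%:E))%E).
    by rewrite lee_wpmul2l ?lee_fin// leeD//; apply: radial_inv2_le => //; exact: ltW.
  rewrite -EFinD -EFinM lee_fin /k le_eqVlt; apply/orP; left; apply/eqP; ring.
rewrite /int3; apply: Rintegral_pair_le => // z _.
rewrite -EFinD -EFinM.
have R0 : 0 <= k * (Q o z + Q cx z) by rewrite mulr_ge0// addr_ge0.
rewrite /ind; case: asboolP => [zy|_]; last by rewrite !mul0r normr0 !mulr0 addr0 lee_fin.
rewrite -/(ind _) !mul1r.
set c0 := x.1 - y.1 + vnorm z; rewrite -/cx; set bv := vsub cx z; set bn := vnorm bv.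
set b2 := c0 ^+ 2 - bn ^+ 2.
have bn0 : 0 <= bn := vnorm_ge0 _.
have z0 : 0 <= vnorm z := vnorm_ge0 _.
(* At [bn = 0] division by zero sets both the cosine and the threshold to 0, while [b2] is a square;
   hence both indicators vanish. *)
have [bnz|bnN] := eqVneq bn 0.
  have e1 : vdot (0, 0, 1) (0, 0, 1) = 1 :> R by rewrite /vdot/= !mul0r !add0r mul1r.
  apply: le_trans (@int_S2_pair_le R _ _ (0, 0, 1) (fun=> 0) a b a0 b0 e1 _ _ _) _ => //.
    move=> w; rewrite ind_cases bnz mulr0 invr0 !mulr0 subrr ltxx andbF/=.
    have -> : (b2 < 0) = false.
      by apply/negbTE; rewrite -leNgt /b2 bnz expr0n/= subr0 sqr_ge0.
    by rewrite /= !mulr0 normr0 !mulr0 addr0.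
  by rewrite integral0 mule0 lee_fin.
have bnp : 0 < bn by rewrite lt_def bnN.
pose e := vscale bn^-1 bv.
have we w : vdot w bv / bn = vdot w e by rewrite /e /vdot /vscale/=; ring.
have e1 : vdot e e = 1.
  have bb : vdot bv bv = bn ^+ 2 by rewrite vnorm_sqr /vdot !expr2.
  rewrite -(we e) (_ : vdot e bv = vdot bv bv / bn); last by rewrite /e /vdot /vscale/=; ring.
  by rewrite bb expr2 mulfK// mulfV.
pose thr := b2 / (2 * x.1 * bn) - c0 / bn.
pose P s := ((0 < b2) && (0 < c0) && (thr < s)) || ((b2 < 0) && (s < thr)).
pose phi s := if P s then `|b2| / (4 * (c0 + bn * s) ^+ 2) * G (x.1 - b2 / (2 * (c0 + bn * s)))
              else 0.
pose K := N * h (vnorm z) / vnorm z.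
have K0 : 0 <= K by rewrite divr_ge0// mulr_ge0.
have phi0 s : 0 <= phi s.
  by rewrite /phi; case: ifP => // _; rewrite mulr_ge0// divr_ge0// mulr_ge0// sqr_ge0.
have mD : measurable_fun setT (fun s : R => c0 + bn * s).
  by apply: measurable_funD => //; exact: measurable_funM.
have mphi : measurable_fun setT phi.
  apply: measurable_fun_ifT => //.
    apply: measurable_or; (apply: measurable_and => //); exact: measurable_fun_ltr.
  apply: measurable_funM.
    apply: measurable_funM => //; apply: (measurableT_comp measurable_invr).
    by apply: measurable_funM => //; exact: measurable_funX.
  apply: (measurableT_comp mG); apply: measurable_funB => //.
  apply: measurable_funM => //; apply: (measurableT_comp measurable_invr).
  exact: measurable_funM.
apply: le_trans (@int_S2_pair_le R _ _ e (fun s => K * phi s) a b a0 b0 e1 _ _ _) _.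
- exact: measurable_funM.
- by move=> s; rewrite mulr_ge0.
- move=> w; rewrite ind_cases we -/thr -/(P _) /phi; set s := vdot w e.
  case: ifPn => Ps /=; last by rewrite !mulr0 normr0 !mulr0 addr0.
  rewrite !mulr1 pair_scale.
  have /andP[_ rx] : 0 < b2 / (2 * (c0 + bn * s)) < x.1.
    apply: retarded_time => //; move: Ps => /orP[/andP[/andP[p1 _] p2]|p1].
      by rewrite -/b2 p1 p2.
    by rewrite -/b2 p1 orbT.
  set rs := b2 / _ in rx *.
  have uvb := uv (x.1 - rs, vadd x.2 (vscale rs w)) (y.1 - vnorm z, vadd y.2 z).
  have kp : 0 <= `|b2| / (4 * (c0 + bn * s) ^+ 2 * vnorm z).
    by apply: divr_ge0 => //; apply: mulr_ge0 => //; apply: mulr_ge0 => //; exact: sqr_ge0.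
  rewrite (ger0_norm kp).
  apply: (le_trans (ler_wpM2l kp (uvb _ _))); rewrite /= ?subr_ge0 ?(ltW rx) ?(ltW zy)//.
  by rewrite /K /h -/G invfM le_eqVlt; apply/orP; left; apply/eqP; ring.
have -> : (\int[@lebesgue_measure R]_(s in `[(-1)%R, 1%R]) (K * phi s)%:E =
    K%:E * \int[@lebesgue_measure R]_(s in `[(-1)%R, 1%R]) (phi s)%:E)%E.
  rewrite -ge0_integralZl//; last 2 first.
  - by apply/measurable_EFinP; apply: measurable_funS mphi.
  - by move=> s _; rewrite lee_fin.
have le1 := @retarded_density_le R g g_gt0 g_nd c0 bn x.1 P x0 bnp (fun s => id).
apply: (@le_trans _ _ ((2 * pi)%:E * (K%:E * (gn g 1 x.1 / (2 * bn))%:E))%E).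
  by rewrite lee_wpmul2l ?lee_fin ?mulr_ge0 ?(ltW pi0)// lee_wpmul2l ?lee_fin.
rewrite -!EFinM lee_fin.
(* The factor [2 * pi] of the sphere meets [1 / (2 * bn)], which explains the single [pi] in [k];
   the two singularities in [vnorm z] and [bn] are then separated. *)
have -> : 2 * pi * (K * (gn g 1 x.1 / (2 * bn))) = k * (h (vnorm z) / (vnorm z * bn)).
  have E (p n c w q l : R) : 2 * p * (n * c / w * (q / (2 * l))) = p * n * q * (c / (w * l)).
    by rewrite !invfM; move: w^-1 l^-1 => w1 l1; field.
  exact: E.
rewrite ler_wpM2l// /Q -vnorm_sub0 -/bv -/bn.
exact: inv_prod_le.
Qed.

(** * The operators [A_1] and [A_2] with one mass *)

Lemma measurable_cone_density {R : realType} (g : R -> R) (g_gt0 : forall t, 0 <= t -> 0 < g t)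
    (g_nd : forall s t, 0 <= s -> s <= t -> g s <= g t) (tau t : R) :
  measurable_fun [set: R] (fun r : R =>
    (heav (t - (tau + r)) * gext g (tau + r) + heav (t - (tau - r)) * gext g (tau - r)) / r).
Proof.
have mG : measurable_fun setT (gext g) by exact: measurable_gext.
apply: measurable_funM; last exact: measurable_invr.
have md : measurable_fun setT (fun r : R => tau + r) by exact: measurable_funD.
have mb : measurable_fun setT (fun r : R => tau - r) by exact: measurable_funB.
apply: measurable_funD; apply: measurable_funM.
- by apply: (measurableT_comp measurable_heav); exact: measurable_funB.
- exact: (measurableT_comp mG).
- by apply: (measurableT_comp measurable_heav); exact: measurable_funB.
- exact: (measurableT_comp mG).
Qed.

Lemma cone_integral_le {R : realType} (g : R -> R) (g_gt0 : forall t, 0 <= t -> 0 < g t)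
    (g_nd : forall s t, 0 <= s -> s <= t -> g s <= g t) (tau t : R) (c : V3 R) : 0 <= tau -> 0 <= t ->
  (\int[mu3 R]_z ((heav (t - (tau + vnorm (vsub c z))) * gext g (tau + vnorm (vsub c z)) +
     heav (t - (tau - vnorm (vsub c z))) * gext g (tau - vnorm (vsub c z))) /
     vnorm (vsub c z))%:E <= (4 * pi * ((t + tau) * gn g 1 t))%:E)%E.
Proof.
move=> tau0 t0; have pi0 := pi_gt0 R; have piN := lt0r_neq0 pi0; set G := gext g.
have G0 s : 0 <= G s by exact: gext_ge0.
have mG : measurable_fun setT G by exact: measurable_gext.
pose A r := heav (t - (tau + r)) * G (tau + r); pose B r := heav (t - (tau - r)) * G (tau - r).
have A0 r : 0 <= A r by rewrite mulr_ge0// heav_ge0.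
have B0 r : 0 <= B r by rewrite mulr_ge0// heav_ge0.
have mA : measurable_fun setT A.
  have md : measurable_fun setT (fun r : R => tau + r) by exact: measurable_funD.
  apply: measurable_funM; last exact: (measurableT_comp mG).
  by apply: (measurableT_comp measurable_heav); exact: measurable_funB.
have mB : measurable_fun setT B.
  have md : measurable_fun setT (fun r : R => tau - r) by exact: measurable_funB.
  apply: measurable_funM; last exact: (measurableT_comp mG).
  by apply: (measurableT_comp measurable_heav); exact: measurable_funB.
pose K (r : R) : \bar R := (heav r * ((A r + B r) / r))%:E.
have mK : measurable_fun setT K.
  apply/measurable_EFinP; apply: measurable_funM; first exact: measurable_heav.
  by apply: measurable_funM; [exact: measurable_funD|exact: measurable_invr].
have K0 r : (0 <= K r)%E.
  rewrite lee_fin /heav; case: ifPn => r0; last by rewrite mul0r.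
  by rewrite mul1r divr_ge0// addr_ge0.
rewrite [leLHS](_ : _ = \int[mu3 R]_z K (vnorm (vsub c z)))%E; last first.
  by apply: eq_integral => z _; rewrite /K /heav vnorm_ge0 mul1r.
rewrite (ge0_integral_radial c mK K0).
apply: (@le_trans _ _ (\int[@lebesgue_measure R]_(r in `[0%R, +oo[)
    ((4 * pi)%:E * ((r * A r)%:E + (r * B r)%:E)))%E).
  apply: ge0_le_lower_integral => r /=; rewrite in_itv/= andbT => r0.
    by rewrite mule_ge0// lee_fin !mulr_ge0// ?sqr_ge0// ltW.
  rewrite /K /heav r0 mul1r -EFinD -!EFinM lee_fin -[leLHS]mulrA.
  apply: ler_wpM2l; first by rewrite mulr_ge0// ltW.
  have [->|rN] := eqVneq r 0; first by rewrite expr0n/= !mul0r addr0.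
  by rewrite le_eqVlt; apply/orP; left; apply/eqP; field.
have mrA : measurable_fun (`[0%R, +oo[%classic : set (measurableTypeR R)) (fun r : R => (r * A r)%:E).
  by apply/measurable_EFinP; apply: (@measurable_funS _ _ _ _ setT) => //; exact: measurable_funM.
have mrB : measurable_fun (`[0%R, +oo[%classic : set (measurableTypeR R)) (fun r : R => (r * B r)%:E).
  by apply/measurable_EFinP; apply: (@measurable_funS _ _ _ _ setT) => //; exact: measurable_funM.
have rA0 (r : R) : `[0%R, +oo[%classic r -> (0 <= (r * A r)%:E)%E.
  by rewrite /= in_itv/= andbT => r0; rewrite lee_fin mulr_ge0.
have rB0 (r : R) : `[0%R, +oo[%classic r -> (0 <= (r * B r)%:E)%E.
  by rewrite /= in_itv/= andbT => r0; rewrite lee_fin mulr_ge0.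
rewrite ge0_integralZl//; last 3 first.
- exact: emeasurable_funD.
- by move=> r r0; rewrite adde_ge0 ?rA0 ?rB0.
- by rewrite lee_fin mulr_ge0// ltW.
rewrite ge0_integralD// [leRHS]EFinM lee_wpmul2l ?lee_fin ?mulr_ge0 ?(ltW pi0)//.
rewrite mulrDl EFinD; apply: leeD; first exact: gn1_advanced_le.
exact: gn1_retarded_le.
Qed.

(** The vertex [p] has time [tau = y0 - |c - p|]. The integral over [z] is radial around [p] and
    produces [(x0 + tau) g_1(x0)]. Bounding [tau] by [y0] frees the outer integral, which is radial
    around [c] with singularity [1 / r] and gives [g_2(y0)]. *)
Lemma two_cone_integral_le {R : realType} (g : R -> R) (g_gt0 : forall t, 0 <= t -> 0 < g t)
    (g_nd : forall s t, 0 <= s -> s <= t -> g s <= g t) (x0 y0 k : R) (c : V3 R) :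
  0 <= x0 -> 0 <= y0 -> 0 <= k ->
  (\int[mu3 R]_p \int[mu3 R]_z (k * (gext g (y0 - vnorm (vsub c p)) / (vnorm (vsub c p) * vnorm (vsub p z)) *
     (heav (x0 - (y0 - vnorm (vsub c p) + vnorm (vsub p z))) *
        gext g (y0 - vnorm (vsub c p) + vnorm (vsub p z)) +
      heav (x0 - (y0 - vnorm (vsub c p) - vnorm (vsub p z))) *
        gext g (y0 - vnorm (vsub c p) - vnorm (vsub p z)))))%:E <=
   (k * (16 * pi ^+ 2 * (gn g 1 x0 * ((x0 + y0) * gn g 2 y0))))%:E)%E.
Proof.
move=> x00 y00 k0; have pi0 := pi_gt0 R; have piN := lt0r_neq0 pi0; set G := gext g.
have G0 s : 0 <= G s by exact: gext_ge0.
have mG : measurable_fun setT G by exact: measurable_gext.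
have gx : 0 <= gn g 1 x0 by exact: gn_ge0.
pose kk := k * (4 * pi * ((x0 + y0) * gn g 1 x0)).
have kk0 : 0 <= kk.
  by apply: mulr_ge0 => //; apply: mulr_ge0; apply: mulr_ge0 => //; [exact: ltW|exact: addr_ge0].
have mGy : measurable_fun setT (fun r : R => G (y0 - r) / r).
  apply: measurable_funM; last exact: measurable_invr.
  by apply: (measurableT_comp mG); exact: measurable_funB.
have mGd : measurable_fun [set: (mV3 R)]
    (fun p : (mV3 R) => (G (y0 - vnorm (vsub c p)) / vnorm (vsub c p))%:E).
  apply/measurable_EFinP.
  exact: (measurableT_comp mGy (measurable_dist c)).
apply: (@le_trans _ _ (\int[mu3 R]_p (kk%:E *
    (G (y0 - vnorm (vsub c p)) / vnorm (vsub c p))%:E))%E); last first.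
  rewrite ge0_integralZl//; last by move=> p _; rewrite lee_fin divr_ge0// vnorm_ge0.
  apply: le_trans (lee_wpmul2l _ (radial_inv1_le g_gt0 g_nd c y00)) _; first by rewrite lee_fin.
  rewrite -EFinM lee_fin /kk le_eqVlt; apply/orP; left; apply/eqP; ring.
apply: ge0_le_lower_integral => p _.
  apply: integral_ge0 => z _; rewrite lee_fin mulr_ge0// mulr_ge0//.
    by rewrite divr_ge0// mulr_ge0// vnorm_ge0.
  by rewrite addr_ge0// mulr_ge0// heav_ge0.
set d := vnorm (vsub c p); have d0 : 0 <= d := vnorm_ge0 _.
(* A vertex at negative time contributes nothing, since [gext g] vanishes there. *)
have [tau0|tau0] := ltP (y0 - d) 0.
  rewrite integral0_eq; last by move=> z _; rewrite /G gext_neg// mul0r mul0r mulr0.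
  by rewrite /G gext_neg// mul0r mule0.
pose kp := k * (G (y0 - d) / d).
have kp0 : 0 <= kp by rewrite mulr_ge0// divr_ge0.
pose Phi r := (heav (x0 - (y0 - d + r)) * G (y0 - d + r) +
               heav (x0 - (y0 - d - r)) * G (y0 - d - r)) / r.
have mPhi : measurable_fun setT Phi by exact: measurable_cone_density.
have mPz : measurable_fun [set: (mV3 R)]
    (fun z : (mV3 R) => (Phi (vnorm (vsub p z)))%:E).
  apply/measurable_EFinP.
  exact: (measurableT_comp mPhi (measurable_dist p)).
rewrite [leLHS](_ : _ = \int[mu3 R]_z (kp%:E * (Phi (vnorm (vsub p z)))%:E))%E; last first.
  by apply: eq_integral => z _; rewrite -EFinM /kp /Phi invfM; congr EFin; ring.
rewrite ge0_integralZl//; last first.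
  move=> z _; rewrite lee_fin divr_ge0 ?vnorm_ge0//.
  by rewrite addr_ge0// mulr_ge0// heav_ge0.
apply: le_trans (lee_wpmul2l _ (cone_integral_le g_gt0 g_nd p tau0 x00)) _; first by rewrite lee_fin.
rewrite -!EFinM lee_fin /kp /kk -!mulrA ler_wpM2l//.
rewrite [leRHS](_ : _ = G (y0 - d) * (d^-1 * (4 * (pi * ((x0 + y0) * gn g 1 x0))))); last by ring.
rewrite ler_wpM2l// ler_wpM2l ?invr_ge0// ler_wpM2l// ler_wpM2l ?(ltW pi0)// ler_wpM2r//.
by rewrite lerD2l lerBlDr lerDl.
Qed.

Lemma ge0_integral_mu3_swap {R : realType} (f : (mV3 R) * (mV3 R) -> \bar R) :
  measurable_fun setT f -> (forall z, 0 <= f z)%E ->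
  (\int[mu3 R]_x \int[mu3 R]_y f (x, y) = \int[mu3 R]_y \int[mu3 R]_x f (x, y))%E.
Proof.
move=> mf f0; pose mu := @lebesgue_measure R.
pose m3 := product_sigma_finite (product_sigma_finite mu mu) mu.
exact: (@fubini_tonelli _ _ _ _ R m3 m3 f mf f0).
Qed.

(** For [t < 0] the first Heaviside factor is 0, so the bound on [U] and [V] is asked only for
    [t >= 0]. The light cone condition is weakened to [t <= x0], and the Bessel quotient [J] costs
    [m / 2]. *)
Lemma cone_term_le {R : realType} (g : R -> R) (g_gt0 : forall t, 0 <= t -> 0 < g t)
    (g_nd : forall s t, 0 <= s -> s <= t -> g s <= g t) (a b m N t s x0 n J U V : R) :
  0 <= a -> 0 <= b -> 0 <= m -> 0 <= N -> 0 <= n -> `|J| <= m / 2 ->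
  (0 <= t -> a * `|U| + b * `|V| <= N * (gext g t * gext g s)) ->
  a * `|heav t * heav (x0 - t - n) * J * U| + b * `|heav t * heav (x0 - t - n) * J * V| <=
  (m / 2 * N * gext g s) * (heav (x0 - t) * gext g t).
Proof.
move=> a0 b0 m0 N0 n0 Jm UV.
have Gt : 0 <= gext g t by exact: gext_ge0.
have Gs : 0 <= gext g s by exact: gext_ge0.
have m20 : 0 <= m / 2 by rewrite divr_ge0.
have R0 : 0 <= (m / 2 * N * gext g s) * (heav (x0 - t) * gext g t).
  by rewrite mulr_ge0 ?mulr_ge0// heav_ge0.
rewrite pair_scale {1}/heav; case: ifPn => t0; last by rewrite !mul0r normr0 mul0r.
rewrite mul1r {1}/heav; case: ifPn => xt; last by rewrite !mul0r normr0 mul0r.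
rewrite mul1r {1}/heav ifT ?mul1r; last by apply: le_trans xt _; rewrite gerBl.
apply: (@le_trans _ _ (m / 2 * (N * (gext g t * gext g s)))).
  by apply: ler_pM => //; [rewrite addr_ge0// mulr_ge0|exact: UV].
by rewrite le_eqVlt; apply/orP; left; apply/eqP; ring.
Qed.

Lemma pair_sum_le {R : realType} (a b q T1 T2 S1 S2 B1 B2 : R) : 0 <= a -> 0 <= b -> 0 <= q ->
  a * `|T1| + b * `|S1| <= B1 -> a * `|T2| + b * `|S2| <= B2 ->
  a * `|q * (T1 + T2)| + b * `|q * (S1 + S2)| <= q * (B1 + B2).
Proof.
move=> a0 b0 q0 h1 h2; rewrite pair_scale ger0_norm// ler_wpM2l//.
apply: le_trans (lerD h1 h2); rewrite addrACA -!mulrDr.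
by apply: lerD; rewrite ler_wpM2l// ler_normD.
Qed.

Lemma measurable_vdist {R : realType} (dd : measure_display) (T : measurableType dd)
    (p q : T -> (mV3 R)) :
  measurable_fun setT p -> measurable_fun setT q ->
  measurable_fun setT (fun t => vnorm (vsub (p t) (q t))).
Proof.
move=> mp mq; apply: (measurableT_comp measurable_sqrtr); rewrite /vdot/=.
have p1 := measurableT_comp measurable_fst mp; have q1 := measurableT_comp measurable_fst mq.
have c1 := measurable_funB (measurableT_comp measurable_fst p1) (measurableT_comp measurable_fst q1).
have c2 := measurable_funB (measurableT_comp measurable_snd p1) (measurableT_comp measurable_snd q1).
have c3 := measurable_funB (measurableT_comp measurable_snd mp) (measurableT_comp measurable_snd mq).
exact: (measurable_funD (measurable_funD (measurable_funM c1 c1) (measurable_funM c2 c2))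
  (measurable_funM c3 c3)).
Qed.

Lemma measurable_two_cone {R : realType} (g : R -> R) (g_gt0 : forall t, 0 <= t -> 0 < g t)
    (g_nd : forall s t, 0 <= s -> s <= t -> g s <= g t) (dd : measure_display) (T : measurableType dd)
    (x0 y0 k : R) (d e : T -> R) : measurable_fun setT d -> measurable_fun setT e ->
  measurable_fun setT (fun t => k * (gext g (y0 - d t) / (d t * e t) *
     (heav (x0 - (y0 - d t + e t)) * gext g (y0 - d t + e t) +
      heav (x0 - (y0 - d t - e t)) * gext g (y0 - d t - e t)))).
Proof.
move=> md me; have mG : measurable_fun setT (gext g) by exact: measurable_gext.
have mt : measurable_fun setT (fun t => y0 - d t) by exact: measurable_funB.
have mtp : measurable_fun setT (fun t => y0 - d t + e t) by exact: measurable_funD.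
have mtm : measurable_fun setT (fun t => y0 - d t - e t) by exact: measurable_funB.
apply: measurable_funM => //; apply: measurable_funM.
  apply: measurable_funM; first exact: (measurableT_comp mG mt).
  by apply: (measurableT_comp measurable_invr); exact: measurable_funM.
apply: measurable_funD; apply: measurable_funM.
- by apply: (measurableT_comp measurable_heav); exact: measurable_funB.
- exact: (measurableT_comp mG mtp).
- by apply: (measurableT_comp measurable_heav); exact: measurable_funB.
- exact: (measurableT_comp mG mtm).
Qed.

(** The outer variable is the vertex at retarded time, so the order of integration is already that
    of the two-cone majorant, with the particles exchanged. *)
Lemma A2r_pair_le {R : realType} (g : R -> R) (g_gt0 : forall t, 0 <= t -> 0 < g t)
    (g_nd : forall s t, 0 <= s -> s <= t -> g s <= g t) (lam m a b N : R)
    (u v : Defs.point R -> Defs.point R -> R) : 0 <= lam -> 0 <= m -> 0 <= a -> 0 <= b -> 0 <= N ->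
  (forall x y, 0 <= x.1 -> 0 <= y.1 ->
     a * `|u x y| + b * `|v x y| <= N * (gext g x.1 * gext g y.1)) ->
  forall x y, 0 < x.1 -> 0 < y.1 ->
  a * `|A2r lam m u x y| + b * `|A2r lam m v x y| <=
  N * (lam * m ^+ 2 / (16 * pi) * (gn g 1 y.1 * ((y.1 + x.1) * gn g 2 x.1))).
Proof.
move=> lam0 m0 a0 b0 N0 uv x y x0 y0; have pi0 := pi_gt0 R; have piN := lt0r_neq0 pi0.
rewrite /A2r; apply: (@pair_scale_le R a b _ _ _
    (m / 2 * N * (16 * pi ^+ 2 * (gn g 1 y.1 * ((y.1 + x.1) * gn g 2 x.1))))); last first.
  have lp : 0 <= lam * m / (2 * (4 * pi) ^+ 3).
    apply: divr_ge0; apply: mulr_ge0 => //; apply: exprn_ge0; apply: mulr_ge0 => //.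
    exact: ltW.
  rewrite mulNr normrN ger0_norm// le_eqVlt; apply/orP; left; apply/eqP.
  by move: piN; generalize (pi : R) => p pN; field.
have kN : 0 <= m / 2 * N by rewrite mulr_ge0// divr_ge0.
apply: le_trans (@two_cone_integral_le R g g_gt0 g_nd y.1 x.1 _ x.2 (ltW y0) (ltW x0) kN).
rewrite /int3; apply: Rintegral_pair_le => // p _; apply: Rintegral_pair_le => // z _; rewrite lee_fin.
set d := vnorm (vsub x.2 p); set e := vnorm (vsub p z).
have G0 s : 0 <= gext g s by exact: gext_ge0.
have d0 : 0 <= d := vnorm_ge0 _.
have e0 : 0 <= e := vnorm_ge0 _.
rewrite !big_cons !big_nil !addr0; have [xd|xd] := leP 0 (x.1 - d); last first.
  have hE : heav (x.1 - d) = 0 :> R by rewrite /heav leNgt xd.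
  rewrite hE !mul0r normr0 !mulr0 addr0 mulr_ge0// mulr_ge0//.
    by rewrite divr_ge0// mulr_ge0.
  by rewrite addr_ge0// mulr_ge0// heav_ge0.
have hE : heav (x.1 - d) = 1 :> R by rewrite /heav xd.
rewrite hE /= !mul1r !mulN1r.
apply: le_trans (pair_sum_le a0 b0 _ (@cone_term_le R g g_gt0 g_nd a b m N _ (x.1 - d) _ _ _ _ _ _ _ _ _ _ _ _)
  (@cone_term_le R g g_gt0 g_nd a b m N _ (x.1 - d) _ _ _ _ _ _ _ _ _ _ _ _)) _ => //;
  do ?[exact: vnorm_ge0 | by rewrite invr_ge0 mulr_ge0 | by apply: besselJ1_quot_le => //; exact: sqrtr_ge0].
- by move=> t0; rewrite (mulrC (gext g _)); apply: uv.
- by move=> t0; rewrite (mulrC (gext g _)); apply: uv.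
- by rewrite ?mul1r le_eqVlt; apply/orP; left; apply/eqP; ring.
Qed.

(** Here the vertex is the inner variable. The order is exchanged on the measurable majorant [W],
    never on the operator's own integrand. *)
Lemma A1r_pair_le {R : realType} (g : R -> R) (g_gt0 : forall t, 0 <= t -> 0 < g t)
    (g_nd : forall s t, 0 <= s -> s <= t -> g s <= g t) (lam m a b N : R)
    (u v : Defs.point R -> Defs.point R -> R) : 0 <= lam -> 0 <= m -> 0 <= a -> 0 <= b -> 0 <= N ->
  (forall x y, 0 <= x.1 -> 0 <= y.1 ->
     a * `|u x y| + b * `|v x y| <= N * (gext g x.1 * gext g y.1)) ->
  forall x y, 0 < x.1 -> 0 < y.1 ->
  a * `|A1r lam m u x y| + b * `|A1r lam m v x y| <=
  N * (lam * m ^+ 2 / (16 * pi) * (gn g 1 x.1 * ((x.1 + y.1) * gn g 2 y.1))).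
Proof.
move=> lam0 m0 a0 b0 N0 uv x y x0 y0; have pi0 := pi_gt0 R; have piN := lt0r_neq0 pi0.
rewrite /A1r; apply: (@pair_scale_le R a b _ _ _
    (m / 2 * N * (16 * pi ^+ 2 * (gn g 1 x.1 * ((x.1 + y.1) * gn g 2 y.1))))); last first.
  have lp : 0 <= lam * m / (2 * (4 * pi) ^+ 3).
    apply: divr_ge0; apply: mulr_ge0 => //; apply: exprn_ge0; apply: mulr_ge0 => //.
    exact: ltW.
  rewrite mulNr normrN ger0_norm// le_eqVlt; apply/orP; left; apply/eqP.
  by move: piN; generalize (pi : R) => p pN; field.
have kN : 0 <= m / 2 * N by rewrite mulr_ge0// divr_ge0.
have G0 s : 0 <= gext g s by exact: gext_ge0.
have mG : measurable_fun setT (gext g) by exact: measurable_gext.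
apply: le_trans (@two_cone_integral_le R g g_gt0 g_nd x.1 y.1 _ y.2 (ltW x0) (ltW y0) kN).
pose W (zp : (mV3 R) * (mV3 R)) : R :=
  let d := vnorm (vsub y.2 zp.2) in let e := vnorm (vsub zp.2 zp.1) in
  m / 2 * N * (gext g (y.1 - d) / (d * e) *
     (heav (x.1 - (y.1 - d + e)) * gext g (y.1 - d + e) +
      heav (x.1 - (y.1 - d - e)) * gext g (y.1 - d - e))).
have W0 zp : 0 <= W zp.
  rewrite mulr_ge0// mulr_ge0//; first by rewrite divr_ge0// mulr_ge0// vnorm_ge0.
  by rewrite addr_ge0// mulr_ge0// heav_ge0.
have mW : measurable_fun setT W.
  apply: (measurable_two_cone g_gt0 g_nd).
    exact: (measurable_vdist (measurable_cst _) measurable_snd).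
  exact: (measurable_vdist measurable_snd measurable_fst).
have sw : (\int[mu3 R]_z \int[mu3 R]_p (W (z, p))%:E = \int[mu3 R]_p \int[mu3 R]_z (W (z, p))%:E)%E.
  by apply: (@ge0_integral_mu3_swap R (EFin \o W)); [exact/measurable_EFinP|move=> zp; rewrite lee_fin].
have WE z p : W (z, p) = m / 2 * N *
    (gext g (y.1 - vnorm (vsub y.2 p)) / (vnorm (vsub y.2 p) * vnorm (vsub p z)) *
     (heav (x.1 - (y.1 - vnorm (vsub y.2 p) + vnorm (vsub p z))) *
        gext g (y.1 - vnorm (vsub y.2 p) + vnorm (vsub p z)) +
      heav (x.1 - (y.1 - vnorm (vsub y.2 p) - vnorm (vsub p z))) *
        gext g (y.1 - vnorm (vsub y.2 p) - vnorm (vsub p z)))) by [].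
clearbody W.
apply: (@le_trans _ _ (\int[mu3 R]_z \int[mu3 R]_p (W (z, p))%:E)%E); last first.
  rewrite sw; apply: ge0_le_lower_integral => p _.
    by apply: integral_ge0 => z _; rewrite lee_fin.
  by apply: ge0_le_lower_integral => z _; [rewrite lee_fin|rewrite WE].
rewrite /int3; apply: Rintegral_pair_le => // z _; apply: Rintegral_pair_le => // p _; rewrite lee_fin WE.
set d := vnorm (vsub y.2 p); rewrite (vnorm_vsubC z p); set e := vnorm (vsub p z).
have d0 : 0 <= d := vnorm_ge0 _.
have e0 : 0 <= e := vnorm_ge0 _.
rewrite !big_cons !big_nil !addr0; have [xd|xd] := leP 0 (y.1 - d); last first.
  have hE : heav (y.1 - d) = 0 :> R by rewrite /heav leNgt xd.
  rewrite hE !mul0r normr0 !mulr0 addr0 mulr_ge0// mulr_ge0//.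
    by rewrite divr_ge0// mulr_ge0.
  by rewrite addr_ge0// mulr_ge0// heav_ge0.
have hE : heav (y.1 - d) = 1 :> R by rewrite /heav xd.
rewrite hE /= !mul1r !mulN1r.
apply: le_trans (pair_sum_le a0 b0 _ (@cone_term_le R g g_gt0 g_nd a b m N _ (y.1 - d) _ _ _ _ _ _ _ _ _ _ _ _)
  (@cone_term_le R g g_gt0 g_nd a b m N _ (y.1 - d) _ _ _ _ _ _ _ _ _ _ _ _)) _ => //;
  do ?[exact: vnorm_ge0 | by rewrite invr_ge0 mulr_ge0 | by apply: besselJ1_quot_le => //; exact: sqrtr_ge0].
- by move=> t0; apply: uv.
- by move=> t0; apply: uv.
- by rewrite ?mul1r le_eqVlt; apply/orP; left; apply/eqP; ring.
Qed.

(** * The operator [A_12] with two masses *)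

Lemma ball_heav {R : realType} (T : R) (c : V3 R) :
  (\int[mu3 R]_z (heav (T - vnorm (vsub c z)))%:E =
   (4 / 3 * pi * (if 0 <= T then T ^+ 3 else 0))%:E)%E.
Proof.
case: ifPn => [T0|]; last first.
  rewrite -ltNge => T0; rewrite integral0_eq ?mulr0// => z _.
  rewrite /heav ifF//; apply/negbTE; rewrite -ltNge subr_lt0.
  by apply: lt_le_trans T0 _; exact: vnorm_ge0.
have pi0 := pi_gt0 R.
pose K (r : R) : \bar R := (heav (T - r))%:E.
have mK : measurable_fun setT K.
  apply/measurable_EFinP; apply: (measurableT_comp measurable_heav).
  exact: measurable_funB.
have K0 r : (0 <= K r)%E by rewrite lee_fin heav_ge0.
rewrite (ge0_integral_radial c mK K0).
transitivity (\int[@lebesgue_measure R]_(r in `[0%R, T])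
    ((8 * pi)%:E * ((r - 0) ^+ 2 / 2`!%:R)%:E))%E.
  rewrite [LHS]integral_mkcond [RHS]integral_mkcond; apply: eq_integral => r _.
  rewrite !patchE !mem_setE !in_itv/= andbT /K /heav subr_ge0.
  case: (0 <= r) => //=; case: (r <= T); rewrite ?mule0// mule1 -EFinM; congr EFin.
  by rewrite subr0 !factS fact0 !muln1; field.
rewrite ge0_integralZl//.
- rewrite integral_shifted_power// -EFinM subr0; congr EFin.
  by rewrite !factS fact0 !muln1; field.
- apply/measurable_EFinP; apply: measurable_funM => //.
  by apply: measurable_funX; exact: measurable_funB.
- by move=> r _; rewrite lee_fin divr_ge0// sqr_ge0.
- by rewrite lee_fin mulr_ge0// ltW.
Qed.

(** On [0 <= s <= y0] the distance [|t - s|] is at most [t + y0], independently of [s]. *)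
Lemma A12_inner_le {R : realType} (g : R -> R) (g_gt0 : forall t, 0 <= t -> 0 < g t)
    (g_nd : forall s t, 0 <= s -> s <= t -> g s <= g t) (t y0 q : R) : 0 <= t -> 0 <= y0 -> 0 <= q ->
  (\int[@lebesgue_measure R]_(s in `[0%R, +oo[)
     (q * (`|t - s| * (heav (y0 - s) * gext g s)))%:E <=
   (q * ((t + y0) * gn g 1 y0))%:E)%E.
Proof.
move=> t0 y00 q0.
have G0 s : 0 <= gext g s by exact: gext_ge0.
have mG : measurable_fun setT (gext g) by exact: measurable_gext.
apply: (@le_trans _ _ (\int[@lebesgue_measure R]_(s in `[0%R, y0])
    ((q * (t + y0))%:E * (gext g s)%:E))%E).
  rewrite [leLHS]integral_mkcond [leRHS]integral_mkcond.
  apply: ge0_le_lower_integral => s _; rewrite !patchE !mem_setE !in_itv/= andbT.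
    by case: ifPn => // s0; rewrite lee_fin mulr_ge0// mulr_ge0// mulr_ge0// heav_ge0.
  have [s0|//] := leP 0 s; rewrite /heav subr_ge0 /=.
  have [sy|sy] := leP s y0; last by rewrite mul0r !mulr0.
  rewrite mul1r -EFinM lee_fin -!mulrA ler_wpM2l// ler_wpM2r//.
  by apply: le_trans (ler_normB _ _) _; rewrite !ger0_norm// lerD2l.
rewrite ge0_integralZl//; last 3 first.
- by apply/measurable_EFinP; apply: measurable_funS mG.
- by move=> s _; rewrite lee_fin.
- by rewrite lee_fin mulr_ge0// addr_ge0.
by rewrite gn1E// -EFinM lee_fin mulrA.
Qed.

(** With [w = x0 - t], the factor [w ^+ 3 * (t + y0)] is split as
    [w * (w ^+ 2 * y0) + w ^+ 2 * (w * t)]. Bounding the brackets by [x0 ^+ 2 * y0] and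
    [x0 ^+ 2 / 4] leaves the Cauchy weights [w] of [g_2] and [w ^+ 2 / 2] of [g_3]. *)
Lemma A12_outer_le {R : realType} (g : R -> R) (g_gt0 : forall t, 0 <= t -> 0 < g t)
    (g_nd : forall s t, 0 <= s -> s <= t -> g s <= g t) (x0 y0 q : R) : 0 <= x0 -> 0 <= y0 -> 0 <= q ->
  (\int[@lebesgue_measure R]_(t in `[0%R, +oo[)
     (q * (gext g t * (t + y0) * (if 0 <= x0 - t then (x0 - t) ^+ 3 else 0)))%:E <=
   (q * (x0 ^+ 2 * y0 * gn g 2 x0 + x0 ^+ 2 / 2 * gn g 3 x0))%:E)%E.
Proof.
move=> x00 y00 q0.
have G0 s : 0 <= gext g s by exact: gext_ge0.
have mG : measurable_fun setT (gext g) by exact: measurable_gext.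
pose A t := (x0 - t) ^+ 1 / 1`!%:R * gext g t; pose B t := (x0 - t) ^+ 2 / 2`!%:R * gext g t.
have mA : measurable_fun setT A.
  apply: measurable_funM => //; apply: measurable_funM => //.
  by apply: measurable_funX; exact: measurable_funB.
have mB : measurable_fun setT B.
  apply: measurable_funM => //; apply: measurable_funM => //.
  by apply: measurable_funX; exact: measurable_funB.
have A0 t : `[0, x0]%classic t -> 0 <= A t.
  rewrite /= in_itv/= => /andP[_ tx].
  by rewrite mulr_ge0// divr_ge0// exprn_ge0// subr_ge0.
have B0 t : `[0, x0]%classic t -> 0 <= B t.
  rewrite /= in_itv/= => /andP[_ tx].
  by rewrite mulr_ge0// divr_ge0// exprn_ge0// subr_ge0.
pose c1 := q * (x0 ^+ 2 * y0); pose c2 := q * (x0 ^+ 2 / 2).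
have c10 : 0 <= c1 by rewrite mulr_ge0// mulr_ge0// sqr_ge0.
have c20 : 0 <= c2 by rewrite mulr_ge0// divr_ge0// sqr_ge0.
apply: (@le_trans _ _ (\int[@lebesgue_measure R]_(t in `[0%R, x0])
    (c1%:E * (A t)%:E + c2%:E * (B t)%:E))%E).
  rewrite [leLHS]integral_mkcond [leRHS]integral_mkcond.
  apply: ge0_le_lower_integral => t _; rewrite !patchE !mem_setE !in_itv/= andbT.
    case: ifPn => // t0; rewrite lee_fin mulr_ge0// mulr_ge0//.
      by rewrite mulr_ge0// addr_ge0.
    by case: ifPn => // ?; exact: exprn_ge0.
  have [t0|//] := leP 0 t; rewrite subr_ge0 /=.
  have [tx|tx] := leP t x0; last by rewrite !mulr0.
  rewrite -!EFinM -EFinD lee_fin /c1 /c2 /A /B !factS fact0 !muln1 expr1 divr1.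
  have -> : q * (x0 ^+ 2 * y0) * ((x0 - t) * gext g t) +
      q * (x0 ^+ 2 / 2) * ((x0 - t) ^+ 2 / 2 * gext g t) =
      q * (gext g t * ((x0 - t) * (x0 ^+ 2 * y0 + x0 ^+ 2 / 4 * (x0 - t)))) by field.
  rewrite ler_wpM2l// -mulrA ler_wpM2l// exprS mulrCA.
  have w0 : 0 <= x0 - t by rewrite subr_ge0.
  rewrite ler_wpM2l//.
  have wx : x0 - t <= x0 by rewrite gerBl.
  have h1 : (x0 - t) ^+ 2 * y0 <= x0 ^+ 2 * y0 by rewrite ler_wpM2r// lerXn2r ?nnegrE.
  (* The arithmetic-geometric mean inequality for two numbers of sum [x0]. Half of the resulting
     [1 / 4] belongs to the Cauchy weight of [g_3]; the other half is the [1 / 2] in the bound. *)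
  have h2 : (x0 - t) * t <= x0 ^+ 2 / 4.
    rewrite -subr_ge0 (_ : _ - _ = ((x0 / 2 - t) ^+ 2)) ?sqr_ge0//.
    by field.
  rewrite mulrDl addrC mulrC; apply: lerD => //.
  rewrite (_ : t * _ = (x0 - t) * t * (x0 - t)); last by ring.
  exact: ler_wpM2r.
have mA' : measurable_fun `[0, x0] (fun t => (A t)%:E).
  by apply/measurable_EFinP; apply: measurable_funS mA.
have mB' : measurable_fun `[0, x0] (fun t => (B t)%:E).
  by apply/measurable_EFinP; apply: measurable_funS mB.
rewrite ge0_integralD//; last 4 first.
- by move=> t t0; rewrite mule_ge0// lee_fin// A0.
- by apply: emeasurable_funM.
- by move=> t t0; rewrite mule_ge0// lee_fin// B0.
- by apply: emeasurable_funM.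
rewrite !ge0_integralZl//.
rewrite -(gnE g_gt0 g_nd 1 x00) -(gnE g_gt0 g_nd 2 x00) -!EFinM -EFinD lee_fin /c1 /c2.
by rewrite le_eqVlt; apply/orP; left; apply/eqP; ring.
Qed.

Lemma A12r_pair_le {R : realType} (g : R -> R) (g_gt0 : forall t, 0 <= t -> 0 < g t)
    (g_nd : forall s t, 0 <= s -> s <= t -> g s <= g t) (lam m1 m2 a b N : R)
    (u v : Defs.point R -> Defs.point R -> R) :
  0 <= lam -> 0 <= m1 -> 0 <= m2 -> 0 <= a -> 0 <= b -> 0 <= N ->
  (forall x y, 0 <= x.1 -> 0 <= y.1 ->
     a * `|u x y| + b * `|v x y| <= N * (gext g x.1 * gext g y.1)) ->
  forall x y, 0 < x.1 -> 0 < y.1 ->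
  a * `|A12r lam m1 m2 u x y| + b * `|A12r lam m1 m2 v x y| <=
  N * (lam * m1 ^+ 2 * m2 ^+ 2 / (96 * pi) *
    (x.1 ^+ 2 * gn g 2 x.1 * (y.1 * gn g 1 y.1) + 1 / 2 * (x.1 ^+ 2 * gn g 3 x.1 * gn g 1 y.1))).
Proof.
move=> lam0 m10 m20 a0 b0 N0 uv x y x0 y0; have pi0 := pi_gt0 R.
have piN : pi != 0 :> R by rewrite gt_eqF.
pose K := m1 / 2 * (m2 / 2) * N * (16 * pi ^+ 2 / 3) * gn g 1 y.1.
unfold A12r; apply: (@pair_scale_le R a b _ _ _
    (K * (x.1 ^+ 2 * y.1 * gn g 2 x.1 + x.1 ^+ 2 / 2 * gn g 3 x.1))); last first.
  have lp : 0 <= lam * m1 * m2 / (2 * (4 * pi) ^+ 3).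
    apply: divr_ge0; first by rewrite !mulr_ge0.
    by apply: mulr_ge0 => //; apply: exprn_ge0; apply: mulr_ge0 => //; exact: ltW.
  rewrite ger0_norm// /K le_eqVlt; apply/orP; left; apply/eqP.
  by move: piN; generalize (pi : R) => p pN; field.
have G0 s : 0 <= gext g s by exact: gext_ge0.
have gy : 0 <= gn g 1 y.1 by apply: gn_ge0 => //; exact: ltW.
pose kk := m1 / 2 * (m2 / 2) * N.
have kk0 : 0 <= kk by rewrite mulr_ge0// mulr_ge0// divr_ge0.
have p2 : 0 <= 16 * pi ^+ 2 / 3 :> R by rewrite divr_ge0// mulr_ge0// sqr_ge0.
have K0 : 0 <= K by rewrite mulr_ge0// mulr_ge0.
apply: le_trans (A12_outer_le g_gt0 g_nd (ltW x0) (ltW y0) K0).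
rewrite /int_half; apply: Rintegral_pair_le => // t /=; rewrite in_itv/= andbT => t0.
pose C2 := 4 * pi * kk * gext g t * ((t + y.1) * gn g 1 y.1).
have ty : 0 <= t + y.1 by rewrite addr_ge0// ltW.
have C20 : 0 <= C2.
  apply: mulr_ge0; last exact: mulr_ge0.
  by apply: mulr_ge0 => //; apply: mulr_ge0 => //; apply: mulr_ge0 => //; exact: ltW.
have mhd : measurable_fun [set: (mV3 R)]
    (fun z : (mV3 R) => (heav (x.1 - t - vnorm (vsub x.2 z)))%:E).
  apply/measurable_EFinP; apply: (measurableT_comp measurable_heav).
  by apply: measurable_funB => //; exact: measurable_dist.
rewrite (_ : (K * _)%:E = (\int[mu3 R]_z (C2%:E * (heav (x.1 - t - vnorm (vsub x.2 z)))%:E))%E); last first.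
  rewrite ge0_integralZl//; last by move=> z _; rewrite lee_fin heav_ge0.
  by rewrite ball_heav -EFinM /K /C2 /kk; congr EFin; move: (if _ then _ else _) => cu;
    generalize (pi : R) => p; field.
rewrite /int3; apply: Rintegral_pair_le => // z _; set n := vnorm (vsub x.2 z).
pose q := 4 * pi * kk * gext g t * heav (x.1 - t - n).
have q0 : 0 <= q.
  apply: mulr_ge0; last exact: heav_ge0.
  by apply: mulr_ge0 => //; apply: mulr_ge0 => //; apply: mulr_ge0 => //; exact: ltW.
rewrite -EFinM (_ : C2 * _ = q * ((t + y.1) * gn g 1 y.1)); last by rewrite /C2 /q; ring.
apply: le_trans (A12_inner_le g_gt0 g_nd t0 (ltW y0) q0).
apply: Rintegral_pair_le => // s /=; rewrite in_itv/= andbT => s0.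
(* The light cone condition on [y'] is weakened to [s <= y.1]. The majorant is then constant on the
   sphere, which contributes its area, and the axis may be any unit vector. *)
pose F := kk * gext g t * heav (x.1 - t - n) * (`|t - s| * (heav (y.1 - s) * gext g s)).
have F0 : 0 <= F.
  apply: mulr_ge0; last by rewrite mulr_ge0// mulr_ge0// heav_ge0.
  by rewrite mulr_ge0 ?heav_ge0// mulr_ge0.
have e1 : vdot (0, 0, 1) (0, 0, 1) = 1 :> R by rewrite /vdot/= !mul0r !add0r mul1r.
apply: le_trans (@int_S2_pair_le R _ _ (0, 0, 1) (fun=> F) a b a0 b0 e1 _ _ _) _ => //; last first.
  rewrite integral_cst//= lebesgue_measure_itv/= lte_fin ifT; last by rewrite (lt_trans (ltrN10 _) ltr01).
  by rewrite -EFinD -!EFinM lee_fin /F /q le_eqVlt; apply/orP; left; apply/eqP; ring.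
move=> w /=; rewrite pair_scale.
set hx := heav _; set J1 := _ / _; set hy := heav _; set J2 := _ / _.
have J1m : `|J1| <= m1 / 2 by apply: besselJ1_quot_le => //; exact: sqrtr_ge0.
have J2m : `|J2| <= m2 / 2 by apply: besselJ1_quot_le => //; exact: sqrtr_ge0.
have hx0 : 0 <= hx by exact: heav_ge0.
have hy0 : 0 <= hy by exact: heav_ge0.
have hyle : hy <= heav (y.1 - s).
  rewrite /hy {1}/heav; case: ifPn => [ys|_]; last exact: heav_ge0.
  by rewrite /heav ifT//; apply: le_trans ys _; rewrite gerBl vnorm_ge0.
have hxE : hx = heav (x.1 - t - n) by [].
clearbody hx hy J1 J2.
rewrite !normrM normr_id (ger0_norm hx0) (ger0_norm hy0).
apply: (@le_trans _ _ (`|t - s| * (hx * (m1 / 2)) * (heav (y.1 - s) * (m2 / 2)) *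
    (N * (gext g t * gext g s)))).
  apply: ler_pM; [|by rewrite addr_ge0// mulr_ge0| |exact: uv].
    by apply: mulr_ge0; [apply: mulr_ge0 => //|]; exact: mulr_ge0.
  apply: ler_pM; [by rewrite mulr_ge0// mulr_ge0|by rewrite mulr_ge0| |by apply: ler_pM].
  by rewrite ler_wpM2l// ler_wpM2l.
by rewrite /F /kk -hxE le_eqVlt; apply/orP; left; apply/eqP; ring.
Qed.

(** * Passage to the weighted norm *)

(** The modulus of [psi] bounds all its pair combinations with one [N], the operator keeps these
    bounds, and their supremum over [a] and [b] is the modulus of the image. The norm of [psi] is a
    real [N], while [C] may be infinite. *)
Lemma gwnorm_op_le {R : realType} (g : R -> R) (g_gt0 : forall t, 0 <= t -> 0 < g t)
    (g_nd : forall s t, 0 <= s -> s <= t -> g s <= g t)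
    (A : (Defs.point R -> Defs.point R -> R) -> Defs.point R -> Defs.point R -> R)
    (B : R -> R -> R) (C : \bar R) (M : R) (psi : cfun R) :
  (forall t, 0 <= t -> (g t)^-1 <= M) ->
  (forall a b N u v, 0 <= a -> 0 <= b -> 0 <= N ->
    (forall x y, 0 <= x.1 -> 0 <= y.1 ->
       a * `|u x y| + b * `|v x y| <= N * (gext g x.1 * gext g y.1)) ->
    forall x y, 0 < x.1 -> 0 < y.1 ->
      a * `|A u x y| + b * `|A v x y| <= N * B x.1 y.1) ->
  (forall x y, 0 < x -> 0 < y -> ((B x y / (g x * g y))%:E <= C)%E) ->
  schwartz_half psi -> (gwnorm g (lift_op A psi) <= C * gwnorm g psi)%E.
Proof.
move=> gM AB BC spsi; have [N N0 EN] := gwnorm_fin g_gt0 g_nd gM spsi.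
have leN : (gwnorm g psi <= N%:E)%E by rewrite EN.
rewrite EN; apply: gwnorm_le => x y x0 y0.
have cle : cmod (lift_op A psi x y) <= N * B x.1 y.1.
  apply: cmod_le_pair => a b a0 b0 ab; apply: AB => // x' y' x'0 y'0.
  apply: le_trans (pair_le_cmod _ _ a0 b0 ab) _.
  by rewrite -surjective_pairing; exact: (gwnorm_pointwise g_gt0 g_nd spsi leN).
have gg : 0 <= (g x.1 * g y.1)^-1.
  by rewrite invr_ge0 mulr_ge0// ltW// g_gt0// ltW.
apply: (@le_trans _ _ (N%:E * (B x.1 y.1 / (g x.1 * g y.1))%:E)%E).
  by rewrite -EFinM lee_fin mulrA ler_wpM2r.
by rewrite muleC lee_wpmul2r ?lee_fin// BC.
Qed.

Lemma supt_ub {R : realType} (h : R -> R) (t : R) : 0 <= t -> ((h t)%:E <= supt h)%E.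
Proof.
by move=> t0; apply: ereal_sup_ubound; exists t => //=; rewrite in_itv/= t0.
Qed.

(** The integrals produce the first two products with coefficient 1, so the coefficients 3 and the
    nonnegative third term leave room. Nonnegativity makes the products monotone even when a
    supremum is [+oo]. *)
Lemma mass_term_bound {R : realType} (ts1 s2 s1 ts2 s3 p1 p2 p3 p4 : \bar R) :
  (0 <= s3 -> 0 <= p1 -> 0 <= p2 -> 0 <= p3 -> 0 <= p4 ->
   p1 <= ts1 -> p2 <= s2 -> p3 <= s1 -> p4 <= ts2 ->
   p1 * p2 + p3 * p4 <= 3%:E * ts1 * s2 + 3%:E * s1 * ts2 + 2%:E * s1 * s3)%E.
Proof.
move=> s30 p10 p20 p30 p40 h1 h2 h3 h4.
have three (p q : \bar R) : (0 <= p -> p <= q -> p <= 3%:E * q)%E.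
  move=> p0 pq; apply: (le_trans pq); apply: lee_pemull; first exact: le_trans pq.
  by rewrite lee_fin ler1n.
have s10 : (0 <= s1)%E by exact: le_trans h3.
apply: (@le_trans _ _ (3%:E * ts1 * s2 + 3%:E * s1 * ts2)%E).
  by apply: leeD; apply: lee_pmul => //; exact: three.
by apply: leeDl; rewrite !mule_ge0.
Qed.

Theorem theorem1 (R : realType) (lam m1 m2 : R) (g : R -> R) :
  0 < lam -> 0 <= m1 -> 0 <= m2 ->
  (forall t, 0 <= t -> 0 < g t) ->
  (forall s t, 0 <= s -> s <= t -> g s <= g t) ->
  (exists M : R, forall t, 0 <= t -> (g t)^-1 <= M) ->
  let s1 := supt (fun t => gn g 1 t / g t) in
  let s2 := supt (fun t => gn g 2 t / g t) in
  let s3 := supt (fun t => gn g 3 t / g t) in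
  let ts1 := supt (fun t => t * gn g 1 t / g t) in
  let ts2 := supt (fun t => t * gn g 2 t / g t) in
  let tts2 := supt (fun t => t ^+ 2 * gn g 2 t / g t) in
  let tts3 := supt (fun t => t ^+ 2 * gn g 3 t / g t) in
  let C0 := ((lam / (8 * pi))%:E * (s1 * s1))%E in
  let C1 := ((lam * m1 ^+ 2 / (16 * pi))%:E *
             (3%:E * ts1 * s2 + 3%:E * s1 * ts2 + 2%:E * s1 * s3))%E in
  let C2 := ((lam * m2 ^+ 2 / (16 * pi))%:E *
             (3%:E * ts1 * s2 + 3%:E * s1 * ts2 + 2%:E * s1 * s3))%E in
  let C12 := ((lam * m1 ^+ 2 * m2 ^+ 2 / (96 * pi))%:E *
              (tts2 * ts1 + (1 / 2)%:E * tts3 * s1))%E in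
  forall psi : cfun R, schwartz_half psi ->
    [/\ (gwnorm g (A0 lam psi) <= C0 * gwnorm g psi)%E,
        (gwnorm g (A1 lam m1 psi) <= C1 * gwnorm g psi)%E,
        (gwnorm g (A2 lam m2 psi) <= C2 * gwnorm g psi)%E &
        (gwnorm g (A12 lam m1 m2 psi) <= C12 * gwnorm g psi)%E].
Proof.
move=> lam0 m10 m20 g_gt0 g_nd [M gM] s1 s2 s3 ts1 ts2 tts2 tts3 C0 C1 C2 C12 psi spsi.
have lamW := ltW lam0; have piW := ltW (pi_gt0 R).
have nn (i n : nat) t : 0 <= t -> 0 <= t ^+ i * gn g n t / g t.
  move=> t0; rewrite mulr_ge0 ?invr_ge0//; last by rewrite ltW// g_gt0.
  by rewrite mulr_ge0 ?exprn_ge0//; exact: gn_ge0.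
have n0 n t : 0 <= t -> (0 <= (gn g n t / g t)%:E)%E.
  by move=> t0; rewrite lee_fin; have := nn 0 n t t0; rewrite expr0 mul1r.
have n1 n t : 0 <= t -> (0 <= (t * gn g n t / g t)%:E)%E.
  by move=> t0; rewrite lee_fin; have := nn 1 n t t0; rewrite expr1.
have n2 n t : 0 <= t -> (0 <= (t ^+ 2 * gn g n t / g t)%:E)%E.
  by move=> t0; rewrite lee_fin; exact: nn.
have s30 : (0 <= s3)%E.
  exact: le_trans (n0 3 0 (lexx _)) (@supt_ub R (fun t => gn g 3 t / g t) 0 (lexx _)).
split.
- apply: (@gwnorm_op_le R g g_gt0 g_nd (A0r lam)
    (fun x y => lam / (8 * pi) * (gn g 1 x * gn g 1 y)) _ M psi gM _ _ spsi).
    by move=> a b N u v a0 b0 N0 uv x y x0 y0; exact: (A0r_pair_le g_gt0 g_nd lamW).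
  move=> x y /ltW x0 /ltW y0.
  rewrite (_ : _ / _ = lam / (8 * pi) * ((gn g 1 x / g x) * (gn g 1 y / g y))); last first.
    by rewrite !invfM; ring.
  rewrite EFinM; apply: lee_wpmul2l; first by rewrite lee_fin divr_ge0// mulr_ge0.
  exact: (lee_pmul (n0 1 x x0) (n0 1 y y0) (@supt_ub R (fun t => gn g 1 t / g t) _ x0)
    (@supt_ub R (fun t => gn g 1 t / g t) _ y0)).
- apply: (@gwnorm_op_le R g g_gt0 g_nd (A1r lam m1)
    (fun x y => lam * m1 ^+ 2 / (16 * pi) * (gn g 1 x * ((x + y) * gn g 2 y))) _ M psi gM _ _ spsi).
    by move=> a b N u v a0 b0 N0 uv x y x0 y0; exact: (A1r_pair_le g_gt0 g_nd lamW).
  move=> x y /ltW x0 /ltW y0.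
  (* Splitting [x + y] turns the bound into products of a function of [x] and a function of [y],
     each below its own supremum. *)
  rewrite (_ : _ / _ = lam * m1 ^+ 2 / (16 * pi) * ((x * gn g 1 x / g x) * (gn g 2 y / g y) +
    (gn g 1 x / g x) * (y * gn g 2 y / g y))); last by rewrite !invfM; ring.
  rewrite EFinM; apply: lee_wpmul2l.
    by rewrite lee_fin divr_ge0// mulr_ge0// sqr_ge0.
  exact: (mass_term_bound s30 (n1 1 x x0) (n0 2 y y0) (n0 1 x x0) (n1 2 y y0)
    (@supt_ub R (fun t => t * gn g 1 t / g t) _ x0) (@supt_ub R (fun t => gn g 2 t / g t) _ y0)
    (@supt_ub R (fun t => gn g 1 t / g t) _ x0) (@supt_ub R (fun t => t * gn g 2 t / g t) _ y0)).
- apply: (@gwnorm_op_le R g g_gt0 g_nd (A2r lam m2)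
    (fun x y => lam * m2 ^+ 2 / (16 * pi) * (gn g 1 y * ((y + x) * gn g 2 x))) _ M psi gM _ _ spsi).
    by move=> a b N u v a0 b0 N0 uv x y x0 y0; exact: (A2r_pair_le g_gt0 g_nd lamW).
  move=> x y /ltW x0 /ltW y0.
  rewrite (_ : _ / _ = lam * m2 ^+ 2 / (16 * pi) * ((y * gn g 1 y / g y) * (gn g 2 x / g x) +
    (gn g 1 y / g y) * (x * gn g 2 x / g x))); last by rewrite !invfM; ring.
  rewrite EFinM; apply: lee_wpmul2l.
    by rewrite lee_fin divr_ge0// mulr_ge0// sqr_ge0.
  exact: (mass_term_bound s30 (n1 1 y y0) (n0 2 x x0) (n0 1 y y0) (n1 2 x x0)
    (@supt_ub R (fun t => t * gn g 1 t / g t) _ y0) (@supt_ub R (fun t => gn g 2 t / g t) _ x0)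
    (@supt_ub R (fun t => gn g 1 t / g t) _ y0) (@supt_ub R (fun t => t * gn g 2 t / g t) _ x0)).
- apply: (@gwnorm_op_le R g g_gt0 g_nd (A12r lam m1 m2)
    (fun x y => lam * m1 ^+ 2 * m2 ^+ 2 / (96 * pi) * (x ^+ 2 * gn g 2 x * (y * gn g 1 y) +
      1 / 2 * (x ^+ 2 * gn g 3 x * gn g 1 y))) _ M psi gM _ _ spsi).
    by move=> a b N u v a0 b0 N0 uv x y x0 y0; exact: (A12r_pair_le g_gt0 g_nd lamW).
  move=> x y /ltW x0 /ltW y0.
  have E (k p q r s h c d : R) : k * (p * q + h * (r * s)) / (c * d) =
      k * ((p / c) * (q / d) + (h * (r / c)) * (s / d)) by rewrite invfM; ring.
  rewrite E.
  rewrite EFinM; apply: lee_wpmul2l.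
    by rewrite lee_fin divr_ge0 ?mulr_ge0 ?sqr_ge0.
  have h0 : (0 <= (1 / 2)%:E :> \bar R)%E by rewrite lee_fin divr_ge0.
  exact: (leeD
    (lee_pmul (n2 2 x x0) (n1 1 y y0) (@supt_ub R (fun t => t ^+ 2 * gn g 2 t / g t) _ x0)
      (@supt_ub R (fun t => t * gn g 1 t / g t) _ y0))
    (lee_pmul (mule_ge0 h0 (n2 3 x x0)) (n0 1 y y0)
      (lee_wpmul2l h0 (@supt_ub R (fun t => t ^+ 2 * gn g 3 t / g t) _ x0))
      (@supt_ub R (fun t => gn g 1 t / g t) _ y0))).
Qed.
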